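(* Let $M$ be a generic $CR$ submanifold, of type $(n,k)$, of a complex manifold $\tilde M$. Let $x_0$ be a point of $M$, let $\xi_0\in\dot H^0_{x_0}M$ be a regular point of $\dot H^0M$, and let $m$ be the rank of the Levi form $\mathcal L_{\xi_0}$. Then there exist an open neighborhood $\tilde\omega$ of $x_0$ in $\tilde M$ (with holomorphic coordinates $z^1,\dots,z^{n+k}$ in $\tilde\omega$), an $(n-m)$-dimensional complex submanifold $W$ of $\tilde\omega$ with $$x_0\in W\subset M\cap\tilde\omega,$$ and a real valued smooth function $\rho:\tilde\omega\to\mathbb R$ with $\rho(x)=0$ for $x\in M\cap\tilde\omega$, $d^c\rho(x_0)=\xi_0$, and such that $\left.\dfrac{\partial\rho}{\partial z^\alpha}\right|_{W}$ is holomorphic in $W$ for $\alpha=1,\dots,n+k$.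
   Context: Let $\tilde M$ be a complex manifold of complex dimension $n+k$ with complex structure $\mathcal J:T\tilde M\to T\tilde M$. A generic $CR$ submanifold $M\subset\tilde M$ of type $(n,k)$ is a smooth real submanifold of real dimension $2n+k$ which is locally defined by $\rho_1=\cdots=\rho_k=0$ with $\rho_j$ smooth real valued functions satisfying $\partial\rho_1\wedge\cdots\wedge\partial\rho_k\ne0$; it carries the $CR$ structure $H_xM=T_xM\cap\mathcal J(T_xM)$ (real rank $2n$) with $J=\mathcal J|_{HM}$. The characteristic bundle is $H^0M=\{\xi\in T^*M\mid\langle X,\xi\rangle=0\ \forall X\in H_{\pi(\xi)}M\}$, with projection $\pi:H^0M\to M$; $\dot H^0M$ is the open subset of nonzero covectors. For $\xi\in H^0_xM$ the Levi form is $\mathcal L_\xi(X)=\xi([J\tilde X,\tilde X])=d\tilde\xi(X,JX)$, $X\in H_xM$, where $\tilde\xi$ is a section of $H^0M$ extending $\xi$ and $\tilde X$ a section of $HM$ extending $X$; it is Hermitian for the complex structure $J$ on $H_xM\simeq\mathbb C^n$, and its rank is its rank as a Hermitian form. With $d^c=(\partial-\bar\partial)/i$, the bundle $H^0M$ is regarded as embedded in $T^*\tilde M$ by identifying it locally with $\{(x,\sum_{j=1}^ka^jd^c\rho_j(x))\mid x\in M,\ a^1,\dots,a^k\in\mathbb R\}$ (restriction of these covectors to $T_xM$ gives the isomorphism with $H^0_xM$). Regular points: let $\vartheta$ be the tautological $1$-form on $H^0M$, $\vartheta(X)=\xi(\pi_*X)$ for $X\in T_\xi H^0M$. Set $N_\xi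 H^0M=\{X\in T_\xi H^0M\mid\vartheta(X)=0\}$ and $H_\xi H^0M=\{X\in N_\xi H^0M\mid d\vartheta(X,Y)=0\ \forall Y\in T_\xi H^0M\}$. A point $\xi_0\in\dot H^0M$ is regular if there are an open neighborhood $U$ of $\xi_0$ in $\dot H^0M$ and a smooth submanifold $V$ of $U$ with $\xi_0\in V$, $T_\xi V\subset H_\xi H^0M$ for all $\xi\in V$, and $T_{\xi_0}V=H_{\xi_0}H^0M$. *)

(* Defs.v *)
From HB Require Import structures.
From mathcomp Require Import all_boot all_order all_algebra.
From mathcomp Require Import complex.
From mathcomp Require Import all_classical all_reals all_analysis.

Set Implicit Arguments.
Unset Strict Implicit.
Unset Printing Implicit Defensive.

Import Order.TTheory GRing.Theory Num.Theory.
Import numFieldNormedType.Exports.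

Local Open Scope classical_set_scope.
Local Open Scope ring_scope.
Local Open Scope complex_scope.

(** * Smooth maps, submanifolds and tangent spaces in R^d *)

(* The partial derivatives of [f] of all orders; a word [s] in the coordinate
   indices is a multi-index. *)
Fixpoint iter_partial (R : realType) (d : nat) (V : normedModType R)
    (s : seq 'I_d) (f : 'rV[R]_d -> V) : 'rV[R]_d -> V :=
  if s is i :: s' then fun p => 'D_(delta_mx 0 i) (iter_partial s' f) p else f.

(* C^infinity on [U]; meant for open [U]. *)
Definition smooth_on (R : realType) (d : nat) (V : normedModType R)
    (U : set 'rV[R]_d) (f : 'rV[R]_d -> V) : Prop :=
  forall (s : seq 'I_d) p, U p -> differentiable (iter_partial s f) p.

Definition diffeo (R : realType) (d : nat) (U U' : set 'rV[R]_d)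
    (f g : 'rV[R]_d -> 'rV[R]_d) : Prop :=
  [/\ open U /\ open U', f @` U = U', (forall p, U p -> g (f p) = p),
      smooth_on U f & smooth_on U' g].

(* [u *m pid_mx d] is (u_1, .., u_d, 0, .., 0). *)
Definition smooth_submanifold (R : realType) (D d : nat) (V : set 'rV[R]_D) :
    Prop :=
  forall p, V p -> exists U U' f g,
    [/\ U p, diffeo U U' f g &
        f @` (V `&` U) =
        U' `&` range (fun u : 'rV[R]_d => u *m pid_mx d : 'rV[R]_D)].

(* Velocities at [p] of the smooth curves lying on [S]; for an embedded
   submanifold [S] this is the tangent space at [p]. *)
Definition tangent (R : realType) (D : nat) (S : set 'rV[R]_D) (p : 'rV[R]_D) :
    set 'rV[R]_D :=
  [set v | exists (e : R) (gam : R -> 'rV[R]_D),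
     [/\ 0 < e,
         forall (j : nat) t, `|t| < e -> derivable (derive1n j gam) t 1,
         forall t, `|t| < e -> S (gam t),
         gam 0 = p & derive1 gam 0 = v]].

Definition pairing (R : realType) (D : nat) (xi v : 'rV[R]_D) : R :=
  (xi *m v^T) 0 0.

(* Exterior derivative of the 1-form [w], where [w p] is the value of the form
   at [p] as a function of the tangent vector: the invariant formula
   dw(X, Y) = X (w Y) - Y (w X) - w [X, Y] with X and Y constant. *)
Definition ext_d (R : realType) (D : nat) (w : 'rV[R]_D -> 'rV[R]_D -> R)
    (p X Y : 'rV[R]_D) : R :=
  'D_X (fun q => w q Y) p - 'D_Y (fun q => w q X) p.

(** * C^N as R^(N + N) *)

(* The point z = x + i y of C^N is the real row vector (x, y); [Jmul] is
   multiplication by i. *)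
Notation Cspace R N := 'rV[R]_(N + N).

Definition Jmul (R : realType) (N : nat) (v : Cspace R N) : Cspace R N :=
  row_mx (- rsubmx v) (lsubmx v).

Definition real_coords (R : realType) (N : nat) (w : 'rV[R[i]]_N) :
    Cspace R N :=
  row_mx (map_mx (@complex.Re R) w) (map_mx (@complex.Im R) w).

(* Smooth with complex linear differential. *)
Definition holomorphic_on (R : realType) (a b : nat) (U : set (Cspace R a))
    (f : Cspace R a -> Cspace R b) : Prop :=
  smooth_on U f /\
  forall p v, U p -> 'd f p (Jmul v) = Jmul ('d f p v).

Definition holomorphic_fun (R : realType) (a : nat) (U : set (Cspace R a))
    (f : Cspace R a -> R[i]) : Prop :=
  holomorphic_on U (fun p => real_coords (const_mx (f p) : 'rV[R[i]]_1)).

(* The inclusion of C^d = C^d x 0 into C^N. *)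
Definition Cincl (R : realType) (d N : nat) (u : Cspace R d) : Cspace R N :=
  row_mx (lsubmx u *m pid_mx d) (rsubmx u *m pid_mx d).

Definition partial_x (R : realType) (N : nat) (f : Cspace R N -> R)
    (p : Cspace R N) (a : 'I_N) : R := 'D_(delta_mx 0 (lshift N a)) f p.

Definition partial_y (R : realType) (N : nat) (f : Cspace R N -> R)
    (p : Cspace R N) (a : 'I_N) : R := 'D_(delta_mx 0 (rshift N a)) f p.

(* df/dz^a = (df/dx^a - i df/dy^a) / 2, for a real valued [f]. *)
Definition dz (R : realType) (N : nat) (f : Cspace R N -> R)
    (p : Cspace R N) (a : 'I_N) : R[i] :=
  (partial_x f p a / 2) +i* (- (partial_y f p a / 2)).

(* d^c f = (d' f - d'' f) / i.  Since f is real, d'' f is the conjugate of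
   d' f, so d^c f = 2 Im (sum_a df/dz^a (dx^a + i dy^a))
                  = sum_a (df/dx^a dy^a - df/dy^a dx^a);
   real covectors are given by their components on (dx, dy). *)
Definition dc (R : realType) (N : nat) (f : Cspace R N -> R)
    (p : Cspace R N) : Cspace R N :=
  row_mx (\row_a - partial_y f p a) (\row_a partial_x f p a).

(** * Complex manifolds *)

Record chart (R : realType) (X : topologicalType) (N : nat) := Chart {
  cdom : set X;
  cmap : X -> Cspace R N;
  cinv : Cspace R N -> X;
  cdom_open : open cdom;
  cimg_open : open (cmap @` cdom);
  cmapK : forall x, cdom x -> cinv (cmap x) = x;
  cmap_continuous : {within cdom, continuous cmap};
  cinv_continuous : {within cmap @` cdom, continuous cinv} }.

Definition cimg (R : realType) (X : topologicalType) (N : nat)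
    (c : chart R X N) : set (Cspace R N) := cmap c @` cdom c.

Definition compatible (R : realType) (X : topologicalType) (N : nat)
    (c c' : chart R X N) : Prop :=
  holomorphic_on (cmap c @` (cdom c `&` cdom c')) (cmap c' \o cinv c) /\
  holomorphic_on (cmap c' @` (cdom c `&` cdom c')) (cmap c \o cinv c').

Record complex_manifold (R : realType) (N : nat) := ComplexManifold {
  cm_space :> topologicalType;
  cm_hausdorff : hausdorff_space cm_space;
  cm_countable : @second_countable cm_space;
  cm_atlas : set (chart R cm_space N);
  cm_cover : forall x, exists2 c, cm_atlas c & cdom c x;
  cm_compatible : forall c c', cm_atlas c -> cm_atlas c' -> compatible c c';
  cm_maximal : forall c, (forall c', cm_atlas c' -> compatible c c') ->
    cm_atlas c }.

Definition smooth_fun (R : realType) (N : nat) (X : complex_manifold R N)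
    (U : set X) (f : X -> R) : Prop :=
  forall c, cm_atlas c ->
    smooth_on (cmap c @` (U `&` cdom c)) (f \o cinv c : Cspace R N -> R).

(* [c] maps [W] to C^d x 0. *)
Definition slice_chart (R : realType) (N d : nat) (X : complex_manifold R N)
    (W : set X) (c : chart R X N) : Prop :=
  cm_atlas c /\ cmap c @` (W `&` cdom c) = cimg c `&` range (@Cincl R d N).

Definition complex_submanifold (R : realType) (N d : nat)
    (X : complex_manifold R N) (omega W : set X) : Prop :=
  W `<=` omega /\
  forall w, W w -> exists c,
    [/\ slice_chart d W c, cdom c w & cdom c `<=` omega].

(* The charts of the [d]-dimensional complex submanifold [W] are the
   restrictions of its slice charts, here given by their inverses. *)
Definition holomorphic_on_submanifold (R : realType) (N d : nat)
    (X : complex_manifold R N) (W : set X) (f : X -> R[i]) : Prop :=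
  forall c, slice_chart d W c ->
    holomorphic_fun (@Cincl R d N @^-1` cimg c)
      (fun u : Cspace R d => f (cinv c (Cincl N u))).

(** * Generic CR submanifolds *)

(* d' r_1 /\ .. /\ d' r_k at [p] is nonzero: one of its coefficients
   on the products dz^(f 1) /\ .. /\ dz^(f k) is nonzero. *)
Definition wedge_nonzero (R : realType) (N k : nat)
    (r : 'I_k -> Cspace R N -> R) (p : Cspace R N) : Prop :=
  exists f : 'I_k -> 'I_N, \det (\matrix_(j, l) dz (r j) p (f l)) != 0.

Definition defining_functions (R : realType) (N k : nat)
    (X : complex_manifold R N) (M U : set X) (r : 'I_k -> X -> R) : Prop :=
  [/\ open U,
      forall j, smooth_fun U (r j),
      M `&` U = U `&` [set x | forall j, r j x = 0] &
      forall x c, (M `&` U) x -> cm_atlas c -> cdom c x ->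
        wedge_nonzero (fun j => r j \o cinv c) (cmap c x)].

(* Type (n, k), where N = n + k. *)
Definition generic_CR (R : realType) (N k : nat) (X : complex_manifold R N)
    (M : set X) : Prop :=
  forall x, M x -> exists U (r : 'I_k -> X -> R),
    U x /\ defining_functions M U r.

(** * The characteristic bundle and the Levi form in a chart *)

(* Over the domain of a chart [c] the real cotangent bundle of the manifold is
   identified with cimg c x R^(N + N), and (p, xi) is encoded as
   [row_mx p xi]. *)
Notation Tspace R N := 'rV[R]_((N + N) + (N + N)).

Definition in_chart (R : realType) (N : nat) (X : complex_manifold R N)
    (c : chart R X N) (M : set X) : set (Cspace R N) :=
  cmap c @` (M `&` cdom c).

Definition CR_tangent (R : realType) (N : nat) (S : set (Cspace R N))
    (p : Cspace R N) : set (Cspace R N) :=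
  tangent S p `&` (@Jmul R N @` tangent S p).

(* H^0 M embedded in the cotangent bundle of the ambient manifold as the set
   of the (x, sum_j a^j d^c r_j(x)), for local defining functions r. *)
Definition char_bundle (R : realType) (N k : nat) (X : complex_manifold R N)
    (c : chart R X N) (M : set X) : set (Tspace R N) :=
  [set w | exists x U (r : 'I_k -> X -> R) (a : 'I_k -> R),
     [/\ M x, cdom c x, U x, defining_functions M U r &
         w = row_mx (cmap c x)
               (\sum_j a j *: dc (r j \o cinv c) (cmap c x))]].

Definition nonzero_covectors (R : realType) (N : nat) (B : set (Tspace R N)) :
    set (Tspace R N) :=
  [set w | B w /\ rsubmx w != 0].

(* The tautological form xi |-> xi (pi_* X). *)
Definition tautological (R : realType) (N : nat) (w X : Tspace R N) : R :=
  pairing (rsubmx w) (lsubmx X).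

(* The tautological form of a submanifold B of the cotangent bundle is the
   restriction to B of [tautological], and its differential is the restriction
   of the differential. *)
Definition N_space (R : realType) (N : nat) (B : set (Tspace R N))
    (w : Tspace R N) : set (Tspace R N) :=
  [set X | tangent B w X /\ tautological w X = 0].

Definition H_space (R : realType) (N : nat) (B : set (Tspace R N))
    (w : Tspace R N) : set (Tspace R N) :=
  [set X | N_space B w X /\
     forall Y, tangent B w Y -> ext_d (@tautological R N) w X Y = 0].

Definition regular_point (R : realType) (N : nat) (B : set (Tspace R N))
    (w0 : Tspace R N) : Prop :=
  nonzero_covectors B w0 /\
  exists (O V : set (Tspace R N)) (d : nat),
    [/\ open O /\ O w0,
        V `<=` O `&` nonzero_covectors B,
        smooth_submanifold d V /\ V w0,
        forall w, V w -> tangent V w `<=` H_space B w &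
        tangent V w0 = H_space B w0].

(* [s] extends the covector [xi] at [p] to a section of the characteristic
   bundle [B] of [S]; it is given by a smooth 1-form on an open set of C^N. *)
Definition section_extending (R : realType) (N : nat) (S : set (Cspace R N))
    (B : set (Tspace R N)) (p xi : Cspace R N)
    (s : Cspace R N -> Cspace R N) : Prop :=
  exists U, [/\ open U, U p, smooth_on U s, s p = xi &
    forall q, S q -> U q -> B (row_mx q (s q))].

(* On the tangent vectors of the submanifold this is d s (X, J X) for the
   restriction of [s] to the submanifold. *)
Definition Levi_form (R : realType) (N : nat) (s : Cspace R N -> Cspace R N)
    (p X : Cspace R N) : R :=
  ext_d (fun q => pairing (s q)) p X (Jmul X).

(* The Hermitian form h, linear in X and antilinear in Y, with
   h (X, X) = q X: its real part is the polarization b of q, and its imaginary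
   part is b (X, J Y). *)
Definition polarization (R : realType) (N : nat) (q : Cspace R N -> R)
    (X Y : Cspace R N) : R := (q (X + Y) - q X - q Y) / 2.

Definition Hermitian_form (R : realType) (N : nat) (q : Cspace R N -> R)
    (X Y : Cspace R N) : R[i] :=
  polarization q X Y +i* polarization q X (Jmul Y).

(* The rows of [e] form a basis over C of the space [H]. *)
Definition complex_basis (R : realType) (N n : nat) (H : set (Cspace R N))
    (e : 'M[R[i]]_(n, N)) : Prop :=
  row_free e /\
  forall v : 'rV[R[i]]_N, H (real_coords v) <-> (v <= e)%MS.

Definition Hermitian_rank (R : realType) (N n : nat) (H : set (Cspace R N))
    (q : Cspace R N -> R) (m : nat) : Prop :=
  exists e : 'M[R[i]]_(n, N), complex_basis H e /\
    \rank (\matrix_(a, b) Hermitian_form q (real_coords (row a e))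
                                           (real_coords (row b e))) = m.

(* [m] is the rank of the Levi form at the covector [xi] at [p]; the Levi form
   does not depend on the section [s]. *)
Definition Levi_rank (R : realType) (N n : nat) (S : set (Cspace R N))
    (B : set (Tspace R N)) (p xi : Cspace R N) (m : nat) : Prop :=
  exists s, section_extending S B p xi s /\
    Hermitian_rank n (CR_tangent S p) (Levi_form s p) m.

(* Main.v *)
Require Import Defs.
From HB Require Import structures.
From mathcomp Require Import all_boot all_order all_algebra.
From mathcomp Require Import complex.
From mathcomp Require Import all_classical all_reals all_analysis.
From mathcomp Require Import ring lra.

Set Implicit Arguments.
Unset Strict Implicit.
Unset Printing Implicit Defensive.

Import Order.TTheory GRing.Theory Num.Theory.
Import numFieldNormedType.Exports.

Local Open Scope classical_set_scope.
Local Open Scope ring_scope.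

(** The idea is that a regular point lies on a complex submanifold of the
    cotangent bundle, whose projection to the base is [W].

    In a chart, let [J] be the multiplication by i on C^N = R^(2N).  If M is
    rho_1 = .. = rho_k = 0, the characteristic bundle B consists of the
    (q, J grad (sum_j a_j rho_j) (q)): it is the conormal bundle of M, turned
    by [J] in the fibres.  The conormal bundle is Lagrangian, because Hessians
    are symmetric; turning by [J], this says that the radical H of d theta on B
    is the intersection of TB and K TB, where K (v, eta) = (J v, - J eta) is
    the complex structure of the cotangent bundle that makes d^c f |-> df/dz
    complex linear.  So H is invariant under K at every point of B
    ([H_space_kernel_eqs], [kernel_eqs_cotangentJ]).  Since the differentials
    d' rho_j are independent, H projects injectively to the base; at xi0 its
    image is the null space E of the Levi form, of complex dimension n - m
    ([kernel_eqs_null], [kernel_lift], [levi_null_rank]).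

    Let V be the submanifold provided by regularity.  As T V = H at xi0, near
    xi0 it is the graph of a map G over E.  The linear equations of H depend
    continuously on the point, so that also near xi0 an element of H is zero as
    soon as its component along E is.  The vector K (dG v) - dG (J v) belongs
    to H, since T V does and H is invariant under K, and its component along E
    vanishes.  Hence G satisfies the Cauchy-Riemann equations
    ([holomorphic_lift]).

    Write G (u) = (q (u), xi (u)).  The image of q is W; as a holomorphic
    graph over E, it becomes a coordinate plane after a holomorphic change of
    coordinates ([straighten]).  Write xi (u) as the combination of the
    d^c rho_j (q (u)) with coefficients a_j (u), and let rho be the sum of the
    a_j rho_j, where the a_j are extended constantly along the fibres of the
    projection to E.  As the rho_j vanish on M, d^c rho = xi along W
    ([dc_combination]), and the derivatives of rho with respect to the z^a are
    complex linear functions of d^c rho, hence holomorphic on W.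

    The analysis rests on one principle, [smooth_on_coind]: a family of
    differentiable functions that is closed under partial derivatives consists
    of smooth functions.  It yields the smoothness of products, quotients and
    composites, and that of the local inverse given by the contraction
    principle ([local_section]).  The inverse function theorem is used in the
    form of [local_graph], a parametrization of a level set by its tangent
    space, both for M and for V. *)

(** * Smooth functions on open subsets of R^d *)

Section near_differentiable.
Variables (R : realType) (V W : normedModType R).

(** The differential is a choice among linear maps, so that locality has to be
    derived from the uniqueness of the first order expansion. *)
Lemma near_eq_differentiable (f g : V -> W) (x : V) :
  (\near x, f x = g x) -> differentiable f x -> differentiable g x.
Proof.
move=> fg df.
have fgx : f x = g x by exact: nbhs_singleton fg.
have E : g \o shift x = cst (g x) + 'd f x +o_ (0 : V) id.
  apply/eqaddoP => e e0.
  have /eqaddoP/(_ e e0) fx := diff_locally df.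
  have fg0 : \forall h \near (0 : V), f (h + x) = g (h + x).
    by move: fg; rewrite (near_shift 0 x) subr0.
  near=> h.
  have <- : (f \o shift x - (cst (f x) + 'd f x)) h =
            (g \o shift x - (cst (g x) + 'd f x)) h.
    rewrite -fgx !fctE /=; congr (_ - _).
    by near: h.
  by near: h.
apply/diff_locallyP.
have -> : 'd g x = 'd f x :> (V -> W).
  by apply: diff_unique => //; exact: diff_continuous.
by split=> //; exact: diff_continuous.
Unshelve. all: by end_near. Qed.

End near_differentiable.

Section smooth_calculus.
Variables (R : realType) (d : nat).
Implicit Types (U : set 'rV[R]_d) (p v : 'rV[R]_d).

Lemma open_nearby U p (P : 'rV[R]_d -> Prop) :
  open U -> U p -> (forall q, U q -> P q) -> \near p, P p.
Proof.
by move=> oU Up UP; apply: filterS (open_nbhs_nbhs (conj oU Up)) => q /UP.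
Qed.

Lemma iter_partial_rcons (V : normedModType R) (s : seq 'I_d) i
    (f : 'rV[R]_d -> V) :
  iter_partial (rcons s i) f = iter_partial s (fun p => 'D_(delta_mx 0 i) f p).
Proof. by elim: s => //= j s ->. Qed.

Lemma smooth_on_sub (V : normedModType R) U U' (f : 'rV[R]_d -> V) :
  U `<=` U' -> smooth_on U' f -> smooth_on U f.
Proof. by move=> UU' sf s p /UU'; exact: sf. Qed.

Lemma smooth_on_differentiable (V : normedModType R) U (f : 'rV[R]_d -> V) p :
  smooth_on U f -> U p -> differentiable f p.
Proof. by move=> sf; exact: (sf [::]). Qed.

Lemma smooth_on_partial (V : normedModType R) U (f : 'rV[R]_d -> V) i :
  smooth_on U f -> smooth_on U (fun p => 'D_(delta_mx 0 i) f p).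
Proof. by move=> sf s p Up; rewrite -iter_partial_rcons; exact: sf. Qed.

(** All derivatives of a member of [P] coincide on [U] with members of [P],
    by induction on their order: this is how every smoothness statement below
    is obtained, with a family [P] chosen so that the derivatives can be
    computed without leaving it. *)
Lemma smooth_on_coind (V : normedModType R) U (P : ('rV[R]_d -> V) -> Prop) :
  open U ->
  (forall f, P f -> (forall p, U p -> differentiable f p) /\
     forall i, exists2 g, P g & forall p, U p -> 'D_(delta_mx 0 i) f p = g p) ->
  forall f, P f -> smooth_on U f.
Proof.
move=> oU HP f Pf.
have key s : exists2 g, P g & forall p, U p -> iter_partial s f p = g p.
  elim: s => [|i s [g Pg fg]]; first by exists f.
  have [_ /(_ i)[h Ph gh]] := HP _ Pg.
  exists h => // p Up; rewrite -gh //=; apply: near_eq_derive.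
  exact: open_nearby fg.
move=> s p Up; have [g Pg fg] := key s.
apply: near_eq_differentiable (_ : differentiable g p).
  by apply: open_nearby oU Up _ => q Uq; rewrite fg.
by have [+ _] := HP _ Pg; apply.
Qed.

Lemma smooth_on_ext (V : normedModType R) U (f g : 'rV[R]_d -> V) :
  open U -> (forall p, U p -> f p = g p) -> smooth_on U f -> smooth_on U g.
Proof.
move=> oU fg sf.
apply: (@smooth_on_coind _ _ (fun h => exists2 f, smooth_on U f &
  forall p, U p -> f p = h p)) => //; last by exists f.
move=> h {f fg sf} [f sf fh]; split.
  move=> p Up; apply: near_eq_differentiable (smooth_on_differentiable sf Up).
  exact: open_nearby fh.
move=> i; exists (fun p => 'D_(delta_mx 0 i) h p) => //.
exists (fun p => 'D_(delta_mx 0 i) f p); first exact: smooth_on_partial.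
by move=> p Up; apply: near_eq_derive; exact: open_nearby fh.
Qed.

Lemma smooth_onP (V : normedModType R) U (f : 'rV[R]_d -> V) :
  (forall p, U p -> differentiable f p) ->
  (forall i, smooth_on U (fun p => 'D_(delta_mx 0 i) f p)) -> smooth_on U f.
Proof.
move=> df sf s; elim/last_ind: s => [|s i _] p Up /=; first exact: df.
by rewrite iter_partial_rcons; exact: sf.
Qed.

(** The polynomials in the functions of [gens].  By the rules for sums and
    products they are closed under partial derivatives as soon as the
    derivatives of the generators are among them. *)
Inductive generated (gens : set ('rV[R]_d -> R)) : ('rV[R]_d -> R) -> Prop :=
| GenBase f : gens f -> generated gens f
| GenCst a : generated gens (fun=> a)
| GenAdd f g : generated gens f -> generated gens g ->
    generated gens (fun p => f p + g p)
| GenMul f g : generated gens f -> generated gens g ->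
    generated gens (fun p => f p * g p).

Lemma generated_sum gens n (f : 'I_n -> 'rV[R]_d -> R) :
  (forall i, generated gens (f i)) ->
  generated gens (fun p => \sum_i f i p).
Proof.
elim: n f => [|n IH] f gf.
  rewrite (_ : (fun _ => _) = fun=> 0); first exact: GenCst.
  by apply/funext => p; rewrite big_ord0.
rewrite (_ : (fun _ => _) = fun p => \sum_(i < n) f (widen_ord (leqnSn n) i) p
  + f ord_max p); last by apply/funext => p; rewrite big_ord_recr.
by apply: GenAdd => //; exact: IH.
Qed.

Lemma generated_smooth U gens : open U ->
  (forall f, gens f -> (forall p, U p -> differentiable f p) /\
     forall i, exists2 g, generated gens g &
       forall p, U p -> 'D_(delta_mx 0 i) f p = g p) ->
  forall f, generated gens f -> smooth_on U f.
Proof.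
move=> oU Hg; apply: smooth_on_coind => // f; elim=> {f}.
- exact: Hg.
- move=> a; split=> [p _|i]; first exact: differentiable_cst.
  by exists (fun=> 0); [exact: GenCst|move=> p _; exact: derive_cst].
- move=> f g gf [df IHf] gg [dg IHg]; split=> [p Up|i].
    by apply: differentiableD; [exact: df|exact: dg].
  have [f' gf' ff'] := IHf i; have [g' gg' gg'E] := IHg i.
  exists (fun p => f' p + g' p); first exact: GenAdd.
  move=> p Up; rewrite -ff' // -gg'E //.
  by apply: deriveD; apply: diff_derivable; [exact: df|exact: dg].
- move=> f g gf [df IHf] gg [dg IHg]; split=> [p Up|i].
    by apply: differentiableM; [exact: df|exact: dg].
  have [f' gf' ff'] := IHf i; have [g' gg' gg'E] := IHg i.
  exists (fun p => f p * g' p + g p * f' p).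
    by apply: GenAdd; apply: GenMul.
  move=> p Up; rewrite -ff' // -gg'E //.
  by apply: deriveM; apply: diff_derivable; [exact: df|exact: dg].
Qed.

Lemma smooth_generated U f : open U -> generated (smooth_on U) f ->
  smooth_on U f.
Proof.
move=> oU; apply: generated_smooth => // {}f sf; split=> [p Up|i].
  exact: smooth_on_differentiable sf Up.
exists (fun p => 'D_(delta_mx 0 i) f p) => //.
by apply: GenBase; exact: smooth_on_partial.
Qed.

Lemma smooth_cst U (a : R) : open U -> smooth_on U (fun=> a).
Proof. by move=> oU; apply: smooth_generated => //; exact: GenCst. Qed.

Lemma smoothD U (f g : 'rV[R]_d -> R) : open U -> smooth_on U f ->
  smooth_on U g -> smooth_on U (fun p => f p + g p).
Proof.
by move=> oU sf sg; apply: smooth_generated => //; apply: GenAdd;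
  exact: GenBase.
Qed.

Lemma smoothM U (f g : 'rV[R]_d -> R) : open U -> smooth_on U f ->
  smooth_on U g -> smooth_on U (fun p => f p * g p).
Proof.
by move=> oU sf sg; apply: smooth_generated => //; apply: GenMul;
  exact: GenBase.
Qed.

Lemma smoothN U (f : 'rV[R]_d -> R) : open U -> smooth_on U f ->
  smooth_on U (fun p => - f p).
Proof.
move=> oU sf; apply: (@smooth_on_ext _ _ (fun p => -1 * f p)) => //.
  by move=> p _; rewrite mulN1r.
by apply: smoothM => //; exact: smooth_cst.
Qed.

Lemma smooth_sum U n (f : 'I_n -> 'rV[R]_d -> R) : open U ->
  (forall i, smooth_on U (f i)) -> smooth_on U (fun p => \sum_i f i p).
Proof.
move=> oU sf; apply: smooth_generated => //; apply: generated_sum => i.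
exact: GenBase.
Qed.

(** The ring generated by the smooth functions and [1 / f] is closed under
    partial derivatives, as those of [1 / f] are the [- (1 / f)^2 * df]. *)
Lemma smoothV U (f : 'rV[R]_d -> R) : open U -> smooth_on U f ->
  (forall p, U p -> f p != 0) -> smooth_on U (fun p => (f p)^-1).
Proof.
move=> oU sf f0; pose fV p := (f p)^-1.
apply: (@generated_smooth _ [set g | smooth_on U g \/ g = fV]) => //;
  last first.
  by apply: GenBase; right.
move=> g [sg|->]; split=> [p Up|i].
- exact: smooth_on_differentiable sg Up.
- exists (fun p => 'D_(delta_mx 0 i) g p) => //.
  by apply: GenBase; left; exact: smooth_on_partial.
- apply: differentiableV; last exact: f0.
  exact: smooth_on_differentiable sf Up.
- exists (fun p => -1 * (fV p * fV p) * 'D_(delta_mx 0 i) f p).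
    apply: GenMul; last by apply: GenBase; left; exact: smooth_on_partial.
    by apply: GenMul; [exact: GenCst|apply: GenMul; apply: GenBase; right].
  move=> p Up; rewrite deriveV ?f0 //; last first.
    by apply: diff_derivable; exact: smooth_on_differentiable sf Up.
  by rewrite /fV mulN1r -invfM -expr2.
Qed.

End smooth_calculus.

(** * Vector and matrix valued smooth maps *)

Section directional.
Variables (R : realType) (d : nat).

Lemma derive_linear (V W : normedModType R) (f : {linear V -> W}) p v :
  continuous f -> 'D_v f p = f v.
Proof.
move=> cf; rewrite deriveE; last exact: linear_differentiable.
by rewrite diff_lin.
Qed.

Lemma derive_chain (V W Z : normedModType R) (f : V -> W) (g : W -> Z) p v :
  differentiable f p -> differentiable g (f p) ->
  'D_v (g \o f) p = 'D_('D_v f p) g (f p).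
Proof.
move=> df dg; rewrite !deriveE //; last exact: differentiable_comp.
by rewrite diff_comp.
Qed.

Lemma derive_partials (V : normedModType R) (f : 'rV[R]_d -> V) p v :
  differentiable f p ->
  'D_v f p = \sum_i v 0 i *: 'D_(delta_mx 0 i) f p.
Proof.
move=> df; rewrite deriveE // {1}(row_sum_delta v) linear_sum /=.
by apply: eq_bigr => i _; rewrite linearZ deriveE.
Qed.

Lemma differentiable_rowP (V : normedModType R) m (F : V -> 'rV[R]_m) p :
  (forall j, differentiable (fun p => F p 0 j) p) -> differentiable F p.
Proof.
move=> dF.
have -> : F = \sum_j (fun p => F p 0 j *: (delta_mx 0 j : 'rV_m)).
  apply/funext => q; rewrite {1}(row_sum_delta (F q)).
  by rewrite fct_sumE.
by apply: differentiable_sum => j; exact: differentiableZl.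
Qed.

Lemma differentiable_entry (V : normedModType R) m (F : V -> 'rV[R]_m) p j :
  differentiable F p -> differentiable (fun p => F p 0 j) p.
Proof.
move=> dF; apply: (@differentiable_comp _ _ _ _ F (fun N : 'rV_m => N 0 j)) =>
  //.
exact: differentiable_coord.
Qed.

Lemma derive_entry (V : normedModType R) m (F : V -> 'rV[R]_m) p v j :
  derivable F p v -> ('D_v F p) 0 j = 'D_v (fun p => F p 0 j) p.
Proof. by move=> dF; rewrite derive_mx // mxE. Qed.

End directional.

Section smooth_vectors.
Variables (R : realType).

Lemma smooth_entry d m (U : set 'rV[R]_d) (F : 'rV[R]_d -> 'rV[R]_m) j :
  open U -> smooth_on U F -> smooth_on U (fun p => F p 0 j).
Proof.
move=> oU sF; apply: (@smooth_on_coind _ _ _ _ (fun f => exists2 F,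
  smooth_on U F & forall p, U p -> f p = (F p : 'rV[R]_m) 0 j)) => //;
    last by exists F.
move=> f {F sF} [F sF fF].
have near_f p : U p -> \near p, F p 0 j = f p.
  by move=> Up; apply: open_nearby oU Up _ => q /fF ->.
split.
  move=> p Up; apply: near_eq_differentiable (near_f p Up) _.
  by apply: differentiable_entry; exact: smooth_on_differentiable sF Up.
move=> i; exists (fun p => ('D_(delta_mx 0 i) F p) 0 j).
  by exists (fun p => 'D_(delta_mx 0 i) F p) => //; exact: smooth_on_partial.
move=> p Up; rewrite derive_entry; last first.
  by apply: diff_derivable; exact: smooth_on_differentiable sF Up.
by apply: near_eq_derive; apply: open_nearby oU Up _ => q /fF.
Qed.

Lemma smooth_row d m (U : set 'rV[R]_d) (F : 'rV[R]_d -> 'rV[R]_m) :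
  open U -> (forall j, smooth_on U (fun p => F p 0 j)) -> smooth_on U F.
Proof.
move=> oU; move: F; apply: smooth_on_coind => // F sF.
have dF p : U p -> differentiable F p.
  move=> Up; apply: differentiable_rowP => j.
  exact: smooth_on_differentiable (sF j) Up.
split=> // i; exists (fun p => 'D_(delta_mx 0 i) F p) => // j.
apply: (@smooth_on_ext _ _ _ _
  (fun p => 'D_(delta_mx 0 i) (fun p => F p 0 j) p)) => //.
  by move=> p Up; rewrite derive_entry //; apply: diff_derivable; exact: dF.
exact: smooth_on_partial.
Qed.

(** Stated on sets that need not be open: the coordinates are smooth on the
    whole space. *)
Lemma smooth_coord d (U : set 'rV[R]_d) j :
  smooth_on U (fun p : 'rV[R]_d => p 0 j).
Proof.
apply: (@smooth_on_sub _ _ _ _ setT) => //.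
apply: smooth_onP => [p _|i]; first exact: differentiable_coord.
rewrite (_ : (fun _ => _) = fun=> (delta_mx 0 i : 'rV[R]_d) 0 j).
  exact/smooth_cst/openT.
apply/funext => p; rewrite -[X in 'D__ X p]/(fun q : 'rV[R]_d => id q 0 j).
by rewrite -derive_entry ?derive_id //; exact: derivable_id.
Qed.

Lemma smooth_derive d (U : set 'rV[R]_d) (f : 'rV[R]_d -> R) v :
  open U -> smooth_on U f -> smooth_on U (fun p => 'D_v f p).
Proof.
move=> oU sf.
apply: (@smooth_on_ext _ _ _ _ (fun p => \sum_i v 0 i * 'D_(delta_mx 0 i) f p))
  => //.
  by move=> p Up; rewrite derive_partials //;
    exact: smooth_on_differentiable sf Up.
apply: smooth_sum => // i; apply: smoothM => //; first exact: smooth_cst.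
exact: smooth_on_partial.
Qed.

(** By the chain rule, the ring generated by the smooth functions on [U] and by
    the [h \o G] with [h] smooth on [U'] is closed under partial derivatives. *)
Lemma smooth_comp_scalar d d' (U : set 'rV[R]_d) (U' : set 'rV[R]_d')
    (G : 'rV[R]_d -> 'rV[R]_d') (f : 'rV[R]_d' -> R) :
  open U -> smooth_on U G -> smooth_on U' f -> (forall p, U p -> U' (G p)) ->
  smooth_on U (f \o G).
Proof.
move=> oU sG sf UU'.
apply: (@generated_smooth _ _ _ [set g | smooth_on U g \/
  exists2 h, smooth_on U' h & g = h \o G]) => //; last first.
  by apply: GenBase; right; exists f.
have dG p : U p -> differentiable G p by exact: smooth_on_differentiable.
move=> g [sg|[h sh ->]].
  split=> [p Up|i]; first exact: smooth_on_differentiable sg Up.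
  exists (fun p => 'D_(delta_mx 0 i) g p) => //.
  by apply: GenBase; left; exact: smooth_on_partial.
have dh p : U p -> differentiable h (G p).
  by move=> /UU'; exact: smooth_on_differentiable.
split=> [p Up|i]; first by apply: differentiable_comp; [exact: dG|exact: dh].
exists (fun p => \sum_j ('D_(delta_mx 0 i) (fun p => G p 0 j) p) *
   ((fun q => 'D_(delta_mx 0 j) h q) \o G) p).
  apply: generated_sum => j; apply: GenMul; apply: GenBase.
    by left; apply: smooth_on_partial; exact: smooth_entry.
  by right; eexists; [exact: smooth_on_partial sh|].
move=> p Up; rewrite derive_chain; [|exact: dG|exact: dh].
rewrite derive_partials; last exact: dh.
apply: eq_bigr => j _; rewrite derive_entry //.
by apply: diff_derivable; exact: dG.
Qed.

Lemma smooth_comp d d' m (U : set 'rV[R]_d) (U' : set 'rV[R]_d')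
    (G : 'rV[R]_d -> 'rV[R]_d') (F : 'rV[R]_d' -> 'rV[R]_m) :
  open U -> open U' ->
  smooth_on U G -> smooth_on U' F -> (forall p, U p -> U' (G p)) ->
  smooth_on U (F \o G).
Proof.
move=> oU oU' sG sF UU'; apply: smooth_row => // j.
apply: (@smooth_comp_scalar _ _ _ _ _ (fun q => F q 0 j)) sG _ UU' => //.
exact: smooth_entry.
Qed.

End smooth_vectors.

Section smooth_matrices.
Variables (R : realType) (d : nat) (U : set 'rV[R]_d).

Definition smooth_mx m n (A : 'rV[R]_d -> 'M[R]_(m, n)) :=
  forall i j, smooth_on U (fun p => A p i j).

Hypothesis oU : open U.

Lemma smooth_mx_cst m n (A : 'M[R]_(m, n)) : smooth_mx (fun=> A).
Proof. by move=> i j; exact: smooth_cst. Qed.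

Lemma smooth_mxD m n (A B : 'rV[R]_d -> 'M[R]_(m, n)) :
  smooth_mx A -> smooth_mx B -> smooth_mx (fun p => A p + B p).
Proof.
move=> sA sB i j; under eq_fun do rewrite mxE.
exact: smoothD.
Qed.

Lemma smooth_mxN m n (A : 'rV[R]_d -> 'M[R]_(m, n)) :
  smooth_mx A -> smooth_mx (fun p => - A p).
Proof.
move=> sA i j; under eq_fun do rewrite mxE.
exact: smoothN.
Qed.

Lemma smooth_mxT m n (A : 'rV[R]_d -> 'M[R]_(m, n)) :
  smooth_mx A -> smooth_mx (fun p => (A p)^T).
Proof. by move=> sA i j; under eq_fun do rewrite mxE; exact: sA. Qed.

Lemma smooth_mxM m n l (A : 'rV[R]_d -> 'M[R]_(m, n))
  (B : 'rV[R]_d -> 'M[R]_(n, l)) :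
  smooth_mx A -> smooth_mx B -> smooth_mx (fun p => A p *m B p).
Proof.
move=> sA sB i j; under eq_fun do rewrite mxE.
by apply: smooth_sum => // h; exact: smoothM.
Qed.

Lemma smooth_row_mx m n1 n2 (A : 'rV[R]_d -> 'M[R]_(m, n1))
   (B : 'rV[R]_d -> 'M[R]_(m, n2)) :
  smooth_mx A -> smooth_mx B -> smooth_mx (fun p => row_mx (A p) (B p)).
Proof.
move=> sA sB i j; under eq_fun do rewrite mxE.
by case: (fintype.split j) => h; [exact: sA|exact: sB].
Qed.

Lemma smooth_col_mx m1 m2 n (A : 'rV[R]_d -> 'M[R]_(m1, n))
   (B : 'rV[R]_d -> 'M[R]_(m2, n)) :
  smooth_mx A -> smooth_mx B -> smooth_mx (fun p => col_mx (A p) (B p)).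
Proof.
move=> sA sB i j; under eq_fun do rewrite mxE.
by case: (fintype.split i) => h; [exact: sA|exact: sB].
Qed.

Lemma smooth_mx_det n (A : 'rV[R]_d -> 'M[R]_n) :
  smooth_mx A -> smooth_on U (fun p => \det (A p)).
Proof.
elim: n A => [|n IH] A sA.
  rewrite (_ : (fun _ => _) = fun=> 1); first exact: smooth_cst.
  by apply/funext => p; rewrite det_mx00.
rewrite (_ : (fun _ => _) = fun p => \sum_j A p ord0 j * cofactor (A p) ord0 j).
  apply: smooth_sum => // j; apply: smoothM => //.
  apply: smoothM => //; first exact: smooth_cst.
  by apply: IH => a b; under eq_fun do rewrite !mxE; exact: sA.
by apply/funext => p; rewrite (expand_det_row _ ord0).
Qed.

Lemma smooth_invmx n (A : 'rV[R]_d -> 'M[R]_n) :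
  smooth_mx A -> (forall p, U p -> A p \in unitmx) ->
  smooth_mx (fun p => invmx (A p)).
Proof.
move=> sA uA i j.
apply: (@smooth_on_ext _ _ _ _ (fun p => (\det (A p))^-1 * (\adj (A p)) i j))
  => //.
  by move=> p Up; rewrite /invmx uA // !mxE.
apply: smoothM => //.
  apply: smoothV => //; first exact: smooth_mx_det.
  by move=> p /uA; rewrite unitmxE unitfE.
under eq_fun do rewrite mxE; apply: smoothM => //; first exact: smooth_cst.
by apply: smooth_mx_det => a b; under eq_fun do rewrite !mxE; exact: sA.
Qed.

Lemma smooth_rowE m (F : 'rV[R]_d -> 'rV[R]_m) : smooth_on U F <-> smooth_mx F.
Proof.
split=> [sF i j|sF]; first by rewrite ord1; exact: smooth_entry.
by apply: smooth_row => // j; exact: sF.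
Qed.

Lemma smooth_id : smooth_mx (fun p => p).
Proof. by move=> i j; rewrite ord1; exact: smooth_coord. Qed.

End smooth_matrices.

HB.instance Definition _ (R : realType) m n :=
  Complete.copy 'M[R]_(m, n) 'M[R]_(m, n).

(** * Estimates along segments *)

Section differentiability_criterion.
Variables (R : realType) (V W : normedModType R).

(** Identifies the differential together with its existence, when a candidate
    is known. *)
Lemma differentiable_epsilon (f : V -> W) (L : {linear V -> W}) x :
  continuous L ->
  (forall e, 0 < e -> \forall h \near (0 : V),
     `|f (h + x) - (f x + L h)| <= e * `|h|) ->
  differentiable f x /\ 'd f x = L :> (V -> W).
Proof.
move=> cL Hf.
have E : f \o shift x = cst (f x) + L +o_ (0 : V) id.
  by apply/eqaddoP => e e0; near=> h; rewrite !fctE /=; near: h; exact: Hf.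
have dE : 'd f x = L :> (V -> W) by exact: diff_unique.
by split=> //; apply/diff_locallyP; rewrite dE.
Unshelve. all: by end_near. Qed.

Lemma line_derivative (p v : V) (t : R) :
  differentiable (fun t : R => p + t *: v) t /\ 'D_1 (fun t : R => p + t *: v)
    t = v.
Proof.
have dZ : differentiable (fun t : R => t *: v) t by [].
have dc : differentiable (cst p : R -> V) t by exact: differentiable_cst.
split; first exact: (@differentiableD _ _ _ (cst p)).
rewrite (@deriveD _ _ _ (cst p)); [|exact: diff_derivable..].
rewrite derive_cst add0r deriveE // diff_val scale1r //.
Qed.

Lemma derive_line (Z : normedModType R) (f : V -> Z) (p v : V) (t : R) :
  differentiable f (p + t *: v) ->
  differentiable (fun t : R => f (p + t *: v)) t /\
  'D_1 (fun t : R => f (p + t *: v)) t = 'D_v f (p + t *: v).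
Proof.
move=> df; have [dl Dl] := line_derivative p v t.
split; first exact: (@differentiable_comp _ _ _ _ (fun t : R => p + t *: v) f).
by rewrite (derive_chain (f := fun t : R => p + t *: v) (g := f)) // Dl.
Qed.

End differentiability_criterion.

Section open_sets.
Variables (R : realType) (d : nat).

Lemma smooth_neq0_open (U : set 'rV[R]_d) (f : 'rV[R]_d -> R) :
  open U -> smooth_on U f -> open [set p | U p /\ f p != 0].
Proof.
move=> oU sf; rewrite openE => p [Up fp].
have cf : {for p, continuous f}.
  by apply: differentiable_continuous; exact: smooth_on_differentiable sf Up.
apply: filterS2 (open_nbhs_nbhs (conj oU Up))
  (cf _ (open_nbhs_nbhs (conj (@open_neq R 0) fp))).
by move=> q Uq /= fq; split.
Qed.

Lemma smooth_preimage_open m (U : set 'rV[R]_d) (V : set 'rV[R]_m)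
    (F : 'rV[R]_d -> 'rV[R]_m) :
  open U -> open V -> smooth_on U F -> open [set p | U p /\ V (F p)].
Proof.
move=> oU oV sF; rewrite openE => p [Up Vp].
have cF : {for p, continuous F}.
  by apply: differentiable_continuous; exact: smooth_on_differentiable sF Up.
apply: filterS2 (open_nbhs_nbhs (conj oU Up))
  (cF _ (open_nbhs_nbhs (conj oV Vp))).
by move=> q Uq /= fq; split.
Qed.

Lemma norm_coord m (v : 'rV[R]_m) j : `|v 0 j| <= `|v|.
Proof.
rewrite [leRHS]/Num.Def.normr/= mx_normrE;
  exact: (le_bigmax _ (fun i => `|v i.1 i.2|) (0, j)).
Qed.

Lemma norm_row_le m (v : 'rV[R]_m) (e : R) : 0 <= e ->
  (forall j, `|v 0 j| <= e) -> `|v| <= e.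
Proof.
move=> e0 ve; rewrite [leLHS]/Num.Def.normr/= mx_normrE bigmax_le //= =>
  -[i j] _ /=.
by rewrite ord1.
Qed.

Lemma closed_ball_segment (w0 w w' : 'rV[R]_d) (r t : R) : 0 <= t <= 1 ->
  `|w0 - w| <= r -> `|w0 - w'| <= r -> `|w0 - (w' + t *: (w - w'))| <= r.
Proof.
move=> /andP[t0 t1] wr w'r.
have -> : w0 - (w' + t *: (w - w')) = (1 - t) *: (w0 - w') + t *: (w0 - w).
  rewrite !scalerBl !scale1r !scalerBr !opprD !opprK.
  apply/rowP => j; rewrite !mxE; ring.
rewrite (le_trans (ler_normD _ _)) // !normrZ !ger0_norm ?subr_ge0 //.
rewrite (_ : r = (1 - t) * r + t * r); last by ring.
by rewrite lerD // ler_wpM2l // subr_ge0.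
Qed.

(** The mean value theorem on the segment from [w'] to [w], which stays in the
    closed ball. *)
Lemma lipschitz_partials (U : set 'rV[R]_d) (f : 'rV[R]_d -> R) (w0 : 'rV[R]_d)
  (r c : R) :
  (forall w, `|w0 - w| <= r -> U w) -> smooth_on U f ->
  (forall w i, `|w0 - w| <= r -> `|'D_(delta_mx 0 i) f w| <= c) ->
  forall w w', `|w0 - w| <= r -> `|w0 - w'| <= r ->
  `|f w - f w'| <= d%:R * c * `|w - w'|.
Proof.
move=> BU sf Dc w w' wr w'r.
pose g (t : R) := f (w' + t *: (w - w')).
have inB t : 0 <= t <= 1 -> `|w0 - (w' + t *: (w - w'))| <= r.
  by move=> t01; exact: closed_ball_segment.
have df t : 0 <= t <= 1 -> differentiable f (w' + t *: (w - w')).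
  by move=> /inB/BU; exact: smooth_on_differentiable.
have [t||t t01] := @MVT_segment R g
  (fun t => 'D_(w - w') f (w' + t *: (w - w'))) 0 1 ler01.
- rewrite in_itv /= => /andP[t0 t1].
  have [dg Dg] := derive_line (df t (introT andP (conj (ltW t0) (ltW t1)))).
  by apply: DeriveDef => //; exact: diff_derivable.
- apply: continuous_in_subspaceT => t; rewrite inE /= in_itv /= => /df dt.
  by apply: differentiable_continuous; have [] := derive_line dt.
rewrite /g scale1r subrKC scale0r addr0 subr0 mulr1 => ->.
rewrite in_itv /= in t01.
rewrite derive_partials; last exact: df.
apply: le_trans (ler_norm_sum _ _ _) _.
have -> : d%:R * c * `|w - w'| = \sum_(i < d) (c * `|w - w'|).
  by rewrite sumr_const card_ord -mulrA mulr_natl.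
apply: ler_sum => i _; rewrite normrM mulrC ler_pM //.
  by apply: Dc; exact: inB.
exact: norm_coord.
Qed.

End open_sets.

(** * The inverse function theorem *)

Section mx_continuity.
Variables (R : realType).

Lemma mulmxr_continuous n l (A : 'M[R]_(n, l)) :
  continuous (mulmxr A : 'rV[R]_n -> 'rV[R]_l).
Proof.
move=> p; apply: differentiable_continuous.
apply: (@smooth_on_differentiable _ _ _ setT) => //.
apply/smooth_rowE; first exact: openT.
by apply: smooth_mxM; [exact: openT|exact: smooth_id|exact/smooth_mx_cst/openT].
Qed.

Lemma derive_mulmxr d (V : normedModType R) m (f : V -> 'rV[R]_d)
  (A : 'M[R]_(d, m)) p v :
  differentiable f p ->
  differentiable (fun p => f p *m A) p /\
  'D_v (fun p => f p *m A) p = 'D_v f p *m A.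
Proof.
move=> df.
have cA := @mulmxr_continuous d m A.
have dA q : differentiable (mulmxr A : 'rV[R]_d -> 'rV[R]_m) q.
  by apply: linear_differentiable.
split; first exact: (@differentiable_comp _ _ _ _ f (mulmxr A)).
rewrite (derive_chain (f := f) (g := mulmxr A : 'rV[R]_d -> 'rV[R]_m)) //.
by rewrite (derive_linear _ _ cA).
Qed.

End mx_continuity.

Section jacobian_matrix.
Variables (R : realType) (a b : nat).
Implicit Types (F : 'rV[R]_a -> 'rV[R]_b).

Definition partials F (p : 'rV[R]_a) : 'M[R]_(a, b) :=
  \matrix_(i, j) 'D_(delta_mx 0 i) (fun q => F q 0 j) p.

Lemma derive_partials_mx F p v : differentiable F p ->
  'D_v F p = v *m partials F p.
Proof.
move=> dF; rewrite derive_partials //; apply/rowP => j.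
rewrite summxE mxE; apply: eq_bigr => i _; rewrite !mxE.
by rewrite derive_entry //; exact: diff_derivable.
Qed.

Lemma smooth_partials (U : set 'rV[R]_a) F : open U -> smooth_on U F ->
  smooth_mx U (partials F).
Proof.
move=> oU sF i j; rewrite /partials; under eq_fun do rewrite mxE.
by apply: smooth_on_partial; exact: smooth_entry.
Qed.

End jacobian_matrix.

(** The differential of [F] at [w0] is the identity, so that [F - id] is a
    contraction near [w0] and [F w = y] is the fixed point equation
    [w = y - (F - id) w].  The differential of the fixed point
    with respect to [y] is the inverse of that of [F], hence a smooth function
    of the fixed point itself. *)
Section local_section.
Variables (R : realType) (a : nat).
Variables (Om : set 'rV[R]_a) (F : 'rV[R]_a -> 'rV[R]_a) (w0 : 'rV[R]_a).
Hypotheses (oOm : open Om) (Omw0 : Om w0) (sF : smooth_on Om F).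
Hypothesis DF : forall v, 'D_v F w0 = v.

Let g w := F w - w.

Let sg : smooth_on Om g.
Proof.
apply/smooth_rowE => //; apply: smooth_mxD => //; first exact/smooth_rowE.
by apply: smooth_mxN => //; exact: smooth_id.
Qed.

Let dF w : Om w -> differentiable F w.
Proof. exact: smooth_on_differentiable sF. Qed.

Let Dg w v : Om w -> 'D_v g w = 'D_v F w - v.
Proof.
move=> Ow; rewrite (_ : g = F - id) //.
rewrite (@deriveB _ _ _ F id w v) ?derive_id //.
by apply: diff_derivable; exact: dF.
Qed.

(** With [a] coordinates, this bound on the partial derivatives makes [F - id]
    Lipschitz of ratio at most 1/2. *)
Let good_radius : exists2 r, 0 < r &
  forall w, `|w0 - w| <= r -> Om w /\
    forall i j, `|'D_(delta_mx 0 i) (fun w => g w 0 j) w| <= (2 * a.+1%:R)^-1.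
Proof.
set c := (2 * a.+1%:R)^-1.
have c0 : 0 < c by rewrite invr_gt0 mulr_gt0.
have : \forall w \near w0, Om w /\ forall ij : 'I_a * 'I_a,
    `|'D_(delta_mx 0 ij.1) (fun w => g w 0 ij.2) w| <= c.
  apply: filterS2 (open_nbhs_nbhs (conj oOm Omw0)) (_ : \forall w \near w0,
    forall ij : 'I_a * 'I_a, `|'D_(delta_mx 0 ij.1) (fun w => g w 0 ij.2) w| <=
      c).
    by move=> w; split.
  apply: (@filter_forall _ _ (fun (ij : 'I_a * 'I_a) w =>
    `|'D_(delta_mx 0 ij.1) (fun w => g w 0 ij.2) w| <= c) (nbhs w0)) =>
      -[i j] /=.
  have sD := smooth_on_partial i (smooth_entry j oOm sg).
  have cD := differentiable_continuous (smooth_on_differentiable sD Omw0).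
  have D0 : 'D_(delta_mx 0 i) (fun w => g w 0 j) w0 = 0.
    have dg := smooth_on_differentiable sg Omw0.
    by rewrite -derive_entry ?Dg ?DF ?subrr ?mxE //; exact: diff_derivable.
  move/cvgrPdist_le : cD => /(_ c c0); rewrite D0.
  by apply: filterS => w; rewrite sub0r normrN.
move=> /nbhs_ballP[r /= r0 rB]; exists (r / 2); first by rewrite divr_gt0.
move=> w wr; have /rB[Ow Dc] : ball w0 r w.
  rewrite -ball_normE /= (le_lt_trans wr) // ltr_pdivrMr // ltr_pMr //.
  by rewrite ltr1n.
by split=> // i j; exact: (Dc (i, j)).
Qed.

Section fixed_radius.
Variable (r : R).
Hypotheses (r0 : 0 < r)
 (rP : forall w, `|w0 - w| <= r -> Om w /\
    forall i j, `|'D_(delta_mx 0 i) (fun w => g w 0 j) w| <= (2 * a.+1%:R)^-1).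

Let halfa : a%:R * (2 * a.+1%:R)^-1 <= 2^-1 :> R.
Proof.
rewrite invfM mulrCA ler_piMr ?invr_ge0 //.
by rewrite ler_pdivrMr ?ltr0n // mul1r ler_nat.
Qed.

Let g_lip w w' : `|w0 - w| <= r -> `|w0 - w'| <= r ->
  `|g w - g w'| <= 2^-1 * `|w - w'|.
Proof.
move=> wr w'r; apply: norm_row_le => [|j]; first
  by rewrite mulr_ge0 // invr_ge0.
rewrite !mxE; apply: le_trans (_ : a%:R * (2 * a.+1%:R)^-1 * `|w - w'| <= _).
  have := @lipschitz_partials _ _ Om (fun w => g w 0 j) w0 r (2 * a.+1%:R)^-1.
  move=> /(_ _ _ _ w w' wr w'r); rewrite !mxE; apply.
  - by move=> u /rP[].
  - exact: smooth_entry.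
  - by move=> u i /rP[_ +]; apply.
by rewrite ler_wpM2r.
Qed.

Let F_expand w w' : `|w0 - w| <= r -> `|w0 - w'| <= r ->
  `|w - w'| <= 2 * `|F w - F w'|.
Proof.
move=> wr w'r.
have : `|w - w'| <= `|F w - F w'| + 2^-1 * `|w - w'|.
  apply: le_trans (lerD (lexx _) (g_lip wr w'r)).
  have -> : w - w' = (F w - F w') - (g w - g w').
    by apply/rowP => j; rewrite /g !mxE; ring.
  exact: ler_normB.
lra.
Qed.

Let unit_partials w : `|w0 - w| <= r -> partials F w \in unitmx.
Proof.
move=> wr; rewrite -row_free_unit -kermx_eq0; apply/eqP/row_matrixP => i.
rewrite row0; set v := row i _.
have [Ow Dc] := rP wr.
have vF : 'D_v F w = 0.
  rewrite derive_partials_mx; last exact: dF.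
  by apply/sub_kermxP; exact: row_sub.
have dg := smooth_on_differentiable sg Ow.
have : `|v| <= 2^-1 * `|v|.
  have -> : `|v| = `|'D_v g w| by rewrite Dg // vF sub0r normrN.
  apply: norm_row_le => [|j]; first by rewrite mulr_ge0 // invr_ge0.
  rewrite derive_entry; last exact: diff_derivable.
  rewrite derive_partials; last exact: differentiable_entry.
  apply: le_trans (ler_norm_sum _ _ _) _.
  apply: le_trans (_ : a%:R * (2 * a.+1%:R)^-1 * `|v| <= _); last first.
    by rewrite -[X in _ <= _ * X](_ : `|v| = _) ?ler_wpM2r // Dg // vF sub0r
      normrN.
  rewrite -mulrA mulr_natl -[X in _ *+ X]card_ord -sumr_const ler_sum // => h _.
  by rewrite normrM mulrC ler_pM // norm_coord.
by move=> v2; apply/eqP; rewrite -normr_le0; lra.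
Qed.

Let solve y : `|F w0 - y| <= r / 2 -> exists2 w, `|w0 - w| <= r & F w = y.
Proof.
move=> yr.
pose B : set 'rV[R]_a := closed_ball_ Num.Def.normr w0 r.
pose T w := y - g w.
have w0B : B w0 by rewrite /B /closed_ball_ /= subrr normr0 ltW.
have TB : set_fun B B T.
  move=> w wr; rewrite /B /closed_ball_ /=.
  have -> : w0 - T w = (F w0 - y) - (g w0 - g w).
    by apply/rowP => j; rewrite /T /g !mxE; ring.
  apply: le_trans (ler_normB _ _) _; rewrite [leRHS](splitr r) lerD //.
  apply: le_trans (g_lip w0B wr) _; rewrite mulrC ler_pdivrMr // divfK //.
pose TF : {fun B >-> B} := HB.pack T (isFun.Build _ _ B B T TB).
have h0 : 0 <= 2^-1 :> R by [].
have cT : is_contraction TF.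
  exists (NngNum h0); split=> /=; first by rewrite invf_lt1 ?ltr1n.
  move=> [u v] [/= uB vB].
  have -> : T u - T v = - (g u - g v) by apply/rowP => j; rewrite /T !mxE; ring.
  by rewrite normrN; exact: g_lip.
have [p pB pE] := banach_fixed_point cT (@closed_closed_ball_ _ _ w0 r)
  (ex_intro _ _ w0B).
exists p => //; have pT : p = y - (F p - p) by exact: pE.
by have := congr1 (fun u => u + (F p - p)) pT; rewrite subrK addrC subrK.
Qed.

Lemma local_section_on_ball : exists (O : set 'rV[R]_a)
  (G : 'rV[R]_a -> 'rV[R]_a),
  [/\ open O, O (F w0), smooth_on O G, G (F w0) = w0 &
      forall y, O y -> Om (G y) /\ F (G y) = y].
Proof.
pose O : set 'rV[R]_a := ball (F w0) (r / 2).
have oO : open O by exact: ball_open.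
have r20 : 0 < r / 2 by rewrite divr_gt0.
have OF : O (F w0) by exact: ballxx.
have OE y : O y -> `|F w0 - y| <= r / 2 by rewrite /O -ball_normE => /ltW.
pose G y := xget w0 [set w | `|w0 - w| <= r /\ F w = y].
have GP y : O y -> `|w0 - G y| <= r /\ F (G y) = y.
  move=> /OE/solve[w wr Fw]; rewrite /G; case: xgetP => [x _ //|/(_ w)].
  by case.
have w0r : `|w0 - w0| <= r by rewrite subrr normr0 ltW.
have inj w w' : `|w0 - w| <= r -> `|w0 - w'| <= r -> F w = F w' -> w = w'.
  move=> wr w'r FF; apply/eqP; rewrite -subr_eq0 -normr_le0.
  by apply: le_trans (F_expand wr w'r) _; rewrite FF subrr normr0 mulr0.
have G0 : G (F w0) = w0.
  by have [? ?] := GP _ OF; exact: inj.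
have GOm y : O y -> Om (G y) by move=> /GP[/rP[]].
pose I y := invmx (partials F (G y)).
have dG y : O y -> differentiable G y /\
    'd G y = mulmxr (I y) :> ('rV[R]_a -> 'rV[R]_a).
  move=> Oy; have [yr yE] := GP _ Oy.
  have cI := @mulmxr_continuous R a a (I y).
  apply: differentiable_epsilon => // e e0.
  have [k k0 kI] := linear_lipschitz cI.
  have dFy := dF (GOm _ Oy).
  have e'0 : 0 < e / (2 * k) by rewrite divr_gt0 // mulr_gt0.
  have /eqaddoP/(_ _ e'0) := diff_locally dFy.
  move=> /nbhs_ballP[dl /= dl0 Hdl].
  have Onear : \forall h \near (0 : 'rV[R]_a), O (h + y).
    have := open_nbhs_nbhs (conj oO Oy).
    by rewrite -[nbhs _ _]/(\forall z \near y, O z) (near_shift 0 y) subr0.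
  have small : \forall h \near (0 : 'rV[R]_a), `|h| < dl / 2.
    apply/nbhs_ballP; exists (dl / 2); first by rewrite /= divr_gt0.
    by move=> h; rewrite -ball_normE /= sub0r normrN.
  near=> h.
  have Oh : O (h + y) by near: h.
  have [hr hE] := GP _ Oh.
  set K := G (h + y) - G y.
  have Kle : `|K| <= 2 * `|h|.
    by apply: le_trans (F_expand hr yr) _; rewrite hE yE addrK.
  have Kdl : ball (0 : 'rV[R]_a) dl K.
    rewrite -ball_normE /= sub0r normrN (le_lt_trans Kle) //.
    rewrite mulrC -ltr_pdivlMr //.
    by near: h.
  have := Hdl _ Kdl; rewrite !fctE /= {1}/K subrK hE yE.
  rewrite -deriveE // derive_partials_mx // => Hk.
  have -> : G (h + y) - (G y + mulmxr (I y) h) =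
     - mulmxr (I y) (h + y - (y + K *m partials F (G y))).
    have KI : K *m partials F (G y) *m I y = K.
      by rewrite -mulmxA mulmxV ?mulmx1 //; exact: unit_partials.
    have -> : h + y - (y + K *m partials F (G y)) = h - K *m partials F (G y).
      by rewrite opprD addrA addrK.
    by rewrite /= mulmxBl KI opprB /K opprD addrA.
  rewrite normrN; apply: le_trans (kI _) _.
  rewrite -ler_pdivlMl //; apply: le_trans Hk _.
  apply: le_trans (ler_wpM2l (ltW e'0) Kle) _.
  rewrite le_eqVlt; apply/orP; left; apply/eqP.
  by field; rewrite gt_eqF.
(* The partial derivatives of [f \o G] are the composites with [G] of the
   smooth functions [sum_j (DF)^-1_(i, j) * df/dw_j]. *)
pose Om' := [set w | Om w /\ \det (partials F w) != 0].
have oOm' : open Om'.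
  apply: smooth_neq0_open => //; apply: smooth_mx_det => //.
  exact: smooth_partials.
have GOm' y : O y -> Om' (G y).
  move=> Oy; split; first exact: GOm.
  have [/unit_partials + _] := GP _ Oy.
  by rewrite unitmxE unitfE.
have sinv : smooth_mx Om' (fun w => invmx (partials F w)).
  apply: smooth_invmx => // [|w [_]]; last by rewrite unitmxE unitfE.
  by apply: smooth_partials => //; apply: smooth_on_sub sF => w [].
have sG f : smooth_on Om' f -> smooth_on O (f \o G : _ -> R).
  move=> sf;
    apply: (@smooth_on_coind _ _ _ O (fun h => exists2 f, smooth_on Om' f &
     h = f \o G)) => //; last by exists f.
  move=> h {f sf} [f sf ->].
  have df y : O y -> differentiable f (G y).
    by move=> /GOm'; exact: smooth_on_differentiable sf.
  split=> [y Oy|i].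
    by apply: differentiable_comp; [have [] := dG _ Oy|exact: df].
  exists ((fun w => \sum_j (invmx (partials F w)) i j * 'D_(delta_mx 0 j) f w)
    \o G).
    eexists; last by [].
    apply: smooth_sum => // j; apply: smoothM => //.
    exact: smooth_on_partial.
  move=> y Oy; have [dGy DG] := dG _ Oy.
  rewrite derive_chain //; last exact: df.
  have -> : 'D_(delta_mx 0 i) G y = delta_mx 0 i *m I y
    by rewrite deriveE // DG.
  rewrite derive_partials; last exact: df.
  by apply: eq_bigr => j _; rewrite -rowE mxE.
exists O, G; split=> //.
  apply: smooth_row => // j.
  by apply: (sG (fun w => w 0 j)); exact: smooth_coord.
by move=> y Oy; split; [exact: GOm|have [] := GP _ Oy].
Unshelve. all: by end_near. Qed.

End fixed_radius.

Theorem local_section : exists (O : set 'rV[R]_a) (G : 'rV[R]_a -> 'rV[R]_a),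
  [/\ open O, O (F w0), smooth_on O G, G (F w0) = w0 &
      forall y, O y -> Om (G y) /\ F (G y) = y].
Proof. by have [r r0 rP] := good_radius;
  exact: local_section_on_ball r0 rP. Qed.

End local_section.

(** * Level sets as graphs over their tangent space *)

Section kernel_factor.
Variables (F : fieldType).

Lemma kernel_factor a b c (D : 'M[F]_(a, b)) (B : 'M[F]_(a, c)) :
  (forall v : 'rV_a, v *m D = 0 -> v *m B = 0) -> exists C, B = D *m C.
Proof.
move=> DB.
suff /submxP[C BC] : (B^T <= D^T)%MS.
  by exists C^T; rewrite -[B]trmxK BC trmx_mul trmxK.
set K := cokermx D^T.
have KD : K^T *m D = 0.
  by rewrite -[D]trmxK -trmx_mul mulmx_coker trmx0.
rewrite submxE -/K -[B^T *m K]trmxK trmx_mul trmxK.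
suff -> : K^T *m B = 0 by rewrite trmx0.
by apply/row_matrixP => i; rewrite row0 row_mul DB // -row_mul KD row0.
Qed.

End kernel_factor.

Section local_graph.
Variables (R : realType) (a b l : nat).
Variables (Om : set 'rV[R]_a) (f : 'rV[R]_a -> 'rV[R]_b) (w0 : 'rV[R]_a).
Variables (iota : 'M[R]_(l, a)) (varpi : 'M[R]_(a, l)).
Hypotheses (oOm : open Om) (Omw0 : Om w0) (sf : smooth_on Om f) (f0 : f w0 = 0).
Hypothesis iotaK : iota *m varpi = 1%:M.
Hypothesis ker_iota : forall v : 'rV_a, v *m partials f w0 = 0 <->
  (v <= iota)%MS.
Hypothesis f_image : forall w, Om w -> (f w <= partials f w0)%MS.

(** Let [D] be the differential of [f] at [w0]; [varpi *m iota] is a projection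
    onto its kernel.  Choose [C] with [D *m C = 1 - varpi *m iota]: the map
    [F w = (w - w0) varpi iota + (f w) C] has differential 1 at [w0], and [G] is
    a section of [F] restricted to the kernel.  The hypothesis [f_image]
    replaces the surjectivity of [D]: it lets one recover [f w] from
    [(f w) C], because [D *m C *m D = D]. *)
Lemma local_graph : exists (O : set 'rV[R]_l) (G : 'rV[R]_l -> 'rV[R]_a),
  [/\ open O, O 0, smooth_on O G, G 0 = w0 &
      forall u, O u -> [/\ Om (G u), f (G u) = 0 & (G u - w0) *m varpi = u]].
Proof.
move: ker_iota f_image; set D := partials f w0 => kerD f_im.
have iotaD : iota *m D = 0.
  by apply/row_matrixP => i; rewrite row_mul row0; apply/kerD; exact: row_sub.
have [C CE] : exists C, 1%:M - varpi *m iota = D *m C.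
  apply: kernel_factor => v /kerD/submxP[x ->].
  by rewrite mulmxBr mulmx1 -mulmxA [iota *m _]mulmxA iotaK mul1mx subrr.
pose F w := (w - w0) *m (varpi *m iota) + f w *m C.
have sF : smooth_on Om F.
  apply/smooth_rowE => //; apply: smooth_mxD => //.
    apply: smooth_mxM => //; last exact: smooth_mx_cst.
    apply: smooth_mxD => //; first exact: smooth_id.
    exact: smooth_mx_cst.
  by apply: smooth_mxM => //; [exact/smooth_rowE|exact: smooth_mx_cst].
have DF v : 'D_v F w0 = v.
  have df : differentiable f w0 by exact: smooth_on_differentiable sf Omw0.
  have [d2 D2] := derive_mulmxr C v df.
  have did : differentiable (fun w : 'rV[R]_a => w - w0) w0.
    apply: (@differentiableB _ _ _ id (cst w0)) => //.
  have [d1 D1] := derive_mulmxr (varpi *m iota) v did.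
  rewrite deriveD; [|exact: diff_derivable..].
  rewrite D1 D2 (@deriveB _ _ _ id (cst w0)) //.
  rewrite derive_id derive_cst subr0 derive_partials_mx // -mulmxA -CE.
  by rewrite mulmxBr mulmx1 addrC subrK.
have F0 : F w0 = 0 by rewrite /F subrr mul0mx f0 mul0mx addr0.
have [Q [G [oO OF sG GF GP]]] := local_section oOm Omw0 sF DF.
rewrite F0 in OF GF.
have siota : smooth_on setT (mulmxr iota : 'rV[R]_l -> 'rV[R]_a).
  apply/smooth_rowE; first exact: openT.
  by apply: smooth_mxM;
    [exact: openT|exact: smooth_id|exact/smooth_mx_cst/openT].
exists [set u | setT u /\ Q (u *m iota)], (fun u => G (u *m iota)).
have oO' : open [set u : 'rV[R]_l | setT u /\ Q (u *m iota)].
  by apply: smooth_preimage_open => //; exact: openT.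
split=> //=; rewrite ?mul0mx //.
  apply: (@smooth_comp _ _ _ _ _ Q (mulmxr iota : 'rV[R]_l -> 'rV[R]_a) G oO'
    oO _ sG) => //; last by move=> p [].
  exact: smooth_on_sub siota.
move=> u [_ Ou]; have [OmG FG] := GP _ Ou.
have fG : f (G (u *m iota)) = 0.
  have /submxP[x xE] := f_im _ OmG.
  have := congr1 (mulmxr D) FG.
  rewrite /= mulmxDl -!mulmxA iotaD !mulmx0 add0r xE -mulmxA.
  by rewrite (mulmxA D) -CE mulmxBl mul1mx -mulmxA iotaD mulmx0 subr0.
split=> //; have := congr1 (mulmxr varpi) FG.
by rewrite /F fG mul0mx addr0 /= -!mulmxA iotaK !mulmx1.
Qed.

End local_graph.

(** * Smooth curves as tangent vectors *)

Section curves.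
Variables (R : realType) (d D : nat).
Variables (U : set 'rV[R]_d) (F : 'rV[R]_d -> 'rV[R]_D) (S : set 'rV[R]_D).
Hypotheses (oU : open U) (sF : smooth_on U F) (FS : forall q, U q -> S (F q)).

(** The velocity of a line of the parameter space. *)
Lemma smooth_image_tangent p v : U p -> tangent S (F p) ('D_v F p).
Proof.
move=> Up.
have small : \forall t \near (0 : R), U (p + t *: v).
  have cl : {for (0 : R), continuous (fun t : R => p + t *: v)}.
    apply: differentiable_continuous.
    by have [] := line_derivative p v 0.
  by apply: cl; rewrite /= scale0r addr0; exact: (open_nbhs_nbhs (conj oU Up)).
have [e e0 He] : exists2 e : R, 0 < e & forall t : R, `|t| < e ->
  U (p + t *: v).
  move/nbhs_ballP : small => [e /= e0 He]; exists e => // t te; apply: He.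
  by rewrite -ball_normE /= sub0r normrN.
have opE (t : R) : `|t| < e -> \near t, `|t| < e.
  move=> te; have te' : (ball (0 : R) e) t
    by rewrite -ball_normE /= sub0r normrN.
  have := open_nbhs_nbhs (conj (ball_open (0 : R) e) te').
  by apply: filterS => u; rewrite -ball_normE /= sub0r normrN.
pose gam (t : R) := F (p + t *: v).
have key j : exists2 H : 'rV[R]_d -> 'rV[R]_D, smooth_on U H &
    forall t : R, `|t| < e -> derive1n j gam t = H (p + t *: v).
  elim: j => [|j [H sH HE]]; first by exists F.
  have dH q : U q -> differentiable H q by exact: smooth_on_differentiable sH.
  exists (fun q => 'D_v H q).
    apply: smooth_row => // j'.
    apply: (@smooth_on_ext _ _ _ _ (fun q => 'D_v (fun q => H q 0 j') q)) => //.
      by move=> q Uq; rewrite derive_entry //; apply: diff_derivable; exact: dH.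
    by apply: smooth_derive => //; exact: smooth_entry.
  move=> t te; rewrite derive1nS derive1E.
  have [_ <-] := derive_line (dH _ (He _ te)).
  by apply: near_eq_derive; apply: filterS (opE _ te).
exists e, gam; split; first exact: e0.
- move=> j t te; have [H sH HE] := key j.
  apply: (@near_eq_derivable _ R^o _ (fun t => H (p + t *: v))).
    by apply: filterS (opE _ te) => u ue; rewrite HE.
  apply: diff_derivable.
  by have [] := derive_line (smooth_on_differentiable sH (He _ te)).
- by move=> t te; apply: FS; exact: He.
- by rewrite /gam scale0r addr0.
- rewrite derive1E.
  have U0 : U (p + 0 *: v) by rewrite scale0r addr0.
  have [_ ->] := derive_line (smooth_on_differentiable sF U0).
  by rewrite scale0r addr0.
Qed.

End curves.

(** * Symmetry of second derivatives *)

Lemma dist_half (R : realType) (x y z e : R) :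
  `|x - z| <= e / 2 -> `|y - z| <= e / 2 -> `|x - y| <= e.
Proof.
move=> xz yz; apply: le_trans (ler_distD z _ _) _.
by rewrite [leRHS]splitr lerD // distrC.
Qed.

Section schwarz.
Variables (R : realType) (d : nat) (U : set 'rV[R]_d) (f : 'rV[R]_d -> R).
Hypotheses (oU : open U) (sf : smooth_on U f).

Let second_difference p u v (h : R) :=
  f (p + h *: u + h *: v) - f (p + h *: u) - (f (p + h *: v) - f p).

Lemma mean_value_line (g : 'rV[R]_d -> R) q u (h : R) : 0 < h ->
  (forall t, 0 <= t <= h -> differentiable g (q + t *: u)) ->
  exists2 t, 0 <= t <= h & g (q + h *: u) - g q = 'D_u g (q + t *: u) * h.
Proof.
move=> h0 dg.
have [t||t th E] := @MVT_segment R (fun t => g (q + t *: u))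
   (fun t => 'D_u g (q + t *: u)) 0 h (ltW h0).
- rewrite in_itv /= => /andP[t0 t1].
  have [dl Dl] := derive_line (dg t (introT andP (conj (ltW t0) (ltW t1)))).
  by apply: DeriveDef => //; exact: diff_derivable.
- apply: continuous_in_subspaceT => t; rewrite inE /= in_itv /= => /dg dt.
  by apply: differentiable_continuous; have [] := derive_line dt.
exists t; first by move: th; rewrite in_itv.
by move: E; rewrite scale0r addr0 subr0.
Qed.

(** The mean value theorem, first in the direction [u] for the increment of [f]
    by [h v], then in the direction [v]. *)
Lemma second_differenceE p u v (h : R) : 0 < h ->
  (forall s t, 0 <= s <= h -> 0 <= t <= h -> U (p + s *: u + t *: v)) ->
  exists s t, [/\ 0 <= s <= h, 0 <= t <= h & second_difference p u v h =
    'D_v (fun q => 'D_u f q) (p + s *: u + t *: v) * h * h].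
Proof.
move=> h0 HU.
have h01 : 0 <= h <= h by rewrite ltW //= lexx.
have h00 : 0 <= (0 : R) <= h by rewrite lexx ltW.
pose g q := f (q + h *: v) - f q.
have dfU q : U q -> differentiable f q by exact: smooth_on_differentiable sf.
have dtr q : U (q + h *: v) -> differentiable (fun q => f (q + h *: v)) q /\
   'D_u (fun q => f (q + h *: v)) q = 'D_u f (q + h *: v).
  move=> Uq.
  have dsh : differentiable (fun q : 'rV[R]_d => q + h *: v) q.
    exact: (@differentiableD _ _ _ id (cst (h *: v))).
  have dfq := dfU _ Uq.
  split; first exact:
    (@differentiable_comp _ _ _ _ (fun q : 'rV[R]_d => q + h *: v) f).
  rewrite (derive_chain (f := fun q : 'rV[R]_d => q + h *: v) (g := f)) //.
  congr ('D_ _ f _); rewrite (@deriveD _ _ _ id (cst (h *: v))) //.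
  by rewrite derive_id derive_cst addr0.
have dg s : 0 <= s <= h -> differentiable g (p + s *: u) /\
   'D_u g (p + s *: u) = 'D_u f (p + s *: u + h *: v) - 'D_u f (p + s *: u).
  move=> sh; have [d1 D1] := dtr _ (HU s h sh h01).
  have U0 : U (p + s *: u) by have := HU s 0 sh h00; rewrite scale0r addr0.
  split; first by apply: differentiableB => //; exact: dfU.
  rewrite (@deriveB _ _ _ (fun q => f (q + h *: v)) f) ?D1 //.
    exact: diff_derivable.
  by apply: diff_derivable; exact: dfU.
have [t th|s sh E1] := @mean_value_line g p u h h0; first by have [] := dg _ th.
have [t th|t th E2] := @mean_value_line (fun q => 'D_u f q) (p + s *: u) v h h0.
  apply: smooth_on_differentiable (HU s t sh th).
  exact: smooth_derive.
exists s, t; split=> //; rewrite -E2.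
by have [_ <-] := dg _ sh; rewrite -E1.
Qed.

(** The second difference is symmetric in [u] and [v], and it is [h^2] times a
    value of either mixed derivative near [p]. *)
Lemma derive_comm p u v : U p ->
  'D_v (fun q => 'D_u f q) p = 'D_u (fun q => 'D_v f q) p.
Proof.
move=> Up; apply/eqP; rewrite -subr_eq0 -normr_le0; apply/ler_addgt0Pr => e e0.
rewrite add0r.
have cont a b : {for p, continuous (fun q => 'D_a (fun q => 'D_b f q) q)}.
  apply: differentiable_continuous; apply: smooth_on_differentiable Up.
  by apply: smooth_derive => //; exact: smooth_derive.
have e20 : 0 < e / 2 by rewrite divr_gt0.
have close a b : \forall q \near p,
    `|'D_a (fun q => 'D_b f q) p - 'D_a (fun q => 'D_b f q) q| <= e / 2.
  by have /cvgrPdist_le/(_ _ e20) := cont a b.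
have /nbhs_ballP[r /= r0 rP] : \forall q \near p, [/\ U q,
   `|'D_v (fun q => 'D_u f q) p - 'D_v (fun q => 'D_u f q) q| <= e / 2 &
   `|'D_u (fun q => 'D_v f q) p - 'D_u (fun q => 'D_v f q) q| <= e / 2].
  apply: filterS (filterI (open_nbhs_nbhs (conj oU Up))
    (filterI (close v u) (close u v))).
  by move=> q [Uq [c1 c2]].
pose h := r / (1 + `|u| + `|v|).
have den : 0 < 1 + `|u| + `|v| by rewrite ltr_pwDl // ltr_pwDl.
have h0 : 0 < h by rewrite divr_gt0.
have inB a b s t : `|a| + `|b| = `|u| + `|v| -> 0 <= s <= h -> 0 <= t <= h ->
   ball p r (p + s *: a + t *: b).
  move=> ab /andP[s0 sh] /andP[t0 th]; rewrite -ball_normE /=.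
  rewrite -addrA opprD addrA subrr sub0r normrN.
  apply: le_lt_trans (ler_normD _ _) _; rewrite !normrZ !ger0_norm //.
  apply: le_lt_trans (lerD (ler_wpM2r _ sh) (ler_wpM2r _ th)) _ => //.
  by rewrite -mulrDr ab /h mulrAC ltr_pdivrMr // ltr_pM2l // -addrA ltrDr.
have [||s [t [sh th E1]]] := @second_differenceE p u v h; rewrite //.
  by move=> s t sh th; have [] := rP _ (inB u v s t erefl sh th).
have [||s' [t' [sh' th' E2]]] := @second_differenceE p v u h; rewrite //.
  by move=> s' t' sh1 th1; have [] := rP _ (inB v u s' t' (addrC _ _) sh1 th1).
have E : second_difference p u v h = second_difference p v u h.
  by rewrite /second_difference (addrAC p); ring.
have EE : 'D_v (fun q => 'D_u f q) (p + s *: u + t *: v) =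
          'D_u (fun q => 'D_v f q) (p + s' *: v + t' *: u).
  by have := E; rewrite E1 E2 => /(mulIf (lt0r_neq0 h0))/(mulIf (lt0r_neq0 h0)).
have [_ b1 _] := rP _ (inB u v s t erefl sh th).
have [_ _ b2] := rP _ (inB v u s' t' (addrC _ _) sh' th').
rewrite EE in b1; exact: (dist_half b1 b2).
Qed.

End schwarz.

(** * Derivatives of graph parametrizations *)

Section graph_derivative.
Variables (R : realType) (a b l : nat).
Variables (O : set 'rV[R]_l) (G : 'rV[R]_l -> 'rV[R]_a).
Variables (w0 : 'rV[R]_a) (varpi : 'M[R]_(a, l)).
Hypotheses (oO : open O) (sG : smooth_on O G).
Hypothesis GP : forall u, O u -> (G u - w0) *m varpi = u.

Lemma graph_derive_proj u v : O u -> 'D_v G u *m varpi = v.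
Proof.
move=> Ou; have dG := smooth_on_differentiable sG Ou.
have dc : differentiable (cst w0 : 'rV[R]_l -> _) u
  by exact: differentiable_cst.
have dB : differentiable (fun u => G u - w0) u.
  exact: (@differentiableB _ _ _ G (cst w0)).
have [_ DB] := derive_mulmxr (f := fun u => G u - w0) varpi v dB.
have -> : 'D_v G u = 'D_v (fun u => G u - w0) u.
  rewrite (@deriveB _ _ _ G (cst w0)); [|exact: diff_derivable..].
  by rewrite derive_cst subr0.
rewrite -DB -[RHS](derive_id u); apply: near_eq_derive.
exact: open_nearby GP.
Qed.

Variables (Om : set 'rV[R]_a) (f : 'rV[R]_a -> 'rV[R]_b) (iota : 'M[R]_(l, a)).
Hypotheses (oOm : open Om) (sf : smooth_on Om f).
Hypothesis iotaK : iota *m varpi = 1%:M.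
Hypothesis ker_iota : forall v : 'rV_a, v *m partials f w0 = 0 ->
  (v <= iota)%MS.
Hypothesis fG : forall u, O u -> Om (G u) /\ f (G u) = 0.
Hypotheses (O0 : O 0) (G0 : G 0 = w0).

(** The derivative lies in the kernel of the differential of [f], spanned by
    [iota], where it is determined by its image under [varpi]. *)
Lemma graph_derive0 v : 'D_v G 0 = v *m iota.
Proof.
have [OmG _] := fG O0; have dG := smooth_on_differentiable sG O0.
have df := smooth_on_differentiable sf OmG.
have /ker_iota/submxP[x xE] : 'D_v G 0 *m partials f w0 = 0.
  rewrite -G0 -derive_partials_mx // -derive_chain //.
  rewrite -[RHS](derive_cst 0 0 v); apply: near_eq_derive.
  by apply: open_nearby oO O0 _ => u /fG[].
by have := graph_derive_proj v O0; rewrite xE -mulmxA iotaK mulmx1 => ->.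
Qed.

End graph_derivative.

(** * Multiplication by i and conormal covectors *)

Section complex_structure.
Variables (R : realType) (N : nat).

(** Row vectors are multiplied on the right: [v *m Jmx] is i v. *)
Definition Jmx : 'M[R]_(N + N) := block_mx 0 1%:M (- 1%:M) 0.

Lemma JmulE (v : Cspace R N) : Jmul v = v *m Jmx.
Proof.
by rewrite -{2}[v]hsubmxK mul_row_block !mulmx0 add0r addr0 mulmxN !mulmx1.
Qed.

Lemma Jmx_sqr : Jmx *m Jmx = - 1%:M.
Proof.
rewrite mulmx_block !mulmx0 !mul0mx !mulmx1 !add0r !addr0 mul1mx.
by rewrite [in RHS]scalar_mx_block opp_block_mx !oppr0.
Qed.

Lemma Jmx_tr : Jmx^T = - Jmx.
Proof.
by rewrite tr_block_mx opp_block_mx !trmx0 linearN /= trmx1 opprK oppr0.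
Qed.

Lemma mulmxJJ m (A : 'M[R]_(m, N + N)) : A *m Jmx *m Jmx = - A.
Proof. by rewrite -mulmxA Jmx_sqr mulmxN mulmx1. Qed.

Lemma dcE (f : Cspace R N -> R) p :
  dc f p = (\row_i 'D_(delta_mx 0 i) f p) *m Jmx.
Proof.
rewrite -JmulE /Jmul /dc; congr row_mx; apply/rowP => j; rewrite !mxE //.
Qed.

End complex_structure.

Section conormal_bundle.
Variables (R : realType) (N k : nat).
Notation C := (Cspace R N).
Notation T := 'rV[R]_((N + N) + (N + N)).
Local Notation J := (Jmx R N).

Definition rowfun (rho : 'I_k -> C -> R) (p : C) : 'rV[R]_k := \row_j rho j p.

(** The gradients are the columns, so that [v *m gradients rho p] is the
    differential at [v]; by [dcE] the covectors [dc (rho j) p] are the rows of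
    [(gradients rho p)^T *m Jmx]. *)
Definition gradients (rho : 'I_k -> C -> R) (p : C) : 'M[R]_(N + N, k) :=
  \matrix_(i, j) 'D_(delta_mx 0 i) (rho j) p.

(** The Hessian of the combination of the [rho j] with constant
    coefficients [a]. *)
Definition hessian (rho : 'I_k -> C -> R) (a : 'rV[R]_k) (p : C) :
    'M[R]_(N + N) :=
  \matrix_(i, i') \sum_j a 0 j *
     'D_(delta_mx 0 i) (fun q => 'D_(delta_mx 0 i') (rho j) q) p.

Variables (rho : 'I_k -> C -> R) (Om : set C).
Hypotheses (oOm : open Om) (srho : forall j, smooth_on Om (rho j)).
Local Notation D := (gradients rho).
Local Notation r := (rowfun rho).

Lemma partials_rowfun p : partials r p = D p.
Proof.
apply/matrixP => i j; rewrite !mxE; congr ('D_ _ _ p).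
by apply/funext => q; rewrite mxE.
Qed.

Lemma smooth_rowfun : smooth_on Om r.
Proof.
apply: smooth_row => // j; apply: smooth_on_ext (srho j) => // p _.
by rewrite mxE.
Qed.

Lemma smooth_gradients : smooth_mx Om D.
Proof.
move=> i j; rewrite /gradients; under eq_fun do rewrite mxE.
exact: smooth_on_partial.
Qed.

Lemma smooth_hessian d (U : set 'rV[R]_d) (a : 'rV[R]_d -> 'rV[R]_k)
  (q : 'rV[R]_d -> C) :
  open U -> smooth_on U a -> smooth_on U q -> (forall w, U w -> Om (q w)) ->
  smooth_mx U (fun w => hessian rho (a w) (q w)).
Proof.
move=> oU sa sq UOm i i'; rewrite /hessian; under eq_fun do rewrite mxE.
apply: smooth_sum => // j; apply: smoothM => //; first exact: smooth_entry.
apply: (smooth_comp_scalar (G := q) (U' := Om) (f := fun p => 'D_(delta_mx 0 i)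
  (fun q => 'D_(delta_mx 0 i') (rho j) q) p)) => //.
by do 2!apply: smooth_on_partial.
Qed.

Lemma hessian_sym a p : Om p -> (hessian rho a p)^T = hessian rho a p.
Proof.
move=> Op; apply/matrixP => i i'; rewrite !mxE; apply: eq_bigr => j _.
by rewrite (derive_comm oOm (srho j) (delta_mx 0 i) (delta_mx 0 i') Op).
Qed.

(** The Leibniz rule for the conormal covector [sum_j a_j grad (rho_j) (q)]. *)
Lemma derive_conormal (V : normedModType R) (a : V -> 'rV[R]_k)
  (q : V -> C) x v :
  differentiable a x -> differentiable q x -> Om (q x) ->
  differentiable (fun w => a w *m (D (q w))^T) x /\
  'D_v (fun w => a w *m (D (q w))^T) x =
    'D_v a x *m (D (q x))^T + 'D_v q x *m hessian rho (a x) (q x).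
Proof.
move=> da dq Oq.
have dDq j i : differentiable (fun p => 'D_(delta_mx 0 i) (rho j) p) (q x).
  exact: smooth_on_differentiable (smooth_on_partial _ (srho j)) Oq.
have dD j i : differentiable ((fun p => 'D_(delta_mx 0 i) (rho j) p) \o q) x.
  exact: differentiable_comp.
have daj j : differentiable (fun w => a w 0 j) x by exact: differentiable_entry.
have entryE i w : (a w *m (D (q w))^T) 0 i =
    \sum_j a w 0 j * ((fun p => 'D_(delta_mx 0 i) (rho j) p) \o q) w.
  by rewrite mxE; apply: eq_bigr => j _; rewrite !mxE.
have sumE i : (fun w => (a w *m (D (q w))^T) 0 i) = \sum_j (fun w =>
    a w 0 j * ((fun p => 'D_(delta_mx 0 i) (rho j) p) \o q) w).
  by apply/funext => w; rewrite entryE fct_sumE.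
have dM j i : differentiable (fun w =>
    a w 0 j * ((fun p => 'D_(delta_mx 0 i) (rho j) p) \o q) w) x.
  exact: differentiableM.
have dF : differentiable (fun w => a w *m (D (q w))^T) x.
  apply: differentiable_rowP => i; rewrite sumE.
  exact: differentiable_sum.
split=> //; apply/rowP => i.
rewrite derive_entry; last exact: diff_derivable.
rewrite sumE derive_sum; last by move=> j; exact: diff_derivable.
rewrite !mxE.
under [X in _ = _ + X]eq_bigr => i' _.
  rewrite mxE mulr_sumr; over.
rewrite exchange_big -big_split /=; apply: eq_bigr => j _.
rewrite (@deriveM _ _ (fun w => a w 0 j)); last 2 first.
- exact/diff_derivable/daj.
- exact/diff_derivable/dD.
rewrite derive_entry; last exact: diff_derivable.
rewrite addrC !mxE /=; congr (_ + _); last by rewrite [LHS]mulrC.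
have -> := derive_chain v dq (dDq j i).
rewrite (derive_partials _ (dDq j i)).
rewrite [LHS]scaler_sumr; apply: eq_bigr => i' _.
by rewrite [LHS]mulrCA.
Qed.

End conormal_bundle.

(** * Tangent spaces of level sets *)

Section tangent_spaces.
Variables (R : realType) (D : nat).

Lemma tangent_differentiable (S : set 'rV[R]_D) p v : tangent S p v ->
  exists gam : R -> 'rV[R]_D, [/\ differentiable gam 0, \forall t \near
    (0 : R), S (gam t),
    gam 0 = p & 'D_1 gam 0 = v].
Proof.
move=> [e [gam [e0 dgam Sgam g0 <-]]]; exists gam; split.
- by apply/derivable1_diffP; apply: (dgam 0%N); rewrite normr0.
- apply/nbhs_ballP; exists e => // t; rewrite -ball_normE /= sub0r normrN.
  exact: Sgam.
- exact: g0.
- by rewrite -derive1E.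
Qed.

Lemma derive_eq0_along d (f : 'rV[R]_D -> 'rV[R]_d) (gam : R -> 'rV[R]_D) :
  differentiable gam 0 -> differentiable f (gam 0) ->
  (\forall t \near (0 : R), f (gam t) = 0) -> 'D_('D_1 gam 0) f (gam 0) = 0.
Proof.
move=> dg df fg; rewrite -derive_chain // -[RHS](derive_cst 0 (0 : R) 1).
exact: near_eq_derive.
Qed.

Lemma curve_near_open (U : set 'rV[R]_D) (gam : R -> 'rV[R]_D) :
  open U -> differentiable gam 0 -> U (gam 0) -> \forall t \near (0 : R), U
    (gam t).
Proof.
move=> oU dg U0; have cg := differentiable_continuous dg.
exact: cg (open_nbhs_nbhs (conj oU U0)).
Qed.

End tangent_spaces.

Section level_set.
Variables (R : realType) (N k : nat).
Notation C := (Cspace R N).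
Variables (rho : 'I_k -> C -> R) (Om : set C) (S : set C).
Hypotheses (oOm : open Om) (srho : forall j, smooth_on Om (rho j)).
Hypothesis S_level : forall q, Om q -> (S q <-> rowfun rho q = 0).
Local Notation D := (gradients rho).
Local Notation r := (rowfun rho).

Lemma tangent_level_sub p v : Om p -> tangent S p v -> v *m D p = 0.
Proof.
move=> Omp /tangent_differentiable[gam [dg Sg g0 <-]].
have Omg : Om (gam 0) by rewrite g0.
have dr : differentiable r (gam 0).
  exact: smooth_on_differentiable (smooth_rowfun oOm srho) Omg.
rewrite -g0 -partials_rowfun -derive_partials_mx //.
apply: derive_eq0_along => //.
apply: filterS (filterI Sg (curve_near_open oOm dg Omg)) => t [St Ot].
exact/S_level.
Qed.

(** A parametrization of the level set near [p], with tangent map [iota] at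
    [p]. *)
Definition level_chart (p : C) (l : nat) (O : set 'rV[R]_l) (G : 'rV[R]_l -> C)
   (iota : 'M[R]_(l, N + N)) :=
  [/\ open O, O 0, smooth_on O G, G 0 = p &
     [/\ (forall u, O u -> Om (G u) /\ S (G u)),
     (forall u, 'D_u G 0 = u *m iota) &
     forall v : C, v *m D p = 0 -> exists u, v = u *m iota]].

Lemma level_chart_exists p : Om p -> S p ->
  (forall c : 'rV_k, c *m (D p)^T = 0 -> c = 0) ->
  exists (l : nat) (O : set 'rV[R]_l) (G : 'rV[R]_l -> C) iota,
    level_chart p O G iota.
Proof.
move=> Omp Sp free.
set K := row_base (kermx (D p)).
have freeK : row_free K by exact: row_base_free.
have [P KP] : exists P, K *m P = 1%:M by apply/row_freeP.
have kerK (v : 'rV_(N + N)) : v *m D p = 0 <-> (v <= K)%MS.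
  rewrite /K eq_row_base; split; [by move/sub_kermxP|by move/sub_kermxP].
have full w : (r w <= D p)%MS.
  apply: submx_full; rewrite -col_leq_rank -mxrank_tr.
  suff : row_free (D p)^T by rewrite /row_free => /eqP ->.
  rewrite -kermx_eq0; apply/eqP/row_matrixP => i.
  by rewrite row0; apply: free; apply/sub_kermxP; exact: row_sub.
have sr := smooth_rowfun oOm srho.
have [|||Q [G [oQ Q0 sG G0 GP]]] := local_graph oOm Omp sr _ KP.
- exact/S_level.
- by move=> v; rewrite partials_rowfun; exact: kerK.
- by move=> w _; rewrite partials_rowfun; exact: full.
exists _, Q, G, K; split=> //; split.
- by move=> u /GP[OmG rG _]; split=> //; exact/S_level.
- move=> u; apply: (graph_derive0 oQ sG _ sr KP) => //.
  + by move=> w /GP[]; rewrite G0.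
  + by move=> v; rewrite G0 partials_rowfun => /kerK.
  + by move=> w /GP[? ? _].
- by move=> v /kerK/submxP.
Qed.

(** Any vector of the kernel is the velocity of a curve of the level set, by
    the inverse function theorem. *)
Lemma tangent_level p v : Om p -> S p ->
  (forall c : 'rV_k, c *m (D p)^T = 0 -> c = 0) ->
  tangent S p v <-> v *m D p = 0.
Proof.
move=> Omp Sp free; split=> [|vD]; first exact: tangent_level_sub.
have [l [Q [G [iota [oQ Q0 sG G0 [GS DG /(_ _ vD)[u ->]]]]]]] :=
  level_chart_exists Omp Sp free.
rewrite -DG -G0; apply: smooth_image_tangent oQ sG _ _ _ Q0.
by move=> q /GS[].
Qed.

End level_set.

(** * The radical of the tautological form *)

Section submatrices.
Variables (R : realType).

Lemma lsubmx_mul m n1 n2 (v : 'M[R]_(m, n1 + n2)) :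
  lsubmx v = v *m col_mx 1%:M 0.
Proof. by rewrite -{2}[v]hsubmxK mul_row_col mulmx1 mulmx0 addr0. Qed.

Lemma rsubmx_mul m n1 n2 (v : 'M[R]_(m, n1 + n2)) :
  rsubmx v = v *m col_mx 0 1%:M.
Proof. by rewrite -{2}[v]hsubmxK mul_row_col mulmx1 mulmx0 add0r. Qed.

Lemma derive_lsubmx (V : normedModType R) n1 n2
    (f : V -> 'rV[R]_(n1 + n2)) p v :
  differentiable f p -> differentiable (fun q => lsubmx (f q)) p /\
  'D_v (fun q => lsubmx (f q)) p = lsubmx ('D_v f p).
Proof.
move=> df; have [d1 D1] := derive_mulmxr (col_mx 1%:M 0 : 'M[R]_(n1 + n2, n1))
  v df.
rewrite (_ : (fun q => _) = fun q => f q *m col_mx 1%:M 0); last first.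
  by apply/funext => q; rewrite lsubmx_mul.
by rewrite lsubmx_mul.
Qed.

Lemma derive_rsubmx (V : normedModType R) n1 n2
    (f : V -> 'rV[R]_(n1 + n2)) p v :
  differentiable f p -> differentiable (fun q => rsubmx (f q)) p /\
  'D_v (fun q => rsubmx (f q)) p = rsubmx ('D_v f p).
Proof.
move=> df; have [d1 D1] := derive_mulmxr (col_mx 0 1%:M : 'M[R]_(n1 + n2, n2))
  v df.
rewrite (_ : (fun q => _) = fun q => f q *m col_mx 0 1%:M); last first.
  by apply/funext => q; rewrite rsubmx_mul.
by rewrite rsubmx_mul.
Qed.

Lemma smooth_lsubmx n1 n2 (U : set 'rV[R]_(n1 + n2)) :
  open U -> smooth_on U (fun w => lsubmx w).
Proof.
move=> oU; apply/smooth_rowE => // i j; rewrite ord1;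
  under eq_fun do rewrite mxE.
exact: smooth_coord.
Qed.

Lemma smooth_rsubmx n1 n2 (U : set 'rV[R]_(n1 + n2)) :
  open U -> smooth_on U (fun w => rsubmx w).
Proof.
move=> oU; apply/smooth_rowE => // i j; rewrite ord1;
  under eq_fun do rewrite mxE.
exact: smooth_coord.
Qed.

Lemma smooth_mx_comp d d' m n (U : set 'rV[R]_d) (U' : set 'rV[R]_d')
    (G : 'rV[R]_d -> 'rV[R]_d') (A : 'rV[R]_d' -> 'M[R]_(m, n)) :
  open U -> smooth_on U G -> smooth_mx U' A -> (forall p, U p -> U' (G p)) ->
  smooth_mx U (fun p => A (G p)).
Proof.
move=> oU sG sA UU' i j.
exact: (smooth_comp_scalar (f := fun q => A q i j) oU sG (sA i j)).
Qed.

Lemma mx11_tr (x : 'M[R]_1) : x^T = x.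
Proof. by apply/matrixP => i j; rewrite mxE !ord1. Qed.

Lemma pairing_mx D (u v : 'rV[R]_D) : u *m v^T = (pairing u v)%:M.
Proof. exact: mx11_scalar. Qed.

(** The canonical symplectic form of the cotangent bundle. *)
Lemma ext_d_tautological N (w X Y : 'rV[R]_((N + N) + (N + N))) :
  ext_d (@tautological R N) w X Y =
  pairing (rsubmx X) (lsubmx Y) - pairing (rsubmx Y) (lsubmx X).
Proof.
have E (Z W : 'rV[R]_((N + N) + (N + N))) :
    'D_Z (fun q => tautological q W) w = pairing (rsubmx Z) (lsubmx W).
  have did : differentiable (@idfun 'rV[R]_((N + N) + (N + N))) w by [].
  have [d1 D1] := derive_rsubmx (f := idfun) Z did.
  have [d2 D2] := derive_mulmxr (lsubmx W)^T Z d1.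
  rewrite -[LHS]/('D_Z (fun q : 'rV[R]_((N + N) + (N + N)) =>
    (rsubmx q *m (lsubmx W)^T) 0 0) w).
  rewrite -(@derive_entry _ _ _ (fun q : 'rV[R]_((N + N) + (N + N)) =>
    rsubmx q *m (lsubmx W)^T)); last first.
    exact: diff_derivable.
  by rewrite D2 D1 derive_id.
by rewrite /ext_d !E.
Qed.

End submatrices.

Section characteristic_kernel.
Variables (R : realType) (N k : nat).
Notation C := (Cspace R N).
Notation T := 'rV[R]_((N + N) + (N + N)).
Local Notation J := (Jmx R N).

(** With [X = (v, eta)], the first and third equations say that [X] is tangent
    to the characteristic bundle ([tangent_char_bundle]), and the two others
    say the same of i X, for the complex structure [cotangentJ]: on
    (i v, - i eta), the third equation is the fourth one. *)
Definition kernel_eqs (D : 'M[R]_(N + N, k)) (A : 'M[R]_(N + N)) (X : T) :=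
  [/\ lsubmx X *m D = 0, lsubmx X *m J *m D = 0,
   exists b : 'rV_k, rsubmx X = (lsubmx X *m A + b *m D^T) *m J &
   exists c : 'rV_k, rsubmx X = - (lsubmx X *m J *m A) + c *m D^T].

(** On the fibres i acts as [- Jmx]: the covector d^c f has components
    (- df/dy, df/dx), and i df/dz is half of df/dy + i df/dx, so that
    multiplying df/dz by i replaces d^c f by (df/dx, df/dy). *)
Definition cotangentJ (X : T) : T := row_mx (lsubmx X *m J) (- (rsubmx X *m J)).

(** The equations come in two pairs, exchanged by i. *)
Lemma kernel_eqs_cotangentJ D A X : kernel_eqs D A X -> kernel_eqs D A
  (cotangentJ X).
Proof.
move=> [vD vJD [b bE] [c cE]]; split;
  rewrite /cotangentJ ?row_mxKl ?row_mxKr //.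
- by rewrite mulmxJJ mulNmx vD oppr0.
- exists (- c); rewrite cE -mulNmx; congr (_ *m J).
  by rewrite opprD opprK mulNmx.
- exists b; rewrite bE !mulmxJJ mulNmx !opprK //.
Qed.

Lemma kernel_eqs_lin D A a X Y : kernel_eqs D A X -> kernel_eqs D A Y ->
  kernel_eqs D A (X + a *: Y).
Proof.
move=> [vD vJD [b bE] [c cE]] [vD' vJD' [b' bE'] [c' cE']].
have lE : lsubmx (X + a *: Y) = lsubmx X + a *: lsubmx Y.
  by rewrite linearD linearZ.
have rE : rsubmx (X + a *: Y) = rsubmx X + a *: rsubmx Y.
  by rewrite linearD linearZ.
split; rewrite ?lE ?rE ?mulmxDl -?scalemxAl.
- by rewrite vD vD' scaler0 addr0.
- by rewrite vJD vJD' scaler0 addr0.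
- exists (b + a *: b'); rewrite bE bE' !mulmxDl.
  by rewrite -?scalemxAl ?mulmxDl ?scalerDr -?scalemxAl addrACA.
- exists (c + a *: c'); rewrite cE cE' !mulmxDl scalerDr scalerN opprD.
  by rewrite -?scalemxAl addrACA.
Qed.

Variables (rho : 'I_k -> C -> R) (Om : set C) (S : set C) (B : set T).
Variable (L : C -> 'M[R]_(N + N, k)).
Hypotheses (oOm : open Om) (srho : forall j, smooth_on Om (rho j)).
Hypothesis S_level : forall q, Om q -> (S q <-> rowfun rho q = 0).
Local Notation D := (gradients rho).
Local Notation r := (rowfun rho).
Hypothesis B_conormal : forall q xi, Om q ->
  (B (row_mx q xi) <-> S q /\ exists a : 'rV_k, xi = a *m (D q)^T *m J).
Hypothesis sL : smooth_mx Om L.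
Hypothesis LK : forall q, Om q -> (D q)^T *m J *m L q = 1%:M.

(** [L q] inverts the map from coefficients to covectors over [q]: these are
    the coefficients of a covector [w] in terms of the d^c rho_j, extended to a
    smooth function of all covectors near the characteristic bundle. *)
Definition coeffs (w : T) : 'rV[R]_k := rsubmx w *m L (lsubmx w).

Let hess w := hessian rho (coeffs w) (lsubmx w).

Lemma gradients_free p (c : 'rV_k) : Om p -> c *m (D p)^T = 0 -> c = 0.
Proof.
move=> Op cD; rewrite -[c]mulmx1 -(LK Op) !mulmxA cD !mul0mx //.
Qed.

Lemma base_open : open [set w : T | setT w /\ Om (lsubmx w)].
Proof.
apply: smooth_preimage_open oOm _; first exact: openT.
exact/smooth_lsubmx/openT.
Qed.

Lemma smooth_coeffs : smooth_on [set w : T | setT w /\ Om (lsubmx w)] coeffs.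
Proof.
have oT := base_open.
apply/smooth_rowE => //; apply: smooth_mxM => //.
  by apply/smooth_rowE => //; exact: smooth_rsubmx.
apply: (smooth_mx_comp (G := fun w : T => lsubmx w) oT _ sL);
  last by move=> p [].
exact: smooth_lsubmx.
Qed.

Lemma char_bundle_coords w : Om (lsubmx w) -> B w ->
  S (lsubmx w) /\ rsubmx w = coeffs w *m (D (lsubmx w))^T *m J.
Proof.
move=> Ow; rewrite -{1}[w]hsubmxK => /(B_conormal _ Ow)[Sw [a aE]]; split=> //.
suff -> : coeffs w = a by [].
by rewrite /coeffs aE -[RHS]mulmx1 -(LK Ow) !mulmxA.
Qed.

(** Differentiate the two equations of the bundle along the curve: the base
    point stays on the level set, and the covector is the combination of the
    d^c rho_j with coefficients [coeffs]. *)
Lemma char_bundle_velocity (gam : R -> T) (X := 'D_1 gam 0) (w := gam 0) :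
  differentiable gam 0 -> (\forall t \near (0 : R), B (gam t)) ->
    Om (lsubmx w) ->
  lsubmx X *m D (lsubmx w) = 0 /\
  exists b : 'rV_k, rsubmx X = (lsubmx X *m hess w + b *m (D (lsubmx w))^T) *m
    J.
Proof.
move=> dg Bg Og.
have [dq Dq] := derive_lsubmx (1 : R) dg.
have [dxi Dxi] := derive_rsubmx (1 : R) dg.
have near_Om := curve_near_open oOm dq Og.
split.
  have dr : differentiable r (lsubmx (gam 0)).
    exact: smooth_on_differentiable (smooth_rowfun oOm srho) Og.
  rewrite -Dq -partials_rowfun -derive_partials_mx //.
  apply: (@derive_eq0_along _ _ _ r (fun t => lsubmx (gam t))) => //.
  apply: filterS (filterI Bg near_Om) => t [/char_bundle_coords Bt Ot].
  by apply/S_level => //; have [] := Bt Ot.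
have da : differentiable (fun t => coeffs (gam t)) 0.
  apply: (@differentiable_comp _ _ _ _ gam coeffs) => //.
  exact: (smooth_on_differentiable smooth_coeffs).
exists ('D_1 (fun t => coeffs (gam t)) 0).
have [dc DC] := derive_conormal srho (1 : R) da dq Og.
have [_ DJ] := derive_mulmxr J (1 : R) dc.
rewrite addrC -Dq -Dxi /hess -DC -DJ; apply: near_eq_derive.
apply: filterS (filterI Bg near_Om) => t [/char_bundle_coords Bt Ot].
by have [] := Bt Ot.
Qed.

(** Conversely, a curve with the given velocity moves the base point in the
    level set by [level_chart_exists], and the coefficients linearly. *)
Lemma tangent_char_bundle w X : Om (lsubmx w) -> B w -> tangent B w X <->
  lsubmx X *m D (lsubmx w) = 0 /\
  exists b : 'rV_k, rsubmx X = (lsubmx X *m hess w + b *m (D (lsubmx w))^T) *m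
    J.
Proof.
move=> Ow Bw; split.
  move=> /tangent_differentiable[gam [dg Bg g0 <-]].
  by have := @char_bundle_velocity gam dg Bg; rewrite g0; exact.
move=> [vD [b bE]].
have [Sw wE] := char_bundle_coords Ow Bw.
have [l [Q [G [iota [oQ Q0 sG G0 [GS DG /(_ _ vD)[u uE]]]]]]] :=
  level_chart_exists oOm srho S_level Ow Sw (fun c => gradients_free Ow).
set a0 := coeffs w.
pose U := [set x : 'rV[R]_(l + k) | setT x /\ Q (lsubmx x)].
have oU : open U.
  by apply: smooth_preimage_open oQ _; [exact: openT|exact/smooth_lsubmx/openT].
pose q (x : 'rV[R]_(l + k)) := G (lsubmx x).
pose a (x : 'rV[R]_(l + k)) := a0 + rsubmx x.
pose Phi x := row_mx (q x) (a x *m (D (q x))^T *m J).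
have sq : smooth_on U q.
  apply: (@smooth_comp _ _ _ _ _ Q (fun x => lsubmx x) G) => //.
    exact: smooth_lsubmx.
  by move=> x [].
have sa : smooth_on U a.
  apply/smooth_rowE => //; apply: smooth_mxD => //; first exact: smooth_mx_cst.
  by apply/smooth_rowE => //; exact: smooth_rsubmx.
have sDq : smooth_mx U (fun x => D (q x)).
  apply: (smooth_mx_comp (A := D) oU sq (smooth_gradients srho)).
  by move=> x [_ /GS[]].
have sPhi : smooth_on U Phi.
  apply/smooth_rowE => //; apply: smooth_row_mx; first exact/smooth_rowE.
  apply: smooth_mxM => //; last exact: smooth_mx_cst.
  apply: smooth_mxM => //; first exact/smooth_rowE.
  exact: smooth_mxT.
have U0 : U 0 by split=> //; rewrite linear0.
have PhiB x : U x -> B (Phi x).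
  move=> [_ /GS[Gx Sx]]; apply/(B_conormal _ Gx); split;
    [exact: Sx|by exists (a x)].
have Phi0 : Phi 0 = w.
  rewrite /Phi /q /a !linear0 addr0 G0 -wE hsubmxK //.
have dq := smooth_on_differentiable sq U0.
have da := smooth_on_differentiable sa U0.
have dPhi := smooth_on_differentiable sPhi U0.
have Oq : Om (q 0) by rewrite /q linear0; have [] := GS _ Q0.
set v := row_mx u b.
have Dqv : 'D_v q 0 = lsubmx X.
  have did : differentiable (@idfun 'rV[R]_(l + k)) 0 by [].
  have [d1 D1] := derive_lsubmx v did.
  rewrite (derive_chain (f := fun x : 'rV[R]_(l + k) => lsubmx x) (g := G)) //;
    last first.
    by rewrite linear0; exact: smooth_on_differentiable sG Q0.
  by rewrite D1 derive_id linear0 row_mxKl DG uE.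
have Dav : 'D_v a 0 = b.
  have did : differentiable (@idfun 'rV[R]_(l + k)) 0 by [].
  have [d1 D1] := derive_rsubmx v did.
  rewrite (@deriveD _ _ _ (cst a0)); [|exact: diff_derivable..].
  by rewrite derive_cst D1 derive_id row_mxKr add0r.
have [dc DC] := derive_conormal srho v da dq Oq.
have [_ DJ] := derive_mulmxr J v dc.
have -> : X = 'D_v Phi 0.
  rewrite -[X]hsubmxK -['D_v Phi 0]hsubmxK.
  have [_ <-] := derive_lsubmx v dPhi; have [_ <-] := derive_rsubmx v dPhi.
  congr row_mx.
    rewrite (_ : (fun x => lsubmx (Phi x)) = q) ?Dqv //.
    by apply/funext => x; rewrite /Phi row_mxKl.
  rewrite (_ : (fun x => rsubmx (Phi x)) = fun x => a x *m (D (q x))^T *m J);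
    last first.
    by apply/funext => x; rewrite /Phi row_mxKr.
  rewrite DJ DC Dqv Dav bE /q /a !linear0 addr0 G0.
  by rewrite addrC.
rewrite -Phi0; exact: smooth_image_tangent PhiB _ _ U0.
Qed.

(** Pairing [X] with the vertical vectors gives the second equation, and
    pairing it with the vectors [(v', v' A J)] for [v'] in the kernel of [D]
    gives the fourth one, because the covectors that vanish on that kernel are
    the combinations of the gradients.  The symmetry of the Hessian is what
    makes the fourth equation have the same shape as the third. *)
Lemma H_space_kernel_eqs w X : Om (lsubmx w) -> B w ->
  H_space B w X <-> kernel_eqs (D (lsubmx w)) (hess w) X.
Proof.
move=> Ow Bw; set A := hess w; set Dw := D _.
have [Sw wE] := char_bundle_coords Ow Bw.
have symA : A^T = A by exact: (hessian_sym oOm srho _ Ow).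
split.
  move=> [[/(tangent_char_bundle _ Ow Bw)[vD [b bE]] _] HX].
  have {}HX Y : lsubmx Y *m Dw = 0 ->
      (exists b : 'rV_k, rsubmx Y = (lsubmx Y *m A + b *m Dw^T) *m J) ->
      rsubmx X *m (lsubmx Y)^T = rsubmx Y *m (lsubmx X)^T.
    move=> YD Yb; have /HX : tangent B w Y by apply/tangent_char_bundle.
    rewrite ext_d_tautological => /eqP; rewrite subr_eq0 => /eqP E.
    by rewrite !pairing_mx E.
  have vJD : lsubmx X *m J *m Dw = 0.
    apply: trmx_inj; rewrite !trmx_mul trmx0 Jmx_tr mulNmx mulmxN.
    apply/eqP; rewrite oppr_eq0; apply/eqP/row_matrixP => i;
      rewrite row0 row_mul.
    have := HX (row_mx 0 (row i Dw^T *m J)).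
    rewrite row_mxKl row_mxKr trmx0 mulmx0 mul0mx mulmxA => <- //.
    exists (delta_mx 0 i); rewrite mul0mx add0r -rowE //.
  split=> //; first by exists b.
  have [c cE] : exists c, (rsubmx X)^T - A *m J *m (lsubmx X)^T = Dw *m c.
    apply: kernel_factor => v' v'D.
    have := HX (row_mx v' (v' *m A *m J)).
    rewrite row_mxKl row_mxKr => /(_ v'D) HX'.
    rewrite mulmxBr !mulmxA -HX'; last by exists 0; rewrite mul0mx addr0.
    by rewrite -[v' *m _]mx11_tr trmx_mul trmxK subrr.
  exists c^T; apply: trmx_inj; rewrite [in RHS]linearD /= linearN /= !trmx_mul
    trmxK.
  rewrite symA Jmx_tr trmxK -cE -mulmxA mulNmx mulmxN opprK.
  by rewrite addrC mulmxA subrK.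
move=> [vD vJD [b bE] [c cE]].
have DJv : Dw^T *m J *m (lsubmx X)^T = 0.
  apply: trmx_inj; rewrite !trmx_mul !trmxK Jmx_tr mulNmx mulmxN mulmxA.
  by rewrite vJD oppr0 trmx0.
split; first split.
- by apply/tangent_char_bundle => //; split=> //; exists b.
- rewrite /tautological /pairing wE -mulmxA -mulmxA.
  by rewrite [_^T *m _]mulmxA DJv mulmx0 mxE.
- move=> Y /(tangent_char_bundle _ Ow Bw)[v'D [b' bE']].
  rewrite ext_d_tautological; apply/eqP; rewrite subr_eq0; apply/eqP.
  suff E : rsubmx X *m (lsubmx Y)^T = rsubmx Y *m (lsubmx X)^T.
    by rewrite /pairing E.
  have Dv' : Dw^T *m (lsubmx Y)^T = 0 by rewrite -trmx_mul v'D trmx0.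
  rewrite cE bE' !mulmxDl -!(mulmxA c) Dv' mulmx0 addr0.
  rewrite -!(mulmxA b') -/Dw DJv mulmx0 addr0.
  rewrite -[RHS]mx11_tr !trmx_mul trmxK Jmx_tr symA.
  by rewrite !mulNmx mulmxN !mulmxA.
Qed.

End characteristic_kernel.


(** * Complex matrices in real coordinates *)

Section realification.
Local Open Scope complex_scope.
Variables (R : realType).
Local Notation C := R[i].
Local Notation Remx := (map_mx (@complex.Re R)).
Local Notation Immx := (map_mx (@complex.Im R)).

Lemma Remx_mul m n l (P : 'M[C]_(m, n)) (Q : 'M[C]_(n, l)) :
  Remx (P *m Q) = Remx P *m Remx Q - Immx P *m Immx Q.
Proof.
apply/matrixP => i j; rewrite !mxE raddf_sum -sumrB; apply: eq_bigr => h _.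
by rewrite !mxE; case: (P i h) (Q h j) => [a b] [c d].
Qed.

Lemma Immx_mul m n l (P : 'M[C]_(m, n)) (Q : 'M[C]_(n, l)) :
  Immx (P *m Q) = Remx P *m Immx Q + Immx P *m Remx Q.
Proof.
apply/matrixP => i j; rewrite !mxE raddf_sum -big_split; apply: eq_bigr => h _.
by rewrite !mxE; case: (P i h) (Q h j) => [a b] [c d].
Qed.

(** The real matrix of the complex linear map [w |-> w *m Q] in the coordinates
    [real_coords]. *)
Definition realmx m n (Q : 'M[C]_(m, n)) : 'M[R]_(m + m, n + n) :=
  block_mx (Remx Q) (Immx Q) (- Immx Q) (Remx Q).

Lemma real_coordsM m n (w : 'rV[C]_m) (Q : 'M[C]_(m, n)) :
  real_coords (w *m Q) = real_coords w *m realmx Q.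
Proof.
rewrite /real_coords /realmx mul_row_block Remx_mul Immx_mul.
by rewrite mulmxN.
Qed.

Lemma realmxM m n l (P : 'M[C]_(m, n)) (Q : 'M[C]_(n, l)) :
  realmx (P *m Q) = realmx P *m realmx Q.
Proof.
rewrite /realmx mulmx_block Remx_mul Immx_mul !mulNmx !mulmxN.
by rewrite opprD [in LHS](addrC (- (_ *m _))) [X in block_mx _ _ _ X]addrC.
Qed.

Lemma realmx1 n : realmx (1%:M : 'M[C]_n) = 1%:M.
Proof.
rewrite [RHS]scalar_mx_block; congr block_mx; apply/matrixP => i j;
  by rewrite !mxE; case: (i == j) => //=; rewrite oppr0.
Qed.

Lemma realmxJ m n (Q : 'M[C]_(m, n)) : realmx Q *m Jmx R n = Jmx R m *m realmx
  Q.
Proof.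
rewrite /realmx /Jmx !mulmx_block !mulmx0 !mul0mx !mulmx1 !mul1mx !mulmxN
  !mulNmx.
by rewrite !mulmx1 !mul1mx !add0r !addr0.
Qed.

Definition complex_coords n (v : Cspace R n) : 'rV[C]_n :=
  \row_a (v 0 (lshift n a) +i* v 0 (rshift n a)).

Lemma complex_coordsK n (v : Cspace R n) : real_coords (complex_coords v) = v.
Proof.
rewrite -[RHS]hsubmxK /real_coords; congr row_mx; apply/rowP => j;
  by rewrite !mxE.
Qed.

Lemma real_coords_sum n I r (P : pred I) (F : I -> 'rV[C]_n) :
  real_coords (\sum_(i <- r | P i) F i) = \sum_(i <- r | P i) real_coords (F i).
Proof.
apply: (big_morph (@real_coords R n)); last first.
  by apply/rowP => j; rewrite !mxE; case: splitP => h _; rewrite !mxE.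
move=> x y; rewrite /real_coords add_row_mx; congr row_mx;
  by apply/rowP => j; rewrite !mxE raddfD.
Qed.

Lemma real_coordsZ n (z : C) (u : 'rV[C]_n) : real_coords (z *: u) =
  complex.Re z *: real_coords u + complex.Im z *: (real_coords u *m Jmx R n).
Proof.
rewrite /Jmx /real_coords mul_row_block !mulmx0 !mulmx1 mulmxN mulmx1 add0r
  addr0.
rewrite !scale_row_mx add_row_mx; congr row_mx; apply/rowP => j; rewrite !mxE;
  case: z (u 0 j) => [a b] [c d] /=; rewrite ?mulrN //.
Qed.

End realification.

Section complex_bases.
Variables (F : fieldType).

(** Provides the coordinates in which the null space of the Levi form becomes a
    coordinate plane. *)
Lemma row_free_normal_form l N (K : 'M[F]_(l, N)) : row_free K ->
  exists2 A : 'M[F]_N, A \in unitmx &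
    (K :=: (pid_mx l : 'M[F]_(l, N)) *m invmx A)%MS.
Proof.
move=> freeK; exists (invmx (row_ebase K)).
  by rewrite unitmx_inv row_ebase_unit.
have KE : col_ebase K *m ((pid_mx l : 'M[F]_(l, N)) *m row_ebase K) = K.
  by rewrite mulmxA -[RHS]mulmx_ebase; congr (_ *m pid_mx _ *m _);
    apply/esym/eqP.
rewrite invmxK -{1}KE; apply: eqmxMfull.
by rewrite row_full_unit col_ebase_unit.
Qed.

Lemma rank_basis n N (K : 'M[F]_(n, N)) l : \rank K = l ->
  exists2 B : 'M[F]_(l, N), row_free B & (B :=: K)%MS.
Proof.
move=> <-; exists (row_base K); first exact: row_base_free.
exact: eq_row_base.
Qed.

End complex_bases.

(** * The null space of a Hermitian form *)

Section levi_kernel.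
Local Open Scope complex_scope.
Variables (R : realType) (N n : nat).
Local Notation C := R[i].
Local Notation J := (Jmx R N).
Variables (H : set (Cspace R N)) (Q : 'M[R]_(N + N)) (e : 'M[C]_(n, N)).
Hypotheses (symQ : Q^T = Q) (JQ : J *m Q = Q *m J).
Hypothesis HJ : forall v, H v -> H (v *m J).
Hypothesis eH : complex_basis H e.

(** The radical in [H] of the symmetric form [Q]. *)
Definition levi_null : set (Cspace R N) :=
  [set v | H v /\ forall v', H v' -> v *m Q *m v'^T = 0].

Definition quadratic (X : Cspace R N) : R := (X *m Q *m X^T) 0 0.

Lemma quadratic_polarization X Y :
  polarization quadratic X Y = (X *m Q *m Y^T) 0 0.
Proof.
have E : (Y *m Q *m X^T) 0 0 = (X *m Q *m Y^T) 0 0.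
  by rewrite -[Y *m Q *m X^T]mx11_tr !trmx_mul trmxK symQ mulmxA.
rewrite /polarization /quadratic linearD /= !mulmxDl !mulmxDr.
have D (A B : 'M[R]_1) : (A + B) 0 0 = A 0 0 + B 0 0 by rewrite mxE.
rewrite !D E; lra.
Qed.

Let h (v : Cspace R N) (b : 'I_n) : C :=
  (v *m Q *m (real_coords (row b e))^T) 0 0 +i*
  (v *m Q *m (real_coords (row b e) *m J)^T) 0 0.

Let G := \matrix_(a, b) Hermitian_form quadratic (real_coords (row a e))
                                           (real_coords (row b e)).

Let GE a b : G a b = h (real_coords (row a e)) b.
Proof. by rewrite mxE /Hermitian_form !quadratic_polarization JmulE. Qed.

Let h_lin (x y : R) (v : Cspace R N) b :
  h (x *: v + y *: (v *m J)) b = (x +i* y) * h v b.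
Proof.
have JT u : v *m J *m Q *m (u *m J)^T = v *m Q *m u^T.
  rewrite trmx_mul Jmx_tr mulNmx mulmxN -(mulmxA v) JQ !mulmxA.
  by rewrite mulmxJJ mulNmx opprK.
have JT' u : v *m J *m Q *m u^T = - (v *m Q *m (u *m J)^T).
  by rewrite trmx_mul Jmx_tr mulNmx mulmxN opprK -(mulmxA v) JQ !mulmxA.
rewrite /h !mulmxDl -!scalemxAl JT JT' !mxE.
set s := \sum_ _ _; set t := \sum_ _ _.
by apply/eqP; rewrite eq_complex /=; apply/andP; split; apply/eqP; ring.
Qed.

Let hD u v b : h (u + v) b = h u b + h v b.
Proof. by rewrite /h !mulmxDl !mxE. Qed.

Let h0 b : h 0 b = 0.
Proof. by rewrite /h !mul0mx !mxE. Qed.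

Let mulG (x : 'rV[C]_n) b : (x *m G) 0 b = h (real_coords (x *m e)) b.
Proof.
rewrite (mulmx_sum_row x e) real_coords_sum mxE.
rewrite (big_morph (fun v => h v b) (fun u v => hD u v b) (h0 b)).
apply: eq_bigr => a _; rewrite real_coordsZ h_lin GE.
by case: (x 0 a).
Qed.

(** The Hermitian form of [quadratic] has real part [Q], and its imaginary part
    is obtained by applying i to the second argument.  So [v = x *m e] is in
    the radical of [Q] if and only if it is in the radical of the Hermitian
    form, which means [x *m G = 0]. *)
Lemma levi_null_basis (m : nat) : \rank G = m ->
  exists2 K : 'M[C]_((n - m)%N, N), row_free K &
    forall v : 'rV[C]_N, (v <= K)%MS <-> levi_null (real_coords v).
Proof.
move=> rG; have [freee eP] := eH.
have [|K0 freeK0 K0G] := @rank_basis _ _ _ (kermx G) (n - m)%N.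
  by rewrite mxrank_ker rG.
have rb b : H (real_coords (row b e)) by apply/eP; exact: row_sub.
exists (K0 *m e).
  by rewrite /row_free mxrankMfree.
move=> v; split.
  move=> /submxP[y vE]; split.
    by apply/eP; rewrite vE mulmxA; exact: submxMl.
  set x := y *m K0.
  have xG : x *m G = 0 by apply/sub_kermxP; rewrite -K0G; exact: submxMl.
  have hv b : h (real_coords v) b = 0 by rewrite vE mulmxA -mulG xG mxE.
  have hRe b : (real_coords v *m Q *m (real_coords (row b e))^T) = 0.
    by apply/matrixP => i j; rewrite !ord1 [RHS]mxE; have [] := hv b.
  have hIm b : (real_coords v *m Q *m (real_coords (row b e) *m J)^T) = 0.
    by apply/matrixP => i j; rewrite !ord1 [RHS]mxE; have [] := hv b.
  move=> v'; rewrite -[v']complex_coordsK => /eP/submxP[x' ->].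
  rewrite (mulmx_sum_row x' e) real_coords_sum linear_sum /= mulmx_sumr big1 //
    => a _.
  rewrite real_coordsZ linearD /= !linearZ /= mulmxDr -!scalemxAr.
  by rewrite hRe hIm !scaler0 addr0.
move=> [/eP/submxP[x vE] vQ]; rewrite vE; apply: submxMr; rewrite K0G.
apply/sub_kermxP/rowP => b; rewrite mulG -vE [RHS]mxE /h.
by rewrite !vQ ?mxE //; exact: HJ.
Qed.

End levi_kernel.

(** * The Levi form *)

Section levi_form.
Variables (R : realType) (N k : nat).
Notation C := (Cspace R N).
Notation T := 'rV[R]_((N + N) + (N + N)).
Local Notation J := (Jmx R N).
Variables (rho : 'I_k -> C -> R) (Om : set C) (S : set C) (B : set T).
Variable (L : C -> 'M[R]_(N + N, k)).
Hypotheses (oOm : open Om) (srho : forall j, smooth_on Om (rho j)).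
Hypothesis S_level : forall q, Om q -> (S q <-> rowfun rho q = 0).
Local Notation D := (gradients rho).
Hypothesis B_conormal : forall q xi, Om q ->
  (B (row_mx q xi) <-> S q /\ exists a : 'rV_k, xi = a *m (D q)^T *m J).
Hypothesis sL : smooth_mx Om L.
Hypothesis LK : forall q, Om q -> (D q)^T *m J *m L q = 1%:M.

(** The J-invariant part of the Hessian [A], doubled: as [J] is antisymmetric,
    its quadratic form is [A (X, X) + A (J X, J X)]. *)
Definition levi_mx (A : 'M[R]_(N + N)) := A - J *m A *m J.

Lemma levi_mx_sym A : A^T = A -> (levi_mx A)^T = levi_mx A.
Proof.
move=> symA; rewrite /levi_mx linearB /= !trmx_mul Jmx_tr symA.
by rewrite mulNmx !mulmxN opprK mulmxA.
Qed.

Lemma levi_mxJ A : J *m levi_mx A = levi_mx A *m J.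
Proof.
rewrite /levi_mx mulmxBr mulmxBl !mulmxA Jmx_sqr !mulNmx mul1mx opprK.
by rewrite mulmxJJ opprK addrC.
Qed.

Lemma CR_tangentP p v : Om p -> S p ->
  CR_tangent S p v <-> v *m D p = 0 /\ v *m J *m D p = 0.
Proof.
move=> Op Sp; have free c := gradients_free LK (c := c) Op.
have tP u := tangent_level oOm srho S_level u Op Sp free.
rewrite /CR_tangent; split.
  move=> [/tP vD [u /tP uD uv]]; split=> //.
  by rewrite -uv JmulE mulmxJJ mulNmx uD oppr0.
move=> [vD vJD]; split; first exact/tP.
exists (- (v *m J)); first by apply/tP; rewrite mulNmx vJD oppr0.
by rewrite JmulE mulNmx mulmxJJ opprK.
Qed.

Variables (p xi : C).
Hypotheses (Op : Om p) (Bp : B (row_mx p xi)).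
Let Sp : S p. Proof. by have /(B_conormal _ Op)[] := Bp. Qed.
Let A := hessian rho (coeffs L (row_mx p xi)) p.
Let Q := levi_mx A.

(** A section along a curve of the level set is a curve of the characteristic
    bundle. *)
Lemma section_derive s X : section_extending S B p xi s -> X *m D p = 0 ->
  exists b : 'rV_k, 'D_X s p = (X *m A + b *m (D p)^T) *m J.
Proof.
move=> [U [oU Up ss sp HU]] XD.
have free c := gradients_free LK (c := c) Op.
have [gam [dg Sg g0 Dg]] := tangent_differentiable
  ((tangent_level oOm srho S_level X Op Sp free).2 XD).
have ds : differentiable s (gam 0) by rewrite g0;
  exact: smooth_on_differentiable ss Up.
have dsg : differentiable (s \o gam) 0 by exact: differentiable_comp.
have [d1 D1] := derive_mulmxr
  (row_mx 1%:M 0 : 'M[R]_(N + N, (N + N) + (N + N))) (1 : R) dg.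
have [d2 D2] := derive_mulmxr
  (row_mx 0 1%:M : 'M[R]_(N + N, (N + N) + (N + N))) (1 : R) dsg.
pose Gam (t : R) := gam t *m row_mx 1%:M 0 + (s \o gam) t *m row_mx 0 1%:M : T.
have GE t : Gam t = row_mx (gam t) (s (gam t)).
  by rewrite /Gam !mul_mx_row !mulmx0 !mulmx1 add_row_mx addr0 add0r.
have dG : differentiable Gam 0 by exact: differentiableD.
have DG : 'D_1 Gam 0 = row_mx X ('D_X s p).
  rewrite deriveD; [|exact: diff_derivable..].
  rewrite D1 D2 (derive_chain (f := gam) (g := s)) // Dg g0.
  by rewrite !mul_mx_row !mulmx0 !mulmx1 add_row_mx addr0 add0r.
have BG : \forall t \near (0 : R), B (Gam t).
  have gU : U (gam 0) by rewrite g0.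
  apply: filterS (filterI Sg (curve_near_open oU dg gU)) => t [St Ut].
  by rewrite GE; exact: HU.
have G0 : Gam 0 = row_mx p xi by rewrite GE g0 sp.
have OG : Om (lsubmx (Gam 0)) by rewrite G0 row_mxKl.
have [_ [b bE]] := char_bundle_velocity oOm srho S_level B_conormal sL LK dG BG
  OG.
exists b; move: bE; rewrite DG G0 !row_mxKl row_mxKr => ->.
by rewrite /A.
Qed.

(** The combinations of gradients in the derivatives of the section disappear,
    since [X] and [J X] are tangent to the level set. *)
Lemma Levi_form_quadratic s X : section_extending S B p xi s ->
  CR_tangent S p X -> Levi_form s p X = quadratic Q X.
Proof.
move=> Hs /(CR_tangentP _ Op Sp)[XD XJD].
have [b bE] := section_derive Hs XD.
have [b' bE'] := section_derive Hs XJD.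
have ds : differentiable s p.
  by have [U [oU Up ss sp HU]] := Hs; exact: smooth_on_differentiable ss Up.
have E Z W : 'D_Z (fun q => pairing (s q) W) p = ('D_Z s p *m W^T) 0 0.
  have [d1 D1] := derive_mulmxr W^T Z ds.
  by rewrite -D1 derive_entry //; exact: diff_derivable.
rewrite /Levi_form /ext_d !E JmulE bE bE'.
have DX : (D p)^T *m X^T = 0 by rewrite -trmx_mul XD trmx0.
have DJX : (D p)^T *m J *m X^T = 0.
  apply: trmx_inj; rewrite !trmx_mul !trmxK Jmx_tr mulNmx mulmxN mulmxA.
  by rewrite XJD oppr0 trmx0.
rewrite trmx_mul Jmx_tr !mulNmx mulmxN !mulmxA mulmxJJ mulNmx opprK.
rewrite !mulmxDl -!(mulmxA b) DX mulmx0 addr0.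
rewrite -!(mulmxA b') !mulmxA -[b' *m _ *m _]mulmxA -[b' *m _ *m _]mulmxA DJX
  mulmx0 addr0.
by rewrite /quadratic /Q /levi_mx mulmxBr mulmxBl !mulmxA !mxE.
Qed.

Lemma levi_null_rank n (m : nat) : Levi_rank n S B p xi m ->
  exists2 K : 'M[R[i]]_((n - m)%N, N), row_free K &
    forall v : 'rV[R[i]]_N, (v <= K)%MS <->
      levi_null (CR_tangent S p) Q (real_coords v).
Proof.
move=> [s [Hs [e [eH rG]]]].
have symA : A^T = A by exact: (hessian_sym oOm srho _ Op).
apply: (levi_null_basis (levi_mx_sym symA) (levi_mxJ A) _ eH).
  move=> v /(CR_tangentP _ Op Sp)[vD vJD]; apply/(CR_tangentP _ Op Sp).
  by split=> //; rewrite mulmxJJ mulNmx vD oppr0.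
rewrite -[RHS]rG; congr (\rank _); apply/matrixP => a b; rewrite !mxE.
have HC a' : CR_tangent S p (real_coords (row a' e)).
  by have [_ eP] := eH; apply/eP; exact: row_sub.
have polE X Y : CR_tangent S p X -> CR_tangent S p Y ->
    polarization (quadratic Q) X Y = polarization (Levi_form s p) X Y.
  move=> HX HY; rewrite /polarization !(Levi_form_quadratic Hs) //.
  apply/CR_tangentP => //.
  have [] := (CR_tangentP _ Op Sp).1 HX; have [] := (CR_tangentP _ Op Sp).1 HY.
  by rewrite !mulmxDl => -> -> -> ->; rewrite addr0.
rewrite /Hermitian_form !polE //.
have [vD vJD] := (CR_tangentP _ Op Sp).1 (HC b); apply/CR_tangentP => //.
by rewrite JmulE; split=> //; rewrite mulmxJJ mulNmx vD oppr0.
Qed.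

End levi_form.

(** * The radical over the null space of the Levi form *)

Section kernel_parametrization.
Variables (R : realType) (N k : nat).
Notation C := (Cspace R N).
Notation T := 'rV[R]_((N + N) + (N + N)).
Local Notation J := (Jmx R N).
Variables (D : 'M[R]_(N + N, k)) (A : 'M[R]_(N + N)).
Let H : set C := [set v | v *m D = 0 /\ v *m J *m D = 0].
Let Q := levi_mx A.
Hypothesis indep : forall b c : 'rV_k, b *m D^T *m J + c *m D^T = 0 ->
  b = 0 /\ c = 0.

(** Equating the two expressions of the fibre component, [v (A J + J A)] is a
    combination of the gradients and of their images by [J], so that it
    vanishes on the complex tangent space; and [A J + J A] is the Levi matrix
    times [J]. *)
Lemma kernel_eqs_null X : kernel_eqs D A X -> levi_null H Q (lsubmx X).
Proof.
move=> [vD vJD [b bE] [c cE]]; split=> // v' [v'D v'JD].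
have DJ u : u *m D = 0 -> D^T *m u^T = 0 by move=> uD;
  rewrite -trmx_mul uD trmx0.
have E : (lsubmx X *m A *m J + lsubmx X *m J *m A) *m (v' *m J)^T = 0.
  have -> : lsubmx X *m A *m J + lsubmx X *m J *m A = c *m D^T - b *m D^T *m J.
    have : (lsubmx X *m A + b *m D^T) *m J = - (lsubmx X *m J *m A) + c *m D^T.
      by rewrite -bE.
    rewrite mulmxDl => /(canRL (addrK _)) ->.
    by rewrite [LHS]addrC !addrA subrr add0r.
  rewrite mulmxBl -(mulmxA c) (DJ _ _ v'JD) mulmx0 sub0r.
  rewrite trmx_mul Jmx_tr mulNmx mulmxN opprK mulmxA mulmxJJ mulNmx.
  by rewrite -mulmxA (DJ _ _ v'D) mulmx0 oppr0.
move: E; rewrite trmx_mul Jmx_tr mulNmx mulmxN => /eqP; rewrite oppr_eq0.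
rewrite mulmxA => /eqP E; rewrite /Q /levi_mx mulmxBr.
rewrite mulmxDl mulmxJJ mulmxDl in E.
apply/eqP; rewrite -oppr_eq0; apply/eqP;
  rewrite -[RHS]E mulmxBl opprB addrC !mulNmx !mulmxA //.
Qed.

(** The radical contains no vertical vector: a combination of the d^c rho_j that
    is also a combination of the d rho_j is zero. *)
Lemma kernel_eqs_inj X : kernel_eqs D A X -> lsubmx X = 0 -> X = 0.
Proof.
move=> [_ _ [b bE] [c cE]] X0; rewrite -[X]hsubmxK X0 cE X0 !mul0mx oppr0 add0r.
have [|_ /eqP] := indep (b := b) (c := - c).
  by rewrite mulNmx; move: bE; rewrite cE X0 !mul0mx oppr0 !add0r => ->;
    rewrite subrr.
by rewrite oppr_eq0 => /eqP ->; rewrite mul0mx row_mx0.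
Qed.

(** Converse of [kernel_eqs_null], with a lift that is linear in the null
    vector. *)
Lemma kernel_lift l (K : 'M[R]_(l, N + N)) :
  (forall u : 'rV_l, levi_null H Q (u *m K)) ->
  exists eta, forall u : 'rV_l, kernel_eqs D A (u *m row_mx K eta).
Proof.
move=> HK.
have mx0 m (M : 'M[R]_(l, m)) : (forall u : 'rV_l, u *m M = 0) -> M = 0.
  by move=> M0; apply/row_matrixP => i; rewrite rowE M0 row0.
have KD : K *m D = 0 by apply: mx0 => u; rewrite mulmxA; have [[]] := HK u.
have KJD : K *m J *m D = 0.
  by apply: mx0 => u; rewrite !mulmxA; have [[]] := HK u.
have [Z ZE] : exists Z, (K *m A *m J + K *m J *m A)^T = row_mx D (J *m D) *m Z.
  apply: kernel_factor => v; rewrite mul_mx_row => vD.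
  have [vD0 vJD0] : v *m D = 0 /\ v *m J *m D = 0.
    move/eqP: vD; rewrite row_mx_eq0 mulmxA => /andP[/eqP ? /eqP ?]; by split.
  apply: trmx_inj; rewrite trmx_mul trmxK trmx0.
  apply: mx0 => u; have [_ /(_ (v *m J))] := HK u.
  have HvJ : H (v *m J) by split=> //; rewrite mulmxJJ mulNmx vD0 oppr0.
  have QJ : Q *m J = A *m J + J *m A by rewrite /Q /levi_mx mulmxBl mulmxJJ
    opprK.
  move=> /(_ HvJ)/eqP; rewrite trmx_mul Jmx_tr mulNmx mulmxN oppr_eq0.
  rewrite mulmxA -(mulmxA (u *m K)) QJ => /eqP E; rewrite -[RHS]E.
  by rewrite !mulmxA !mulmxDr !mulmxA.
pose c := (usubmx Z)^T; pose b := (dsubmx Z)^T.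
have E : K *m A *m J + K *m J *m A = c *m D^T - b *m D^T *m J.
  apply: trmx_inj; rewrite ZE -[Z]vsubmxK mul_row_col linearB /= !trmx_mul.
  by rewrite !trmxK Jmx_tr mulNmx opprK mulmxA.
have cD : c *m D^T = K *m A *m J + K *m J *m A + b *m D^T *m J
  by rewrite E subrK.
exists (- (K *m J *m A) + c *m D^T) => u.
rewrite mul_mx_row; split; rewrite ?row_mxKl ?row_mxKr.
- by rewrite -mulmxA KD mulmx0.
- by rewrite -!mulmxA (mulmxA K) KJD mulmx0.
- exists (u *m b); rewrite cD [_ + K *m J *m A]addrC -addrA addKr.
  by rewrite mulmxDr !mulmxA mulmxDl.
- by exists (u *m c); rewrite mulmxDr mulmxN !mulmxA.
Qed.

End kernel_parametrization.

(** * Equations of a submanifold *)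

Section submanifold_equation.
Variables (R : realType) (D d : nat) (V : set 'rV[R]_D) (w0 : 'rV[R]_D).

(** The coordinate plane as a kernel; [d] may exceed [D], in which case it is
    the whole space. *)
Lemma range_pid_mx (x : 'rV[R]_D) :
  range (fun u : 'rV[R]_d => u *m pid_mx d : 'rV[R]_D) x <->
  x *m copid_mx d = 0.
Proof.
split=> [[u _ <-]|].
  rewrite -mulmxA /copid_mx mulmxBr mulmx1 mul_pid_mx.
  suff -> : (pid_mx (minn D (minn d d)) : 'M[R]_(d, D)) = pid_mx d.
    by rewrite subrr mulmx0.
  rewrite minnn; apply/matrixP => i j; rewrite !mxE leq_min (ltn_ord i) andbT.
  have [E|//] := boolP (nat_of_ord i == nat_of_ord j).
  by rewrite (eqP E) ltn_ord.
rewrite /copid_mx mulmxBr mulmx1 => /eqP; rewrite subr_eq0 => /eqP xE.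
exists (x *m pid_mx d) => //; rewrite -mulmxA mul_pid_mx minnn.
suff -> : (pid_mx (minn d d) : 'M[R]_D) = pid_mx d by [].
by rewrite minnn.
Qed.

(** The equation is given by the last coordinates of a straightening map [f].
    Its values stay in the image of its differential at [w0], as [local_graph]
    requires, although that differential need not be surjective. *)
Lemma submanifold_equation : smooth_submanifold d V -> V w0 ->
  exists (U : set 'rV[R]_D) (phi : 'rV[R]_D -> 'rV[R]_D),
  [/\ open U /\ U w0, smooth_on U phi, forall w, U w -> (V w <-> phi w = 0),
      forall w, U w -> (phi w <= partials phi w0)%MS &
      forall v, tangent V w0 v <-> v *m partials phi w0 = 0].
Proof.
move=> /(_ w0) H /[dup] Vw0 /H[U [U' [f [g [Uw0 [[oU oU'] fU gf sf sg] fV]]]]].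
pose phi w := f w *m copid_mx d.
have df w : U w -> differentiable f w by exact: smooth_on_differentiable.
have sphi : smooth_on U phi.
  apply/smooth_rowE => //; apply: smooth_mxM => //; first exact/smooth_rowE.
  exact: smooth_mx_cst.
have VE w : U w -> V w <-> phi w = 0.
  move=> Uw; split=> [Vw|/range_pid_mx rw].
    have : (f @` (V `&` U)) (f w) by exists w.
    by rewrite fV => -[_ /range_pid_mx].
  have : (U' `&` range (fun u : 'rV[R]_d => u *m pid_mx d : 'rV[R]_D)) (f w).
    by split=> //; rewrite -fU; exists w.
  by rewrite -fV => -[w' [Vw' Uw']] /(congr1 g); rewrite !gf // => <-.
have dphi w : U w -> differentiable phi w by exact: smooth_on_differentiable.
have U'f : U' (f w0) by rewrite -fU; exists w0.
have dg : differentiable g (f w0) by exact: smooth_on_differentiable sg U'f.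
have gfv v : 'D_('D_v f w0) g (f w0) = v.
  rewrite -derive_chain //; last exact: df.
  rewrite -[RHS](derive_id w0); apply: near_eq_derive.
  exact: open_nearby gf.
have Dphi : partials phi w0 = partials f w0 *m copid_mx d.
  apply/row_matrixP => i; rewrite !rowE mulmxA -!derive_partials_mx;
    [|exact: df|exact: dphi].
  by have [_ ->] := derive_mulmxr (copid_mx d) (delta_mx 0 i) (df _ Uw0).
have unitf : partials f w0 \in unitmx.
  rewrite -row_free_unit -kermx_eq0; apply/eqP/row_matrixP => i.
  rewrite row0 -[LHS]gfv (derive_partials_mx _ (df _ Uw0)).
  by rewrite -row_mul mulmx_ker row0 deriveE // linear0.
exists U, phi; split=> // [w Uw|v].
  rewrite Dphi; apply: submxMr; apply: submx_full.
  by rewrite row_full_unit.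
split=> [/tangent_differentiable[gam [dga Vg g0 <-]]|].
  have Ug : U (gam 0) by rewrite g0.
  rewrite -derive_partials_mx; last exact: dphi.
  rewrite -g0; apply: derive_eq0_along => //; first exact: dphi.
  apply: filterS (filterI Vg (curve_near_open oU dga Ug)) => t [Vt Ut].
  exact/VE.
rewrite Dphi mulmxA -derive_partials_mx; last exact: df.
move=> /range_pid_mx[x _ xE].
have /range_pid_mx[u0 _ u0E] : phi w0 = 0 by exact/VE.
pose h (x : 'rV[R]_d) := g (f w0 + x *m pid_mx d).
have saff : smooth_on setT (fun x : 'rV[R]_d => f w0 + x *m pid_mx d).
  have oT := openT (T := 'rV[R]_d).
  apply/smooth_rowE => //; apply: smooth_mxD => //; first exact: smooth_mx_cst.
  by apply: smooth_mxM => //; [exact: smooth_id|exact: smooth_mx_cst].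
pose Q := [set x : 'rV[R]_d | setT x /\ U' (f w0 + x *m pid_mx d)].
have oQ : open Q by apply: smooth_preimage_open => //; exact: openT.
have sh : smooth_on Q h.
  apply: (smooth_comp (U' := U') (F := g) oQ oU' _ sg) => [|x' []//].
  exact: smooth_on_sub saff.
have Q0 : Q 0 by split=> //; rewrite mul0mx addr0.
have hV x' : Q x' -> V (h x').
  move=> [_ Ux'].
  have : (U' `&` range (fun u : 'rV[R]_d => u *m pid_mx d : 'rV[R]_D))
            (f w0 + x' *m pid_mx d).
    by split=> //; exists (u0 + x') => //; rewrite mulmxDl u0E.
  by rewrite -fV => -[w' [Vw' Uw']] E; rewrite /h -E gf.
have := smooth_image_tangent oQ sh hV x Q0.
have h0 : h 0 = w0 by rewrite /h mul0mx addr0 gf.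
rewrite h0; suff -> : 'D_x h 0 = v by [].
have did : differentiable (@idfun 'rV[R]_d) 0 by [].
have [d1 D1] := derive_mulmxr (pid_mx d : 'M[R]_(d, D)) x did.
have dc : differentiable (cst (f w0) : 'rV[R]_d -> 'rV[R]_D) 0.
  exact: differentiable_cst.
have d2 : differentiable (fun x : 'rV[R]_d => f w0 + x *m pid_mx d : 'rV[R]_D)
  0.
  exact: (@differentiableD _ _ _ (cst (f w0))).
rewrite /h (derive_chain (f := fun x : 'rV[R]_d => f w0 + x *m pid_mx d)) //;
  last first.
  by rewrite mul0mx addr0.
rewrite (@deriveD _ _ _ (cst (f w0))); [|exact: diff_derivable..].
by rewrite derive_cst add0r D1 derive_id mul0mx addr0 xE gfv.
Qed.

End submanifold_equation.

(** * The holomorphic parametrization of the regular submanifold *)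

Lemma pid_mx_conj (F : fieldType) l N (A : 'M[F]_N) : A \in unitmx ->
  (l <= N)%N -> (pid_mx l : 'M[F]_(l, N)) *m invmx A *m (A *m pid_mx l) = 1%:M.
Proof.
move=> uA lN; rewrite -mulmxA (mulmxA (invmx A)) mulVmx // mul1mx.
by rewrite mul_pid_mx minnn (minn_idPr lN) pid_mx_1.
Qed.

Section kernel_matrix.
Variables (R : realType) (N k l : nat).
Notation T := 'rV[R]_((N + N) + (N + N)).
Local Notation J := (Jmx R N).
Variable (P : 'M[R]_(N + N, l)).

(** The equations of the radical as a linear system in the base vector [v] and
    the two families [b] and [c] of coefficients in [kernel_eqs]; the last
    block is the component of [v] along the null space of the Levi form. *)
Definition kernel_mx (D : 'M[R]_(N + N, k)) (A : 'M[R]_(N + N)) :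
    'M[R]_((N + N) + (k + k), k + (k + ((N + N) + l))) :=
  col_mx (row_mx D (row_mx (J *m D) (row_mx (A *m J + J *m A) P)))
   (col_mx (row_mx 0 (row_mx 0 (row_mx (D^T *m J) 0)))
           (row_mx 0 (row_mx 0 (row_mx (- D^T) 0)))).

Lemma mul_kernel_mx D A (v : 'rV_(N + N)) (b c : 'rV_k) :
  row_mx v (row_mx b c) *m kernel_mx D A =
  row_mx (v *m D) (row_mx (v *m J *m D)
   (row_mx (v *m A *m J + v *m J *m A + b *m D^T *m J - c *m D^T) (v *m P))).
Proof.
rewrite /kernel_mx !mul_row_col !mul_mx_row !mulmx0 !add_row_mx !addr0.
by rewrite mulmxDr !mulmxA mulmxN addrA.
Qed.

(** Having full rank is an open condition on [D] and [A], so that this extends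
    to nearby points the fact that the radical meets the kernel of [P] at zero
    only. *)
Lemma kernel_mx_free_eq0 D A X : row_free (kernel_mx D A) ->
  kernel_eqs D A X -> lsubmx X *m P = 0 -> X = 0.
Proof.
move=> free [vD vJD [b bE] [c cE]] XP.
have [B MB] := row_freeP free.
have : row_mx (lsubmx X) (row_mx b c) *m kernel_mx D A = 0.
  rewrite mul_kernel_mx vD vJD XP.
  have -> : lsubmx X *m A *m J + lsubmx X *m J *m A + b *m D^T *m J - c *m D^T
    = 0.
    apply/eqP; rewrite subr_eq0 addrAC -mulmxDl -bE cE addrAC addNr add0r //.
  by rewrite !row_mx0.
move=> /(congr1 (mulmxr B)); rewrite /= -mulmxA MB mulmx1 mul0mx.
move=> /eqP; rewrite !row_mx_eq0 => /and3P[/eqP v0 /eqP b0 /eqP c0].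
by rewrite -[X]hsubmxK cE v0 c0 !mul0mx oppr0 addr0 row_mx0.
Qed.

Lemma kernel_mx_free D A :
  (forall b c : 'rV_k, b *m D^T *m J + c *m D^T = 0 -> b = 0 /\ c = 0) ->
  (forall X, kernel_eqs D A X -> lsubmx X *m P = 0 -> X = 0) ->
  row_free (kernel_mx D A).
Proof.
move=> indep HX; rewrite -kermx_eq0; apply/eqP/row_matrixP => i; rewrite row0.
have : row i (kermx (kernel_mx D A)) *m kernel_mx D A = 0.
  by rewrite -row_mul mulmx_ker row0.
set y := row i _; rewrite -[y]hsubmxK -[rsubmx y]hsubmxK.
set v := lsubmx y; set b := lsubmx _; set c := rsubmx _.
rewrite mul_kernel_mx => /eqP; rewrite !row_mx_eq0.
move=> /and4P[/eqP vD /eqP vJD /eqP E /eqP vP].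
have E' : (v *m A + b *m D^T) *m J = - (v *m J *m A) + c *m D^T.
  move/eqP: (E); rewrite subr_eq0 addrAC => /eqP <-.
  by rewrite mulmxDl [RHS]addrC addrK.
have v0 : v = 0.
  have := HX (row_mx v ((v *m A + b *m D^T) *m J)); rewrite row_mxKl => H.
  have /eqP : row_mx v ((v *m A + b *m D^T) *m J) = 0.
    apply: H => //; split; rewrite ?row_mxKl ?row_mxKr //; first by exists b.
    by exists c.
  by rewrite row_mx_eq0 => /andP[/eqP].
have [|b0 /eqP] := indep b (- c).
  rewrite mulNmx; move: E; rewrite v0 !mul0mx !add0r //.
by rewrite oppr_eq0 => /eqP c0; rewrite v0 b0 c0 !row_mx0.
Qed.

End kernel_matrix.

Section holomorphic_lift.
Variables (R : realType) (N k n m : nat).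
Notation C := (Cspace R N).
Notation T := 'rV[R]_((N + N) + (N + N)).
Local Notation J := (Jmx R N).
Local Notation l := (n - m)%N.
Variables (rho : 'I_k -> C -> R) (Om : set C) (S : set C) (B : set T).
Variable (L : C -> 'M[R]_(N + N, k)).
Hypotheses (oOm : open Om) (srho : forall j, smooth_on Om (rho j)).
Hypothesis S_level : forall q, Om q -> (S q <-> rowfun rho q = 0).
Local Notation D := (gradients rho).
Hypothesis B_conormal : forall q xi, Om q ->
  (B (row_mx q xi) <-> S q /\ exists a : 'rV_k, xi = a *m (D q)^T *m J).
Hypothesis sL : smooth_mx Om L.
Hypothesis LK : forall q, Om q -> (D q)^T *m J *m L q = 1%:M.
Variables (p xi : C).
Hypotheses (Op : Om p).
Hypothesis indep : forall b c : 'rV_k,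
  b *m (D p)^T *m J + c *m (D p)^T = 0 -> b = 0 /\ c = 0.
Hypothesis regular : regular_point B (row_mx p xi).
Hypothesis rank_m : Levi_rank n S B p xi m.

Let hess w := hessian rho (coeffs L w) (lsubmx w).

(** The coordinates [A0] are chosen so that the null space of the Levi form is
    the span of the first [n - m] of them, and [G] parametrizes the regular
    submanifold by these coordinates. *)
Theorem holomorphic_lift :
  exists (A0 : 'M[R[i]]_N) (Q : set (Cspace R l)) (G : Cspace R l -> T),
  [/\ A0 \in unitmx, (l <= N)%N,
     [/\ open Q, Q 0, smooth_on Q G & G 0 = row_mx p xi],
     forall u, Q u -> [/\ Om (lsubmx (G u)), B (G u) &
       (lsubmx (G u) - p) *m realmx (A0 *m pid_mx l) = u] &
     forall u v, Q u -> 'D_(Jmul v) G u = cotangentJ ('D_v G u)].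
Proof.
have [[Bw _] [W [V [d [[oW Ww] VW [smV Vw] VH VHw]]]]] := regular.
set w0 := row_mx p xi in Bw Ww Vw VHw.
have lw0 : lsubmx w0 = p by exact: row_mxKl.
have Ow0 : Om (lsubmx w0) by rewrite lw0.
have hess0 : hess w0 = hessian rho (coeffs L w0) p by rewrite /hess lw0.
have [Sp _] := (B_conormal xi Op).1 Bw.
have HE : CR_tangent S p = [set v | v *m D p = 0 /\ v *m J *m D p = 0].
  by apply/seteqP; split=> v /(CR_tangentP oOm srho S_level LK v Op Sp).
(* Linear algebra at xi0: the rows of [iota] span the radical. *)
have [K freeK KP] := levi_null_rank oOm srho S_level B_conormal sL LK Op Bw
  rank_m.
rewrite HE -/w0 -hess0 in KP.
have [A0 uA0 KA] := row_free_normal_form freeK.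
have lN : (l <= N)%N by have := rank_leq_col K; rewrite (eqP freeK).
set kap := realmx ((pid_mx l : 'M[R[i]]_(l, N)) *m invmx A0).
set P := realmx (A0 *m (pid_mx l : 'M[R[i]]_(N, l))).
have kapP : kap *m P = 1%:M.
  apply: (etrans (esym (realmxM (pid_mx l *m invmx A0) (A0 *m pid_mx l)))).
  rewrite (pid_mx_conj uA0 lN).
  exact: realmx1.
have null_kap v : levi_null [set v | v *m D p = 0 /\ v *m J *m D p = 0]
    (levi_mx (hess w0)) v <-> exists u, v = u *m kap.
  rewrite -[v]complex_coordsK; split=> [/KP|[u]].
    rewrite KA => /submxP[x ->]; exists (real_coords x).
    by rewrite real_coordsM.
  rewrite -[u]complex_coordsK -real_coordsM => ->.
  by apply/KP; rewrite KA; exact: submxMl.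
have [eta etaP] : exists eta, forall u, kernel_eqs (D p) (hess w0)
  (u *m row_mx kap eta).
  by apply: kernel_lift => u; apply/null_kap; exists u.
set iota := row_mx kap eta.
pose varpi : 'M[R]_((N + N) + (N + N), l + l) := col_mx P 0.
have varpiE (w : T) : w *m varpi = lsubmx w *m P.
  by rewrite -{1}[w]hsubmxK mul_row_col mulmx0 addr0.
have iotaK : iota *m varpi = 1%:M.
  by rewrite /iota mul_row_col mulmx0 addr0.
have kerE X : kernel_eqs (D p) (hess w0) X <-> (X <= iota)%MS.
  split=> [HX|/submxP[u ->]]; last exact: etaP.
  have [u uE] := (null_kap _).1 (kernel_eqs_null HX).
  have X0 : kernel_eqs (D p) (hess w0) (X + -1 *: (u *m iota)).
    by apply: kernel_eqs_lin.
  have /eqP : X + -1 *: (u *m iota) = 0.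
    apply: (kernel_eqs_inj indep X0); rewrite linearD linearZ /= uE.
    by rewrite /iota mul_mx_row row_mxKl scaleN1r subrr.
  by rewrite scaleN1r subr_eq0 => /eqP ->; exact: submxMl.
(* The regular submanifold as a graph over the radical at xi0. *)
have [U [phi [[oU Uw] sphi VE phi_im tanV]]] := submanifold_equation smV Vw.
have oBase := base_open oOm.
pose Om1 := U `&` [set w | setT w /\ Om (lsubmx w)].
have oOm1 : open Om1 by exact: openI.
have Om1w : Om1 w0 by exact: (conj Uw (conj I Ow0)).
have [|||||Q [G [oQ Q0 sG G0 GP]]] :=
    @local_graph _ _ _ _ Om1 phi w0 iota varpi oOm1 Om1w.
- by apply: smooth_on_sub sphi => w [].
- exact/VE.
- exact: iotaK.
- move=> v; rewrite -tanV -kerE VHw.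
  have := H_space_kernel_eqs oOm srho S_level B_conormal sL LK v Ow0 Bw.
  by rewrite lw0 -hess0.
- by move=> w [Uw' _]; exact: phi_im.
have GB u : Q u -> [/\ Om (lsubmx (G u)), B (G u) & V (G u)].
  move=> /GP[[UG [_ OG]] pG _]; have VG : V (G u) by exact/VE.
  have [_ [BG _]] := VW _ VG; split; [exact: OG|exact: BG|exact: VG].
(* Shrink the parameter domain until the radical stays transverse to the
   kernel of [P] along the graph. *)
pose M w := kernel_mx P (D (lsubmx w)) (hess w).
have freeM0 : row_free (M w0).
  apply: kernel_mx_free; first by rewrite lw0.
  rewrite lw0 => X /kerE/submxP[u ->].
  rewrite -varpiE -mulmxA iotaK mulmx1 => ->; exact: mul0mx.
have [BM MB] := row_freeP freeM0.
have slw : smooth_on [set w : T | setT w /\ Om (lsubmx w)] (fun w => lsubmx w).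
  exact: smooth_lsubmx.
have sD : smooth_mx [set w : T | setT w /\ Om (lsubmx w)]
  (fun w => D (lsubmx w)).
  by apply: (smooth_mx_comp (A := D) oBase slw (smooth_gradients srho)) => w [].
have sA : smooth_mx [set w : T | setT w /\ Om (lsubmx w)] hess.
  by apply: (smooth_hessian srho oBase (smooth_coeffs oOm sL) slw) => w [].
have sM : smooth_mx [set w : T | setT w /\ Om (lsubmx w)] M.
  have cst a b (Z : 'M[R]_(a, b)) := smooth_mx_cst oBase Z.
  have sDT := smooth_mxT sD.
  have sJ := cst _ _ J.
  have s1 := smooth_mxM oBase sJ sD.
  have s2 := smooth_mxD oBase (smooth_mxM oBase sA sJ) (smooth_mxM oBase sJ sA).
  have s3 := smooth_mxM oBase sDT sJ.
  have s4 := smooth_mxN oBase sDT.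
  exact: (smooth_col_mx
    (smooth_row_mx sD (smooth_row_mx s1 (smooth_row_mx s2 (cst _ _ P))))
    (smooth_col_mx
      (smooth_row_mx (cst _ _ 0)
        (smooth_row_mx (cst _ _ 0) (smooth_row_mx s3 (cst _ _ 0))))
      (smooth_row_mx (cst _ _ 0)
        (smooth_row_mx (cst _ _ 0) (smooth_row_mx s4 (cst _ _ 0)))))).
have sdet : smooth_on Q (fun u => \det (M (G u) *m BM)).
  have sMG : smooth_mx Q (fun u => M (G u)).
    by apply: (smooth_mx_comp (A := M) oQ sG sM) => u /GB[OG _ _];
      exact: (conj I OG).
  exact: (smooth_mx_det oQ (smooth_mxM oQ sMG (smooth_mx_cst oQ BM))).
pose Q' := [set u | Q u /\ \det (M (G u) *m BM) != 0].
have freeM u : Q' u -> row_free (M (G u)).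
  move=> [_]; rewrite -unitfE -unitmxE => uM.
  apply/row_freeP; exists (BM *m invmx (M (G u) *m BM)).
  by rewrite mulmxA mulmxV.
have oQ' : open Q' by exact: smooth_neq0_open oQ sdet.
have Q'0 : Q' 0.
  by split; [exact: Q0|rewrite G0 MB det1; exact: oner_neq0].
have sG' : smooth_on Q' G by apply: smooth_on_sub sG => u [].
exists A0, Q', G; split; [exact: uA0|exact: lN| | |].
- by split; [exact: oQ'|exact: Q'0|exact: sG'|exact: G0].
- move=> u [Qu _]; have [OG BG _] := GB _ Qu; split; [exact: OG|exact: BG|].
  have [_ _] := GP _ Qu.
  by rewrite varpiE linearB /= lw0.
move=> u v Q'u; have [Qu _] := Q'u; have [OG BG VG] := GB _ Qu.
have GV q : Q q -> V (G q) by move=> /GB[].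
have keq v' : kernel_eqs (D (lsubmx (G u))) (hess (G u)) ('D_v' G u).
  have /(VH _ VG) HX := smooth_image_tangent oQ sG GV v' Qu.
  exact: (H_space_kernel_eqs oOm srho S_level B_conormal sL LK _ OG BG).1 HX.
have GPw q : Q q -> (G q - w0) *m varpi = q by move=> /GP[].
have proj v' : lsubmx ('D_v' G u) *m P = v'.
  by rewrite -varpiE; exact: (graph_derive_proj oQ sG GPw v' Qu).
(* Both terms lie in the radical and have the same component i v, so that they
   are equal by transversality. *)
have K0 : kernel_eqs (D (lsubmx (G u))) (hess (G u))
    (cotangentJ ('D_v G u) + -1 *: 'D_(Jmul v) G u).
  exact: kernel_eqs_lin (kernel_eqs_cotangentJ (keq _)) (keq _).
have Y0 : lsubmx (cotangentJ ('D_v G u) + -1 *: 'D_(Jmul v) G u) *m P = 0.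
  rewrite linearD linearZ /= row_mxKl mulmxDl -scalemxAl proj.
  by rewrite -mulmxA -realmxJ mulmxA proj JmulE scaleN1r subrr.
move: (kernel_mx_free_eq0 (freeM _ Q'u) K0 Y0); rewrite scaleN1r.
by move=> /eqP; rewrite subr_eq0 => /eqP.
Qed.

End holomorphic_lift.


(** * Local equations of the manifold and of its characteristic bundle *)

Section wedge.
Local Open Scope complex_scope.
Variables (R : realType) (N k : nat).
Notation C := (Cspace R N).
Local Notation J := (Jmx R N).
Variables (rho : 'I_k -> C -> R) (p : C).

(** The relation [b D^T J + c D^T = 0] between the real gradients is the
    relation with complex coefficients [c - i b] between the d' rho_j. *)
Lemma wedge_independent : wedge_nonzero rho p ->
  forall b c : 'rV[R]_k,
    b *m (gradients rho p)^T *m J + c *m (gradients rho p)^T = 0 ->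
    b = 0 /\ c = 0.
Proof.
move=> [f fdet] b c E.
pose D := gradients rho p.
have DE j i : D i j = 'D_(delta_mx 0 i) (rho j) p by rewrite mxE.
pose Z := \matrix_(j < k, l < k) dz (rho j) p (f l).
pose z : 'rV[R[i]]_k := \row_j (c 0 j +i* - b 0 j).
have trE j i : (gradients rho p)^T j i = D i j by rewrite mxE.
have ExE (a : 'I_N) : \sum_j c 0 j * D (lshift N a) j =
    \sum_j b 0 j * D (rshift N a) j.
  have := congr1 (fun v : C => v 0 (lshift N a)) E.
  rewrite -JmulE /Jmul mxE row_mxEl !mxE.
  under eq_bigr do rewrite trE; under [X in _ + X]eq_bigr do rewrite trE.
  by move=> /eqP; rewrite addrC subr_eq0 => /eqP.
have EyE (a : 'I_N) : \sum_j b 0 j * D (lshift N a) j +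
    \sum_j c 0 j * D (rshift N a) j = 0.
  have := congr1 (fun v : C => v 0 (rshift N a)) E.
  rewrite -JmulE /Jmul mxE row_mxEr !mxE.
  by under eq_bigr do rewrite trE; under [X in _ + X]eq_bigr do rewrite trE.
have zZ : z *m Z = 0.
  apply/rowP => l; rewrite !mxE.
  under eq_bigr do rewrite !mxE /dz /partial_x /partial_y -!DE.
  apply/eqP; rewrite eq_complex !raddf_sum /=; apply/andP; split; apply/eqP.
    rewrite (eq_bigr (fun j => 2^-1 * (c 0 j * D (lshift N (f l)) j)
      - 2^-1 * (b 0 j * D (rshift N (f l)) j))); last by move=> j _; ring.
    by rewrite sumrB -!mulr_sumr ExE subrr.
  rewrite (eq_bigr (fun j => - (2^-1 * (b 0 j * D (lshift N (f l)) j)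
      + 2^-1 * (c 0 j * D (rshift N (f l)) j)))); last by move=> j _; ring.
  by rewrite sumrN big_split /= -!mulr_sumr -mulrDr EyE mulr0 oppr0.
have uZ : Z \in unitmx by rewrite unitmxE unitfE.
have z0 : z = 0 by rewrite -[z](mulmxK uZ) zZ mul0mx.
split; apply/rowP => j; have := congr1 (fun v : 'rV_k => v 0 j) z0;
  rewrite !mxE => /eqP; rewrite eq_complex /= => /andP[/eqP cj].
  by rewrite oppr_eq0 => /eqP.
by [].
Qed.

End wedge.

Section charts.
Variables (R : realType) (N : nat) (X : complex_manifold R N).
Notation C := (Cspace R N).

Lemma open_chart_image (c : chart R X N) (A : set X) : open A ->
  open (cmap c @` (A `&` cdom c)).
Proof.
move=> oA.
have -> : cmap c @` (A `&` cdom c) = cimg c `&` cinv c @^-1` A.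
  apply/seteqP; split=> [_ [x [Ax cx] <-]|q [[x cx <-]]].
    by split; [exists x|rewrite /= cmapK].
  by rewrite /= cmapK // => Ax; exists x.
have oC : open (cimg c) by exact: cimg_open.
have cc : {within cimg c, continuous (cinv c)} by exact: cinv_continuous.
rewrite openE => q [Cq Aq].
have cq : {for q, continuous (cinv c)}.
  by move: cc; rewrite (continuous_open_subspace _ oC) => /(_ q (mem_set Cq)).
apply: filterI; first exact: open_nbhs_nbhs (conj oC Cq).
exact: cq (open_nbhs_nbhs (conj oA Aq)).
Qed.

Lemma open_chart_preimage (c : chart R X N) (O : set C) : open O ->
  open (cdom c `&` cmap c @^-1` O).
Proof.
move=> oO; have oC : open (cdom c) by exact: cdom_open.
have cc : {within cdom c, continuous (cmap c)} by exact: cmap_continuous.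
rewrite openE => q [Cq Aq].
have cq : {for q, continuous (cmap c)}.
  by move: cc; rewrite (continuous_open_subspace _ oC) => /(_ q (mem_set Cq)).
apply: filterI; first exact: open_nbhs_nbhs (conj oC Cq).
exact: cq (open_nbhs_nbhs (conj oO Aq)).
Qed.

End charts.

Section local_equations.
Variables (R : realType) (N k : nat) (X : complex_manifold R N) (M : set X).
Notation C := (Cspace R N).
Local Notation J := (Jmx R N).
Variable (c : chart R X N).
Hypothesis c_atlas : cm_atlas c.

Definition local_rho (r : 'I_k -> X -> R) (j : 'I_k) : C -> R := r j \o cinv c.

Definition independent (rho : 'I_k -> C -> R) (q : C) :=
  forall a b : 'rV[R]_k,
    a *m (gradients rho q)^T *m J + b *m (gradients rho q)^T = 0 ->
    a = 0 /\ b = 0.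

Lemma independent_free rho q (b : 'rV_k) : independent rho q ->
  b *m (gradients rho q)^T = 0 -> b = 0.
Proof.
move=> ind bD; have [|_ //] := ind 0 b.
by rewrite !mul0mx add0r.
Qed.

Lemma defining_level U r : defining_functions M U r ->
  [/\ open (cmap c @` (U `&` cdom c)),
      forall j, smooth_on (cmap c @` (U `&` cdom c)) (local_rho r j),
      forall q, (cmap c @` (U `&` cdom c)) q ->
        (in_chart c M q <-> rowfun (local_rho r) q = 0) &
      forall q, (cmap c @` (U `&` cdom c)) q -> in_chart c M q ->
        independent (local_rho r) q].
Proof.
move=> [oU sr MU wr]; split.
- exact: open_chart_image.
- by move=> j; exact: (sr j c c_atlas).
- move=> _ [x [Ux cx] <-]; split.
    move=> [x' [Mx' cx'] xx'].
    have xE : x' = x by rewrite -(cmapK cx') xx' cmapK.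
    have : (M `&` U) x by split=> //; rewrite -xE.
    rewrite MU => -[_ rx]; apply/rowP => j.
    by rewrite !mxE /local_rho /= cmapK.
  move=> r0; exists x => //; split=> //.
  have : (U `&` [set x | forall j, r j x = 0]) x.
    split=> // j; have := congr1 (fun v : 'rV_k => v 0 j) r0.
    by rewrite !mxE /local_rho /= cmapK.
  by rewrite -MU => -[].
- move=> _ [x [Ux cx] <-] [x' [Mx' cx'] xx'] a b.
  have xE : x' = x by rewrite -(cmapK cx') xx' cmapK.
  apply: wedge_independent; apply: wr => //.
  by split=> //; rewrite -xE.
Qed.

Lemma dc_gradients (rho : 'I_k -> C -> R) (a : 'I_k -> R) q :
  \sum_j a j *: dc (rho j) q = (\row_j a j) *m (gradients rho q)^T *m J.
Proof.
rewrite [X in X *m J]mulmx_sum_row mulmx_suml; apply: eq_bigr => j _.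
rewrite dcE mxE -scalemxAl; congr (_ *: (_ *m J)).
by apply/rowP => i; rewrite !mxE.
Qed.

(** The choice of the defining functions does not matter, since the span of
    their gradients is the annihilator of the tangent space. *)
Lemma char_bundleE U r q xi : defining_functions M U r ->
  (cmap c @` (U `&` cdom c)) q ->
  char_bundle k c M (row_mx q xi) <->
  in_chart c M q /\
  exists a : 'rV_k, xi = a *m (gradients (local_rho r) q)^T *m J.
Proof.
move=> def Uq; have [oU sr S_level ind] := defining_level def.
split; last first.
  move=> [[x [Mx cx] xq] [a ->]].
  have Ux : U x by have [x' [Ux' cx'] x'q] := Uq;
    rewrite -(cmapK cx) xq -x'q cmapK.
  exists x, U, r, (fun j => a 0 j); split=> //.
  rewrite xq (dc_gradients (local_rho r)); congr (row_mx _ (_ *m _ *m _)).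
  by apply/rowP => j; rewrite mxE.
move=> [x [U' [r' [a' [Mx cx U'x def' /eq_row_mx[qx xiE]]]]]].
have Sq : in_chart c M q by exists x.
split=> //.
have U'q : (cmap c @` (U' `&` cdom c)) q by rewrite qx; exists x.
have [oU' sr' S_level' _] := defining_level def'.
have [Z ZE] : exists Z, gradients (local_rho r') q = gradients
  (local_rho r) q *m Z.
  apply: kernel_factor => v vD.
  apply: (tangent_level_sub oU' sr' S_level' U'q).
  apply/(tangent_level oU sr S_level v Uq Sq) => // b.
  by apply: independent_free; exact: ind.
exists ((\row_j a' j) *m Z^T).
rewrite xiE -qx (dc_gradients (local_rho r')) ZE trmx_mul.
by rewrite !mulmxA.
Qed.

Hypothesis M_generic : generic_CR k M.

(** The neighborhood [Om] is chosen so that the d^c rho_j keep a left inverse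
    [L] that depends smoothly on the point. *)
Lemma local_equations x0 : M x0 -> cdom c x0 ->
  exists (U : set X) (r : 'I_k -> X -> R) (Om : set C)
    (L : C -> 'M[R]_(N + N, k)),
  [/\ defining_functions M U r,
    [/\ open Om, Om (cmap c x0) & Om `<=` cmap c @` (U `&` cdom c)],
    forall j, smooth_on Om (local_rho r j),
    [/\ forall q, Om q -> (in_chart c M q <-> rowfun (local_rho r) q = 0),
        forall q xi, Om q -> (char_bundle k c M (row_mx q xi) <->
          in_chart c M q /\
          exists a : 'rV_k, xi = a *m (gradients (local_rho r) q)^T *m J),
        smooth_mx Om L &
        forall q, Om q -> (gradients (local_rho r) q)^T *m J *m L q = 1%:M] &
    independent (local_rho r) (cmap c x0)].
Proof.
move=> Mx0 cx0; have [U [r [Ux0 def]]] := M_generic Mx0.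
have [oU sr S_level ind] := defining_level def.
set p := cmap c x0; set Om0 := cmap c @` (U `&` cdom c) in oU sr S_level ind.
have Op : Om0 p by exists x0.
have Sp : in_chart c M p by exists x0.
have indp := ind _ Op Sp.
set D := gradients (local_rho r).
have : row_free ((D p)^T *m J).
  rewrite -kermx_eq0; apply/eqP/row_matrixP => i; rewrite row0.
  have [|//] := indp (row i (kermx ((D p)^T *m J))) 0.
  by rewrite mul0mx addr0 -mulmxA -row_mul mulmx_ker row0.
move=> /row_freeP[Z ZE].
have sD : smooth_mx Om0 (fun q => (D q)^T *m J *m Z).
  apply: (smooth_mxM oU _ (smooth_mx_cst oU Z)).
  apply: (smooth_mxM oU _ (smooth_mx_cst oU J)).
  exact: (smooth_mxT (smooth_gradients sr)).
pose Om := [set q | Om0 q /\ \det ((D q)^T *m J *m Z) != 0].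
have oOm : open Om by exact: (smooth_neq0_open oU (smooth_mx_det oU sD)).
have OmOm0 : Om `<=` Om0 by move=> q [].
exists U, r, Om, (fun q => Z *m invmx ((D q)^T *m J *m Z)); split.
- exact: def.
- split; [exact: oOm| |exact: OmOm0].
  by split; [exact: Op|rewrite ZE det1; exact: oner_neq0].
- by move=> j; exact: smooth_on_sub (sr j).
- split.
  + by move=> q /OmOm0; exact: S_level.
  + by move=> q xi /OmOm0; exact: char_bundleE.
  + apply: (smooth_mxM oOm (smooth_mx_cst oOm Z)).
    apply: (smooth_invmx oOm) => [i j|q [_]].
      exact: (smooth_on_sub OmOm0 (sD i j)).
    by rewrite unitmxE unitfE.
  + move=> q [_ dq]; rewrite mulmxA mulmxV //.
    by rewrite unitmxE unitfE.
- exact: indp.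
Qed.

End local_equations.

(** * Holomorphic maps and changes of chart *)

Section holomorphic_maps.
Variables (R : realType).

Lemma holomorphic_onP a b (U : set (Cspace R a))
    (f : Cspace R a -> Cspace R b) :
  holomorphic_on U f <-> smooth_on U f /\
    forall p v, U p -> 'D_(v *m Jmx R a) f p = 'D_v f p *m Jmx R b.
Proof.
split=> -[sf Jf]; split=> // p v Up; have df := smooth_on_differentiable sf Up;
  have := Jf p v Up; rewrite !JmulE !deriveE //.
Qed.

Lemma holomorphic_comp a b c (U : set (Cspace R a)) (U' : set (Cspace R b))
    (f : Cspace R a -> Cspace R b) (g : Cspace R b -> Cspace R c) :
  open U -> open U' -> holomorphic_on U f -> holomorphic_on U' g ->
  (forall p, U p -> U' (f p)) -> holomorphic_on U (g \o f).
Proof.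
move=> oU oU' /holomorphic_onP[sf Jf] /holomorphic_onP[sg Jg] UU'.
apply/holomorphic_onP; split; first exact: (smooth_comp oU oU' sf sg UU').
move=> p v Up; have df := smooth_on_differentiable sf Up.
have dg := smooth_on_differentiable sg (UU' _ Up).
by rewrite !(derive_chain _ df dg) Jf // Jg //; exact: UU'.
Qed.

Lemma holomorphic_sub a b (U U' : set (Cspace R a))
  (f : Cspace R a -> Cspace R b) :
  U `<=` U' -> holomorphic_on U' f -> holomorphic_on U f.
Proof.
move=> UU' [sf Jf]; split; first exact: smooth_on_sub sf.
by move=> p v /UU'; exact: Jf.
Qed.

Lemma holomorphic_ext a b (U : set (Cspace R a))
  (f g : Cspace R a -> Cspace R b) :
  open U -> (forall p, U p -> f p = g p) -> holomorphic_on U f ->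
  holomorphic_on U g.
Proof.
move=> oU fg /holomorphic_onP[sf Jf]; apply/holomorphic_onP.
split; first exact: smooth_on_ext fg sf.
move=> p v Up; have E w : 'D_w g p = 'D_w f p.
  by apply/esym; apply: near_eq_derive; exact: open_nearby fg.
by rewrite !E Jf.
Qed.

Lemma holomorphic_mulmxr a b c (U : set (Cspace R a))
  (f : Cspace R a -> Cspace R b)
    (A : 'M[R]_(b + b, c + c)) :
  open U -> holomorphic_on U f -> A *m Jmx R c = Jmx R b *m A ->
  holomorphic_on U (fun p => f p *m A).
Proof.
move=> oU /holomorphic_onP[sf Jf] AJ; apply/holomorphic_onP; split.
  apply/smooth_rowE => //; apply: (smooth_mxM oU _ (smooth_mx_cst oU A)).
  exact/smooth_rowE.
move=> p v Up; have df := smooth_on_differentiable sf Up.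
have [_ ->] := derive_mulmxr A (v *m Jmx R a) df.
have [_ ->] := derive_mulmxr A v df.
by rewrite Jf // -!mulmxA AJ.
Qed.

Lemma holomorphicD a b (U : set (Cspace R a)) (f g : Cspace R a -> Cspace R b) :
  open U -> holomorphic_on U f -> holomorphic_on U g ->
  holomorphic_on U (fun p => f p + g p).
Proof.
move=> oU /holomorphic_onP[sf Jf] /holomorphic_onP[sg Jg];
  apply/holomorphic_onP; split.
  by apply/smooth_rowE => //; apply: smooth_mxD => //; exact/smooth_rowE.
move=> p v Up; have df := smooth_on_differentiable sf Up.
have dg := smooth_on_differentiable sg Up.
have E w : 'D_w (fun p => f p + g p) p = 'D_w f p + 'D_w g p.
  by apply: deriveD; exact: diff_derivable.
by rewrite !E Jf // Jg // mulmxDl.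
Qed.

Lemma holomorphicN a b (U : set (Cspace R a)) (f : Cspace R a -> Cspace R b) :
  open U -> holomorphic_on U f -> holomorphic_on U (fun p => - f p).
Proof.
move=> oU hf; apply: (holomorphic_ext (f := fun p => f p *m - 1%:M) oU).
  by move=> p _; rewrite mulmxN mulmx1.
apply: holomorphic_mulmxr => //.
by rewrite mulmxN mulNmx mulmx1 mul1mx.
Qed.

Lemma holomorphic_cst a b (U : set (Cspace R a)) (v : Cspace R b) :
  open U -> holomorphic_on U (fun=> v).
Proof.
move=> oU; apply/holomorphic_onP; split.
  by apply/smooth_rowE => //; exact: smooth_mx_cst.
by move=> p w _; rewrite !derive_cst mul0mx.
Qed.

Lemma holomorphic_id a (U : set (Cspace R a)) : open U -> holomorphic_on U id.
Proof.
move=> oU; apply/holomorphic_onP; split.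
  by apply/smooth_rowE => //; exact: smooth_id.
by move=> p w _; rewrite !derive_id.
Qed.

Lemma CinclE d N (u : Cspace R d) :
  Cincl N u = u *m realmx (pid_mx d : 'M[R[i]]_(d, N)).
Proof.
rewrite -{2}[u]hsubmxK /Cincl /realmx mul_row_block.
have -> : map_mx (@complex.Re R) (pid_mx d : 'M[R[i]]_(d, N)) = pid_mx d.
  by apply/matrixP => i j; rewrite !mxE; case: (_ && _).
have -> : map_mx (@complex.Im R) (pid_mx d : 'M[R[i]]_(d, N)) = 0.
  by apply/matrixP => i j; rewrite !mxE; case: (_ && _).
by rewrite oppr0 !mulmx0 addr0 add0r.
Qed.

End holomorphic_maps.

Section chart_change.
Variables (R : realType) (N : nat) (X : complex_manifold R N).
Notation C := (Cspace R N).
Variables (c : chart R X N) (O : set C) (Psi Psi' : C -> C).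
Hypotheses (c_atlas : cm_atlas c) (oO : open O) (Ocimg : O `<=` cimg c).
Hypotheses (oPO : open (Psi @` O)) (PsiK : forall p, O p -> Psi' (Psi p) = p).
Hypotheses (hPsi : holomorphic_on O Psi)
  (hPsi' : holomorphic_on (Psi @` O) Psi').

Let dom : set X := cdom c `&` cmap c @^-1` O.

Let dom_open : open dom. Proof. exact: open_chart_preimage. Qed.

Let img : (Psi \o cmap c) @` dom = Psi @` O.
Proof.
apply/seteqP; split=> [_ [x [cx Ox] <-]|_ [p Op <-]]; first
  by exists (cmap c x).
by have [x cx xp] := Ocimg Op; exists x; rewrite /dom /= ?xp.
Qed.

Let img_open : open ((Psi \o cmap c) @` dom). Proof. by rewrite img. Qed.

Let mapK x : dom x -> (cinv c \o Psi') ((Psi \o cmap c) x) = x.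
Proof. by move=> [cx Ox]; rewrite /= PsiK // cmapK. Qed.

Let continuous_Psi p : O p -> {for p, continuous Psi}.
Proof.
move=> Op; apply: differentiable_continuous.
exact: smooth_on_differentiable hPsi.1 Op.
Qed.

Let map_continuous : {within dom, continuous (Psi \o cmap c)}.
Proof.
rewrite (continuous_open_subspace _ dom_open) => x /set_mem[cx Ox].
have cc : {within cdom c, continuous (cmap c)} by exact: cmap_continuous.
have oC : open (cdom c) by exact: cdom_open.
apply: continuous_comp; last exact: continuous_Psi.
by move: cc; rewrite (continuous_open_subspace _ oC) => /(_ x (mem_set cx)).
Qed.

Let inv_continuous :
  {within (Psi \o cmap c) @` dom, continuous (cinv c \o Psi')}.
Proof.
rewrite (continuous_open_subspace _ img_open) img => _ /set_mem[p Op <-].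
have cc : {within cimg c, continuous (cinv c)} by exact: cinv_continuous.
have oC : open (cimg c) by exact: cimg_open.
apply: continuous_comp.
  apply: differentiable_continuous.
  by apply: (smooth_on_differentiable hPsi'.1); exists p.
rewrite PsiK //.
by move: cc; rewrite (continuous_open_subspace _ oC) =>
  /(_ p (mem_set (Ocimg Op))).
Qed.

Definition changed_chart : chart R X N :=
  Chart dom_open img_open mapK map_continuous inv_continuous.

(** The new transition maps are composites of the old ones with [Psi] and
    [Psi'], and the atlas is maximal. *)
Lemma changed_chart_atlas : cm_atlas changed_chart.
Proof.
apply: cm_maximal => c' c'_atlas.
have [h1 h2] := cm_compatible c_atlas c'_atlas.
have oD : open (cmap c @` (cdom c `&` cdom c')).
  by rewrite setIC; apply: open_chart_image; exact: cdom_open.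
have oD' : open (cmap c' @` (cdom c `&` cdom c')).
  by apply: open_chart_image; exact: cdom_open.
have imE : (Psi \o cmap c) @` (dom `&` cdom c') =
    [set y | (Psi @` O) y /\ (cmap c @` (cdom c `&` cdom c')) (Psi' y)].
  apply/seteqP; split=> [_ [x [[cx Ox] c'x] <-]|_ [[p Op <-]] /=].
    split; first by exists (cmap c x).
    by rewrite /= PsiK //; exists x.
  rewrite PsiK // => -[x [cx c'x] xp]; exists x; rewrite /= ?xp //.
  by split=> //; split=> //; rewrite /= xp.
have oI : open ((Psi \o cmap c) @` (dom `&` cdom c')).
  by rewrite imE; exact: smooth_preimage_open oPO oD hPsi'.1.
have imE' : cmap c' @` (dom `&` cdom c') =
    [set y | (cmap c' @` (cdom c `&` cdom c')) y /\ O ((cmap c \o cinv c') y)].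
  apply/seteqP; split=> [_ [x [[cx Ox] c'x] <-]|_ [[x [cx c'x] <-]] /=].
    by split; [exists x|rewrite /= cmapK].
  by rewrite cmapK // => Ox; exists x.
have oI' : open (cmap c' @` (dom `&` cdom c')).
  by rewrite imE'; exact: smooth_preimage_open oD' oO h2.1.
split.
  apply: (holomorphic_comp (f := Psi') (g := cmap c' \o cinv c) oI oD _ h1).
    by apply: holomorphic_sub hPsi'; rewrite imE => y [].
  by move=> y; rewrite imE => -[].
apply: (holomorphic_comp (f := cmap c \o cinv c') (g := Psi) oI' oO _ hPsi).
  by apply: holomorphic_sub h2; rewrite imE' => y [].
by move=> y; rewrite imE' => -[].
Qed.

End chart_change.

(** * Straightening a holomorphic graph *)

Section straightening.
Variables (R : realType) (N l : nat).
Notation C := (Cspace R N).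
Variables (A0 : 'M[R[i]]_N) (Q : set (Cspace R l)) (q : Cspace R l -> C).
Variables (Om : set C) (p0 : C).
Hypotheses (uA0 : A0 \in unitmx) (lN : (l <= N)%N) (oQ : open Q)
  (oOm : open Om).
Hypothesis hq : holomorphic_on Q q.

Let A := realmx A0.
Let A' := realmx (invmx A0).
Let P := realmx (A0 *m (pid_mx l : 'M[R[i]]_(N, l))).
Let P1 := realmx (pid_mx l : 'M[R[i]]_(N, l)).

Hypothesis qP : forall u, Q u -> (q u - p0) *m P = u.

(** The first [l] coordinates of [p - p0] in the basis [A0], which by [qP] are
    the parameter on the graph of [q]. *)
Definition base_coords (p : C) : Cspace R l := (p - p0) *m P.

(** In the basis [A0], subtracts from [p] the point of the graph with the same
    first [l] coordinates, and keeps these coordinates. *)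
Definition straighten (p : C) : C :=
  (p - q (base_coords p)) *m A + Cincl N (base_coords p).

Definition unstraighten (y : C) : C :=
  (y - Cincl N (y *m P1)) *m A' + q (y *m P1).

Definition graph_domain : set C := [set p | Om p /\ Q (base_coords p)].

Let AP1 : A *m P1 = P. Proof. by rewrite -realmxM. Qed.

Let AA' : A *m A' = 1%:M. Proof. by rewrite -realmxM mulmxV // realmx1. Qed.

Let A'A : A' *m A = 1%:M. Proof. by rewrite -realmxM mulVmx // realmx1. Qed.

Let A'P : A' *m P = P1. Proof. by rewrite -AP1 mulmxA A'A mul1mx. Qed.

Let Cincl_P1 (u : Cspace R l) : Cincl N u *m P1 = u.
Proof.
rewrite CinclE -mulmxA -realmxM mul_pid_mx minnn (minn_idPr lN) pid_mx_1.
by rewrite realmx1 mulmx1.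
Qed.

Lemma holomorphic_base_coords (U : set C) : open U ->
  holomorphic_on U base_coords.
Proof.
move=> oU; apply: (holomorphic_mulmxr (f := fun p => p + - p0) oU).
  by apply: (holomorphicD oU); [exact: holomorphic_id|exact: holomorphic_cst].
exact: realmxJ.
Qed.

Lemma graph_domain_open : open graph_domain.
Proof. exact: smooth_preimage_open oOm oQ (holomorphic_base_coords oOm).1. Qed.

Lemma straighten_P1 p : Q (base_coords p) -> straighten p *m P1 = base_coords p.
Proof.
move=> Qp; rewrite /straighten mulmxDl Cincl_P1 -mulmxA AP1.
have -> : p - q (base_coords p) = (p - p0) - (q (base_coords p) - p0).
  by rewrite opprB addrA subrK.
by rewrite mulmxBl qP // subrr add0r.
Qed.

Lemma straightenK p : graph_domain p -> unstraighten (straighten p) = p.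
Proof.
move=> [_ Qp]; rewrite /unstraighten straighten_P1 // /straighten.
by rewrite addrK -mulmxA AA' mulmx1 subrK.
Qed.

Lemma unstraighten_coords y : Q (y *m P1) -> base_coords (unstraighten y) = y
  *m P1.
Proof.
move=> Qy; rewrite /base_coords /unstraighten -addrA mulmxDl qP // -mulmxA A'P.
by rewrite mulmxBl Cincl_P1 subrr add0r.
Qed.

Lemma straighten_image : straighten @` graph_domain =
  [set y | (setT y /\ Q (y *m P1)) /\ Om (unstraighten y)].
Proof.
apply/seteqP; split=> [_ [p [Op Qp] <-]|y [[_ Qy] Oy]].
  split; first by split=> //; rewrite straighten_P1.
  by rewrite straightenK.
have cy := unstraighten_coords Qy.
exists (unstraighten y); first by split; [exact: Oy|rewrite cy].
rewrite /straighten cy /unstraighten addrK -mulmxA A'A mulmx1.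
exact: subrK.
Qed.

Let oU1 : open [set y : C | setT y /\ Q (y *m P1)].
Proof.
have oT := openT (T := C); apply: (smooth_preimage_open oT oQ).
apply/smooth_rowE => //; apply: (smooth_mxM oT); last exact: smooth_mx_cst.
exact: smooth_id.
Qed.

Lemma holomorphic_Cincl (U : set (Cspace R l)) : open U ->
  holomorphic_on U (@Cincl R l N).
Proof.
move=> oU.
apply: (holomorphic_ext
  (f := fun u => u *m realmx (pid_mx l : 'M[R[i]]_(l, N))) oU).
  by move=> u _; rewrite CinclE.
apply: (holomorphic_mulmxr (f := id)) => //; first exact: holomorphic_id.
exact: realmxJ.
Qed.

Lemma holomorphic_straighten : holomorphic_on graph_domain straighten.
Proof.
have oG := graph_domain_open.
have hb := holomorphic_base_coords oG.
apply: (holomorphicD oG).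
  apply: (holomorphic_mulmxr (f := fun p => p + - q (base_coords p)) oG);
    last exact: realmxJ.
  apply: (holomorphicD oG); first exact: holomorphic_id.
  apply: (holomorphicN oG).
  by apply: (holomorphic_comp (f := base_coords) (g := q) oG oQ hb hq) => p [].
have oT := openT (T := Cspace R l).
exact: (holomorphic_comp (f := base_coords) (g := @Cincl R l N) oG oT hb
  (holomorphic_Cincl oT)).
Qed.

Let holomorphic_unstraighten1 :
  holomorphic_on [set y : C | setT y /\ Q (y *m P1)] unstraighten.
Proof.
have hP1 : holomorphic_on [set y : C | setT y /\ Q (y *m P1)]
  (fun y => y *m P1).
  apply: (holomorphic_mulmxr (f := id) oU1); last exact: realmxJ.
  exact: holomorphic_id.
have oT := openT (T := Cspace R l).
apply: (holomorphicD oU1); last first.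
  by apply: (holomorphic_comp (f := fun y => y *m P1) (g := q) oU1 oQ hP1 hq)
    => y [].
apply: (holomorphic_mulmxr (f := fun y => y + - Cincl N (y *m P1)) oU1);
  last exact: realmxJ.
apply: (holomorphicD oU1); first exact: holomorphic_id.
apply: (holomorphicN oU1).
exact: (holomorphic_comp (f := fun y => y *m P1) (g := @Cincl R l N) oU1 oT hP1
  (holomorphic_Cincl oT)).
Qed.

Lemma straighten_image_open : open (straighten @` graph_domain).
Proof.
rewrite straighten_image.
exact: smooth_preimage_open oU1 oOm holomorphic_unstraighten1.1.
Qed.

Lemma holomorphic_unstraighten :
  holomorphic_on (straighten @` graph_domain) unstraighten.
Proof. by apply: holomorphic_sub holomorphic_unstraighten1;
  rewrite straighten_image => y []. Qed.

Lemma straighten_range p : graph_domain p ->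
  range (@Cincl R l N) (straighten p) <-> p = q (base_coords p).
Proof.
move=> [Op Qp]; split=> [[u _ uE]|pE]; last first.
  by exists (base_coords p) => //; rewrite /straighten -pE subrr mul0mx add0r.
have ub : u = base_coords p by rewrite -(straighten_P1 Qp) -uE Cincl_P1.
have /eqP : (p - q (base_coords p)) *m A = 0.
  apply: (addIr (Cincl N (base_coords p))); rewrite add0r -[LHS]/(straighten p).
  by rewrite -uE ub.
move=> /eqP/(congr1 (mulmxr A')); rewrite /= -mulmxA AA' mulmx1 mul0mx.
by move=> /eqP; rewrite subr_eq0 => /eqP.
Qed.

End straightening.

(** * The function rho *)

Section covector_component.
Variables (R : realType) (N : nat).

(** [dz f p a] in terms of the covector [dc f p]. *)
Definition dz_mx (a : 'I_N) : 'M[R]_(N + N, 1 + 1) :=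
  block_mx 0 (2^-1 *: delta_mx a 0) (2^-1 *: delta_mx a 0) 0.

Lemma dz_dc (f : Cspace R N -> R) p a :
  real_coords (const_mx (dz f p a) : 'rV[R[i]]_1) = dc f p *m dz_mx a.
Proof.
rewrite /dc /dz_mx mul_row_block !mulmx0 add0r addr0 -!scalemxAr -!colE.
rewrite /real_coords; congr row_mx; apply/rowP => j; rewrite !mxE /=.
  by rewrite mulrC.
by rewrite mulrN mulrC.
Qed.

(** So the map from covectors to complex numbers is complex linear when i acts
    on covectors as in [cotangentJ]. *)
Lemma dz_mxJ a : Jmx R N *m dz_mx a = - (dz_mx a *m Jmx R 1).
Proof.
rewrite /Jmx /dz_mx !mulmx_block !mulmx0 !mul0mx !mul1mx !mulmx1 !mulmxN
  !mulNmx.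
by rewrite !mul1mx !mulmx1 !add0r !addr0 opp_block_mx !opprK !oppr0.
Qed.

End covector_component.

Lemma dc_ext (R : realType) (N : nat) (U : set (Cspace R N))
    (f g : Cspace R N -> R) p :
  open U -> U p -> (forall q, U q -> f q = g q) -> dc f p = dc g p.
Proof.
move=> oU Up fg; rewrite !dcE; congr (_ *m _); apply/rowP => i; rewrite !mxE.
by apply: near_eq_derive; exact: open_nearby fg.
Qed.

Section combination.
Variables (R : realType) (N k : nat).
Notation C := (Cspace R N).
Variables (rho : 'I_k -> C -> R) (a : 'I_k -> C -> R) (U : set C).
Hypotheses (srho : forall j, smooth_on U (rho j))
  (sa : forall j, smooth_on U (a j)).

(** The coefficients [a j] are not differentiated where the [rho j] vanish. *)
Lemma dc_combination p : U p -> (forall j, rho j p = 0) ->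
  dc (fun q => \sum_j a j q * rho j q) p = \sum_j a j p *: dc (rho j) p.
Proof.
move=> Up r0; rewrite dcE (dc_gradients rho); congr (_ *m _); apply/rowP => i.
rewrite mulmx_sum_row mxE summxE.
rewrite (_ : (fun q => _) = \sum_j (fun q => a j q * rho j q)); last first.
  by apply/funext => q; rewrite fct_sumE.
have da j : differentiable (a j) p by exact: smooth_on_differentiable (sa j) Up.
have dr j : differentiable (rho j) p by exact: smooth_on_differentiable
  (srho j) Up.
rewrite derive_sum; last by move=> j; apply: diff_derivable;
  exact: differentiableM.
apply: eq_bigr => j _; rewrite (@deriveM _ _ (a j) (rho j));
  [|exact: diff_derivable..].
by rewrite r0 !mxE [X in _ + X]scale0r addr0.
Qed.

End combination.

(* The point xi0 of the characteristic bundle is given by its components in an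
   arbitrary holomorphic chart c at x0. *)
Theorem theorem4p6 (R : realType) (n k : nat) (X : complex_manifold R (n + k))
    (M : set X) (x0 : X) (c : chart R X (n + k)) (xi0 : Cspace R (n + k))
    (m : nat)
    (M_generic : generic_CR k M)
    (M_x0 : M x0)
    (c_atlas : cm_atlas c)
    (c_x0 : cdom c x0)
    (xi0_char : char_bundle k c M (row_mx (cmap c x0) xi0))
    (xi0_neq0 : xi0 != 0)
    (xi0_regular :
       regular_point (char_bundle k c M) (row_mx (cmap c x0) xi0))
    (xi0_rank : Levi_rank n (in_chart c M) (char_bundle k c M)
                  (cmap c x0) xi0 m) :
  exists (omega : set X) (z : chart R X (n + k)) (W : set X) (rho : X -> R),
    [/\ [/\ open omega, omega x0, cm_atlas z & cdom z = omega],
        [/\ complex_submanifold (n - m)%N omega W, W x0 &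
            W `<=` M `&` omega],
        [/\ smooth_fun omega rho,
            forall x, (M `&` omega) x -> rho x = 0 &
            dc (rho \o cinv c) (cmap c x0) = xi0] &
        forall a : 'I_(n + k),
          holomorphic_on_submanifold (n - m)%N W
            (fun x => dz (rho \o cinv z) (cmap z x) a)].
Proof.
pose N := (n + k)%N; pose l := (n - m)%N; set p0 := cmap c x0.
have [U [r [Om [L [def [oOm Om0 OmU] srho
    [S_level B_conormal sL LK] indep]]]]] := local_equations c_atlas M_generic M_x0 c_x0.
have [A0 [Q [G [uA0 lN [oQ Q0 sG G0] GP GJ]]]] :=
  holomorphic_lift oOm srho S_level B_conormal sL LK Om0 indep xi0_regular
    xi0_rank.
pose q u := lsubmx (G u).
have dG u : Q u -> differentiable G u by exact: smooth_on_differentiable.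
have hq : holomorphic_on Q q.
  apply/holomorphic_onP; split.
    have oT := openT (T := Tspace R (n + k)).
    exact: (smooth_comp (U' := setT) (F := fun w => lsubmx w) oQ oT sG
      (smooth_lsubmx oT)).
  move=> u v Qu; have [_ ->] := derive_lsubmx (v *m Jmx R l) (dG _ Qu).
  have [_ ->] := derive_lsubmx v (dG _ Qu).
  by rewrite -JmulE GJ // row_mxKl.
have qP u : Q u -> (q u - p0) *m realmx (A0 *m (pid_mx l : 'M[R[i]]_(N, l))) =
  u.
  by move=> /GP[].
(* The coordinate neighborhood, in which [z1] straightens [W] while [z] is a
   restriction of [c]. *)
pose b := @base_coords R N l A0 p0.
pose O := graph_domain A0 Q Om p0.
have oO : open O by exact: graph_domain_open.
have OOm : O `<=` Om by move=> p [].
have OQ p : O p -> Q (b p) by case.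
have Ocimg : O `<=` cimg c.
  by move=> p /OOm/OmU[x [_ cx] <-]; exists x.
have b0 : b p0 = 0 by rewrite /b /base_coords subrr mul0mx.
have Op0 : O p0 by split; [exact: Om0|rewrite -/(b p0) b0].
have oI := straighten_image_open uA0 lN oQ oOm hq qP.
have sK p := straightenK uA0 lN qP (Om := Om) (p := p).
have hS := holomorphic_straighten A0 p0 oQ oOm hq.
have hU := holomorphic_unstraighten Om uA0 lN oQ hq qP.
pose z1 := changed_chart oO Ocimg oI sK hS hU.
have z1_atlas : cm_atlas z1 by exact: changed_chart_atlas.
have oidO : open (id @` O) by rewrite image_id.
have hid' : holomorphic_on (id @` O) id.
  by rewrite image_id; exact: holomorphic_id.
pose z := changed_chart oO Ocimg oidO (fun p _ => erefl)
  (holomorphic_id oO) hid'.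
have z_atlas : cm_atlas z by exact: changed_chart_atlas.
pose omega : set X := cdom c `&` cmap c @^-1` O.
pose W : set X := [set x | omega x /\ cmap c x = q (b (cmap c x))].
(* The coefficients of the lifted covector at the point of [W] with the same
   base coordinates as [p]. *)
pose coef j p := coeffs L (G (b p)) 0 j.
pose rho x := \sum_j coef j (cmap c x) * r j x.
have hb : holomorphic_on O b by exact: holomorphic_base_coords.
have scoef j : smooth_on O (coef j).
  have sGb : smooth_on O (G \o b) := smooth_comp oO oQ hb.1 sG OQ.
  have := smooth_comp_scalar oO sGb (smooth_entry j (base_open oOm)
    (smooth_coeffs oOm sL)).
  by apply=> p /OQ/GP[OG _ _]; exact: (conj I OG).
have srhoO j : smooth_on O (local_rho c r j) by exact: smooth_on_sub (srho j).
pose rhoh p := \sum_j coef j p * local_rho c r j p.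
have rhohE p : O p -> rhoh p = (rho \o cinv c) p.
  move=> /Ocimg[x cx <-]; rewrite /rhoh /rho /=; apply: eq_bigr => j _.
  by rewrite /local_rho /= !cmapK.
have srhoh : smooth_on O rhoh.
  by apply: smooth_sum => // j; exact: smoothM.
have srhoc : smooth_on O (rho \o cinv c) by exact: smooth_on_ext rhohE srhoh.
have qM u : Q u -> in_chart c M (q u) /\
    rsubmx (G u) = coeffs L (G u) *m (gradients (local_rho c r) (q u))^T *m Jmx
      R N.
  by move=> /GP[OG BG _]; exact: (char_bundle_coords B_conormal LK OG BG).
have dc_graph p : O p -> p = q (b p) -> dc (rho \o cinv c) p = rsubmx (G (b p)).
  move=> Op pq; have Qb := OQ _ Op; have [Mq ->] := qM _ Qb.
  have r0 j : local_rho c r j p = 0.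
    have [OG _ _] := GP _ Qb.
    have := (S_level _ OG).1 Mq; rewrite -/(q (b p)) -pq.
    by move=> /(congr1 (fun v : 'rV_k => v 0 j)); rewrite !mxE.
  have -> : dc (rho \o cinv c) p = dc rhoh p.
    by apply: (dc_ext oO Op) => p' Op'; rewrite rhohE.
  rewrite (dc_combination srhoO scoef Op r0) dc_gradients -pq.
  by congr (_ *m _ *m _); apply/rowP => j; rewrite mxE.
have omega0 : omega x0 by split.
have qb0 : p0 = q (b p0) by rewrite b0 /q G0 row_mxKl.
exists omega, z, W, rho; split.
- by split; [exact: open_chart_preimage|exact: omega0|exact: z_atlas|].
- split; [|by split|].
    split; first by move=> x [].
    move=> w [ow wW]; exists z1; split;
      [split; [exact: z1_atlas|]|exact: ow|by []].
    apply/seteqP; split=> [_ [x [[[cx Ox] xW] _] <-]|y [[x [cx Ox] <-] yR]].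
      split; first by exists x.
      exact/(straighten_range uA0 lN qP Ox).
    exists x => //; split; [split=> //|by split].
    exact/(straighten_range uA0 lN qP Ox).
  move=> x [[cx Ox] xW]; split; last by split.
  have [[x' [Mx' cx'] xx'] _] := qM _ (OQ _ Ox).
  by rewrite -(cmapK cx) xW -xx' cmapK.
- split.
  + move=> c' c'_atlas; have [h1 h2] := cm_compatible c_atlas c'_atlas.
    have oD : open (cmap c' @` (cdom c `&` cdom c')).
      by apply: open_chart_image; exact: cdom_open.
    have oD' : open (cmap c' @` (omega `&` cdom c')).
      by apply: open_chart_image; exact: open_chart_preimage.
    have sub : cmap c' @` (omega `&` cdom c') `<=` cmap c' @`
      (cdom c `&` cdom c').
      by move=> _ [x [[cx _] c'x] <-]; exists x.
    have sc := smooth_on_sub sub h2.1.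
    have mapO y : (cmap c' @` (omega `&` cdom c')) y ->
      O ((cmap c \o cinv c') y).
      by move=> [x [[cx Ox] c'x] <-]; rewrite /= cmapK.
    apply: smooth_on_ext (smooth_comp_scalar oD' sc srhoc mapO) => //.
    by move=> _ [x [[cx Ox] c'x] <-]; rewrite /= !cmapK.
  + move=> x [Mx [cx Ox]]; rewrite /rho big1 // => j _.
    have Sx : in_chart c M (cmap c x) by exists x.
    have := (S_level _ (OOm _ Ox)).1 Sx.
    move=> /(congr1 (fun v : 'rV_k => v 0 j));
      rewrite !mxE /local_rho /= cmapK // => ->.
    by rewrite mulr0.
  + by rewrite -/p0 dc_graph // b0 G0 row_mxKr.
move=> a c' [c'_atlas c'W].
have [h1 h2] := cm_compatible c_atlas c'_atlas.
have oD : open (cmap c' @` (cdom c `&` cdom c')).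
  by apply: open_chart_image; exact: cdom_open.
pose I := @Cincl R l N @^-1` cimg c'.
have oT := openT (T := Cspace R l).
have hI := holomorphic_Cincl N oT.
have oI' : open I.
  have oC : open (cimg c') by exact: cimg_open.
  rewrite (_ : I = [set u | setT u /\ cimg c' (Cincl N u)]).
    exact: smooth_preimage_open oT oC hI.1.
  by apply/seteqP; split=> [u Iu|u []].
have IW u : I u -> exists x, [/\ W x, cdom c' x & cmap c' x = Cincl N u].
  move=> Iu; have : (cimg c' `&` range (@Cincl R l N)) (Cincl N u)
    by split=> //; exists u.
  by rewrite -c'W => -[x [Wx c'x] xu]; exists x.
pose F (u : Cspace R l) := (cmap c \o cinv c') (Cincl N u).
have hF : holomorphic_on I F.
  apply: (holomorphic_comp (f := @Cincl R l N) (g := cmap c \o cinv c') oI' oD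
    _ h2).
    exact: holomorphic_sub hI.
  by move=> u /IW[x [[[cx _] _] c'x <-]]; exists x.
have FW u : I u -> O (F u) /\ F u = q (b (F u)).
  by move=> /IW[x [[[cx Ox] xW] c'x xu]]; rewrite /F -xu /= cmapK.
(* The derivative of [rho] as a function of the parameter of [W]; a slice chart
   only reparametrizes it by the holomorphic map [b \o F]. *)
have hxi : holomorphic_on Q (fun u => rsubmx (G u) *m dz_mx R a).
  have oTT := openT (T := Tspace R (n + k)).
  have sxi : smooth_on Q (fun u => rsubmx (G u)) :=
    smooth_comp (U' := setT) (F := fun w => rsubmx w) oQ oTT sG
      (smooth_rsubmx oTT) (fun _ _ => Logic.I).
  apply/holomorphic_onP; split.
    apply/smooth_rowE => //; apply: (smooth_mxM oQ _ (smooth_mx_cst oQ _)).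
    exact/smooth_rowE.
  have dxi u : Q u -> differentiable (fun u => rsubmx (G u)) u.
    exact: smooth_on_differentiable.
  move=> u v Qu; have [_ ->] := derive_mulmxr (dz_mx R a) (v *m Jmx R l)
    (dxi _ Qu).
  have [_ ->] := derive_mulmxr (dz_mx R a) v (dxi _ Qu).
  have [_ ->] := derive_rsubmx (v *m Jmx R l) (dG _ Qu).
  have [_ ->] := derive_rsubmx v (dG _ Qu).
  by rewrite -JmulE GJ // row_mxKr !mulNmx -[in LHS]mulmxA dz_mxJ mulmxN opprK
    mulmxA.
apply: (holomorphic_ext (f := fun u => rsubmx (G (b (F u))) *m dz_mx R a) oI').
  move=> u Iu; have [OF Fq] := FW _ Iu.
  by rewrite dz_dc dc_graph.
have FO u : I u -> O (F u) by move=> /FW[].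
have hbF := holomorphic_comp oI' oO hF hb FO.
by apply: (holomorphic_comp (f := b \o F)
  (g := fun u => rsubmx (G u) *m dz_mx R a) oI' oQ hbF hxi) => u /FO/OQ.
Qed.
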